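(* Let $(\mathfrak g,l_1,l_2,\dots)$ be an sh Lie algebra equipped with a differential $d$ of degree $+1$ (so $d^2=0$) which is a derivation of $l_n$ for each $n$. Then the system of derived homotopies $$(\pm)^i_m\,l_m(d^{\otimes i}\otimes1^{\otimes m-i}),\qquad m\ge1,\ 0\le i\le m-1,\qquad (\pm)^i_m:=(-1)^{\frac{(2m+i-1)i}{2}},$$ where $(\pm)^i_ml_m(d^{\otimes i}\otimes1^{\otimes m-i})$ is given arity $(\underbrace{1,\dots,1}_{i},m-i)$, defines an $\mathcal{LL}_\infty$-algebra structure on $\mathfrak g$. That is, $\partial_{shLL}:=\sum_{m\ge1}\sum_{i=0}^{m-1}\partial_m^{(i)}$ is a codifferential of degree $-1$ on $\bar Ts\bar Ss\mathfrak g$, where $\partial_m^{(i)}$ is the coderivation induced by $$(\pm)^i_m\,s\Big(s\,l_m(d^{\otimes i}\otimes1^{\otimes m-i})(s^{-1})^{\otimes m}\Big)\big((s^{-1})^{\otimes i}\otimes s^{-1}\big):(ss\mathfrak g)^{\otimes i}\otimes s\bar S^{m-i}s\mathfrak g\to ss\mathfrak g .$$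
   Context: Field of characteristic zero; Koszul sign rule; $s$ is the degree $+1$ shift. $\bar SV=\bigoplus_{n\ge1}\bar S^nV$ (graded symmetric powers), $\bar TW=\bigoplus_{n\ge1}W^{\otimes n}$. sh Lie algebra: a graded space $\mathfrak g$ with graded anti-symmetric maps $l_n:\mathfrak g^{\otimes n}\to\mathfrak g$ of degree $n-2$, $n\ge1$, such that the sum $\sum_n\partial_n$ of the coderivations of the commutative coalgebra $\bar S(s\mathfrak g)$ induced by $\partial_n=s\,l_n(s^{-1}\otimes\cdots\otimes s^{-1}):\bar S^n(s\mathfrak g)\to s\mathfrak g$ has square zero. $d$ is a derivation of $l_n$ in the graded sense: $d\,l_n=(-1)^{|l_n|}l_n\sum_{a+b=n-1}1^{\otimes a}\otimes d\otimes1^{\otimes b}$. $\mathcal{LL}_\infty$-algebra (strong homotopy Lie-Leibniz algebra): a graded space $\mathfrak g$ with a codifferential (coderivation of square zero) of degree $-1$ on $\bar Ts\bar Ss\mathfrak g$. Bar coalgebra. Write $\mathrm{unshuff}_i(w_1\cdots w_n)=\sum_\sigma\varepsilon(\sigma)(w_{\sigma(1)}\cdots w_{\sigma(i)},w_{\sigma(i+1)}\cdots w_{\sigma(n)})$ over $(i,n-i)$-unshuffles ($\varepsilon$ the Koszul sign), and $\mathrm{unshuff}_i^{(a,b)}$ for the sub-sum with $w_a$ in the left and $w_b$ in the right word ($a=\emptyset$: no condition on the left). Let $\Delta_c^0=\sum_{i=1}^{n-1}\mathrm{unshuff}_i$ on $\bar S^nV$ and $\Delta_c=(s\otimes s)\Delta_c^0s^{-1}$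 on $s\bar SV$. With $V=s\mathfrak g$, $\bar Ts\bar Ss\mathfrak g$ is the cofree (nilpotent) $\mathcal{Z}inb\odot\mathbf{s}\mathcal{C}om$-coalgebra cogenerated by $ss\mathfrak g$, with $\Delta_z(sc_1\otimes\cdots\otimes sc_n)=\sum_{i=1}^{n-1}\mathrm{unshuff}_i^{(\emptyset,n)}(sc_1\otimes\cdots\otimes sc_n)$ and $\Delta_c(sc_1\otimes\cdots\otimes sc_n)=A-\tau A+B$, where $\tau$ is the graded flip, $A=\sum_{k=1}^{n-1}\sum_{i=1}^{n-1}\mathrm{unshuff}_i^{(k,n)}(-1)^{|sc_1|+\cdots+|sc_{k-1}|}(sc_1\otimes\cdots\otimes\Delta_c(sc_k)\otimes\cdots\otimes sc_n)$ ($\Delta_c(sc_k)$ treated as one letter), $B=\big(\sum_{i=0}^{n-1}\mathrm{unshuff}_i(-1)^{|sc_1|+\cdots+|sc_{n-1}|}(sc_1\otimes\cdots\otimes sc_{n-1})\big)\otimes\Delta_c(sc_n)$ componentwise. A coderivation is an endomorphism $\partial$ with $(\partial\otimes1+1\otimes\partial)\Delta_z=\Delta_z\partial$ and $(-1)^{|\partial|}(\partial\otimes1+1\otimes\partial)\Delta_c=\Delta_c\partial$; coderivations correspond bijectively, by projection to $ss\mathfrak g$, to linear maps $\bar Ts\bar Ss\mathfrak g\to ss\mathfrak g$, and the coderivation induced by a map (extended by zero on the other summands) is the corresponding one. *)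

(* Defs.v *)
From HB Require Import structures.
From mathcomp Require Import all_boot all_order all_algebra.
From mathcomp Require Import generic_quotient ring_quotient boolp.
From mathcomp.multinomials Require Import freeg.
From mathcomp Require Import ring.

Set Implicit Arguments.
Unset Strict Implicit.
Unset Printing Implicit Defensive.

Import GRing.Theory.
Local Open Scope ring_scope.
Local Open Scope quotient_scope.

(* The K-module presented by generators T and relators R; the finite list     *)
(* r = [(c_1,t_1),...] stands for the relation \sum_i c_i t_i = 0.            *)
Section Presentation.
Variables (K : fieldType) (T : choiceType) (R : seq (K * T) -> Prop).

Lemma fglift_linear (M : lmodType K) (F : T -> M) : linear (fglift F).
Proof.
have addF : additive (fglift F) by exact: lift_is_additive.
pose HF := GRing.isAdditive.Build _ _ (fglift F) addF.
pose f : {additive {freeg T / K} -> M} := HB.pack (fglift F) HF.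
move=> a x y.
have -> : fglift F (a *: x + y) = f (a *: x) + f y by exact: raddfD f _ _.
congr (_ + _).
have -> : a *: x = \sum_(z <- dom x) << (a * coeff z x) *g z >> by [].
rewrite raddf_sum -[in RHS](freeg_sumE x).
have -> : fglift F (\sum_(z <- dom x) << coeff z x *g z >>) =
  f (\sum_(z <- dom x) << coeff z x *g z >>) by [].
rewrite raddf_sum scaler_sumr; apply: eq_bigr => z _ /=.
by rewrite !liftU scalerA.
Qed.

(* The submodule generated by the relators.                                   *)
Definition rel_sub : {pred {freeg T / K}} := fun x =>
  `[< forall P : {freeg T / K} -> Prop,
        P 0 -> (forall a u v, P u -> P v -> P (a *: u + v)) ->
        (forall r, R r -> P [freeg r]) -> P x >].

Lemma rel_sub0 : 0 \in rel_sub.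
Proof. by apply/asboolP => P P0 _ _. Qed.

Lemma rel_subP a : {in rel_sub &, forall u v, a *: u + v \in rel_sub}.
Proof.
move=> u v /asboolP Hu /asboolP Hv; apply/asboolP => P P0 PD PR.
by apply: (PD); [apply: Hu|apply: Hv].
Qed.

Lemma rel_sub_zmod : zmod_closed rel_sub.
Proof.
split=> [|u v Hu Hv]; first exact: rel_sub0.
by rewrite -scaleN1r addrC; apply: rel_subP.
Qed.

HB.instance Definition _ := GRing.isZmodClosed.Build _ rel_sub rel_sub_zmod.

Definition pres := Quotient.quot rel_sub.
HB.instance Definition _ := GRing.Zmodule.on pres.

Definition pres_pi (x : {freeg T / K}) : pres := \pi_pres x.

Lemma pres_piE x y : (pres_pi x == pres_pi y) = (x - y \in rel_sub).
Proof. by rewrite Quotient.idealrBE. Qed.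

Lemma pres_piB x y : pres_pi (x - y) = pres_pi x - pres_pi y.
Proof. exact: raddfB. Qed.

Lemma pres_piD x y : pres_pi (x + y) = pres_pi x + pres_pi y.
Proof. exact: raddfD. Qed.

Definition pscale (a : K) (x : pres) : pres := pres_pi (a *: repr x).

Lemma pres_piK (x : pres) : pres_pi (repr x) = x.
Proof. exact: reprK. Qed.

Lemma pscaleE a x : pscale a (pres_pi x) = pres_pi (a *: x).
Proof.
apply/eqP; rewrite pres_piE -scalerBr -[_ *: _]addr0.
by apply: rel_subP rel_sub0; rewrite -pres_piE pres_piK.
Qed.

Lemma pscaleA a b x : pscale a (pscale b x) = pscale (a * b) x.
Proof. by rewrite -[x]pres_piK !pscaleE scalerA. Qed.

Lemma pscale1 : left_id 1 pscale.
Proof. by move=> x; rewrite -[x]pres_piK pscaleE scale1r. Qed.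

Lemma pscaleDr : right_distributive pscale +%R.
Proof.
move=> a x y; rewrite -[x]pres_piK -[y]pres_piK -pres_piD !pscaleE.
by rewrite scalerDr pres_piD.
Qed.

Lemma pscaleDl x : {morph pscale^~ x : a b / a + b}.
Proof. by move=> a b; rewrite -[x]pres_piK !pscaleE scalerDl pres_piD. Qed.

HB.instance Definition _ :=
  GRing.Zmodule_isLmodule.Build K pres pscaleA pscale1 pscaleDr pscaleDl.

Definition pgen (t : T) : pres := pres_pi << t >>.

Lemma pres_pi_freeg s : pres_pi [freeg s] = \sum_(c <- s) c.1 *: pgen c.2.
Proof.
elim: s => [|[a t] s IHs]; first by rewrite freeg_nil big_nil; exact: raddf0.
rewrite big_cons -IHs -cat1s freeg_cat pres_piD /=; congr (_ + _).
rewrite /pgen; apply: etrans (_ : pres_pi (a *: << t >>) = _); last first.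
  by rewrite -pscaleE.
congr pres_pi; apply/eqP/freeg_eqP => z.
by rewrite coeffZ !coeffU mul1r.
Qed.

Lemma pgen_rel r : R r -> \sum_(c <- r) c.1 *: pgen c.2 = 0.
Proof.
move=> Rr; rewrite -pres_pi_freeg.
have -> : (0 : pres) = pres_pi 0 by symmetry; exact: raddf0.
apply/eqP; rewrite pres_piE subr0.
by apply/asboolP => P _ _; apply.
Qed.

Lemma pres_ind (P : pres -> Prop) :
  P 0 -> (forall a t x, P x -> P (a *: pgen t + x)) -> forall x, P x.
Proof.
move=> P0 PD x; rewrite -[x]pres_piK -(Freeg_enum (repr x)) pres_pi_freeg.
by elim: (fgenum _) => [|c s IHs]; rewrite ?big_nil // big_cons; apply: PD.
Qed.

Section Lift.
Variables (M : lmodType K) (F : T -> M).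
Hypothesis FR : forall r, R r -> \sum_(c <- r) c.1 *: F c.2 = 0.

Definition plift_fun (x : pres) : M := fglift F (repr x).

Lemma plift_pi x : plift_fun (pres_pi x) = fglift F x.
Proof.
have lF := fglift_linear F.
have F0 : fglift F 0 = 0.
  by rewrite -(freeg_nil K T) fglift_Freeg prelift_nil.
apply/eqP; rewrite -subr_eq0 -scaleN1r addrC -lF scaleN1r; apply/eqP.
have : - x + repr (pres_pi x) \in rel_sub.
  by rewrite addrC -pres_piE pres_piK.
move=> /asboolP H; apply: (H (fun z => fglift F z = 0)) => //.
- by move=> a u v Fu Fv; rewrite lF Fu Fv scaler0 addr0.
- by move=> r /FR; rewrite fglift_Freeg.
Qed.

Lemma plift_is_linear : linear plift_fun.
Proof.
move=> a x y; rewrite -[x]pres_piK -[y]pres_piK.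
have -> : a *: pres_pi (repr x) + pres_pi (repr y) =
  pres_pi (a *: repr x + repr y) by rewrite pres_piD -pscaleE.
by rewrite !plift_pi fglift_linear.
Qed.

HB.instance Definition _ :=
  GRing.isLinear.Build K pres M _ plift_fun plift_is_linear.

Definition plift : {linear pres -> M} := plift_fun.

Lemma plift_gen t : plift (pgen t) = F t.
Proof. by rewrite /plift /= plift_pi liftU scale1r. Qed.

End Lift.

End Presentation.

Definition eps {K : fieldType} (z : int) : K := (-1) ^ z.

(* A Z-graded vector space, as a module with the projections onto its         *)
(* homogeneous components; x is homogeneous of degree k iff gproj k x = x.    *)
Record gmod (K : fieldType) := Gmod {
  gsort :> lmodType K;
  gproj : int -> {linear gsort -> gsort};
  gproj_proj : forall j k x,
    gproj j (gproj k x) = if j == k then gproj k x else 0;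
  gproj_fin : forall x,
    exists2 s : seq int, uniq s & x = \sum_(k <- s) gproj k x }.

(* A homogeneous element together with a degree (relevant only for 0).        *)
Record helt (K : fieldType) (V : gmod K) := MkHelt {
  hpair : int * V;
  _ : gproj V hpair.1 hpair.2 == hpair.2 }.

HB.instance Definition _ K V := [isSub for @hpair K V].
HB.instance Definition _ K V := [Choice of @helt K V by <:].

Section Helt.
Variables (K : fieldType) (V : gmod K).

Definition hdeg (x : helt V) : int := (hpair x).1.
Definition hval (x : helt V) : V := (hpair x).2.

Lemma heltP (x : helt V) : gproj V (hdeg x) (hval x) = hval x.
Proof. by case: x => p H; apply/eqP. Qed.

Definition Helt (k : int) (x : V) (Hx : gproj V k x = x) : helt V :=
  @MkHelt K V (k, x) (introT eqP Hx).

Definition helt0 : helt V := Helt (raddf0 (gproj V 0)).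

Definition hlin (a : K) (x y z : helt V) : Prop :=
  [/\ hdeg x = hdeg z, hdeg y = hdeg z & hval z = a *: hval x + hval y].

Definition wdeg (w : seq (helt V)) : int := \sum_(x <- w) hdeg x.

Lemma helt_eq (x y : helt V) : hdeg x = hdeg y -> hval x = hval y -> x = y.
Proof.
move=> Hd Hv; apply: val_inj => /=.
by move: Hd Hv; rewrite /hdeg /hval; case: (hpair x) (hpair y) => ? ? [? ?] /= -> ->.
Qed.

End Helt.

(* When generators have degrees and relators are homogeneous, the presented   *)
(* module is graded.                                                          *)
Section Gpres.
Variables (K : fieldType) (T : choiceType) (deg : T -> int).
Variable R : seq (K * T) -> Prop.
Hypothesis RH : forall r, R r -> exists k, forall c, c \in r -> deg c.2 = k.

Definition gpres_projF (k : int) (t : T) : pres R :=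
  if deg t == k then pgen R t else 0.

Lemma gpres_projR k r : R r -> \sum_(c <- r) c.1 *: gpres_projF k c.2 = 0.
Proof.
move=> Rr; have [j Hj] := RH Rr.
rewrite (eq_big_seq (fun c => if j == k then c.1 *: pgen R c.2 else 0)).
  by case: eqP => _; [exact: pgen_rel|rewrite big1].
by move=> c /Hj; rewrite /gpres_projF => ->; case: eqP; rewrite ?scaler0.
Qed.

Definition gpres_proj k : {linear pres R -> pres R} := plift (@gpres_projR k).

Lemma gpres_proj_gen k t :
  gpres_proj k (pgen R t) = if deg t == k then pgen R t else 0.
Proof. exact: plift_gen. Qed.

Lemma gpres_proj_proj j k x :
  gpres_proj j (gpres_proj k x) = if j == k then gpres_proj k x else 0.
Proof.
elim/pres_ind: x => [|a t x IH]; first by rewrite !raddf0 if_same.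
rewrite !linearP IH gpres_proj_gen.
have [<-|neq] := eqVneq (deg t) k; last first.
  by rewrite raddf0 scaler0 !add0r.
rewrite gpres_proj_gen eq_sym.
by case: ifP => _; rewrite ?scaler0 ?add0r.
Qed.

Lemma gpres_proj_fin x :
  exists2 s : seq int, uniq s & x = \sum_(k <- s) gpres_proj k x.
Proof.
elim/pres_ind: x => [|a t x [s us Ex]].
  by exists [::] => //; rewrite big_nil.
have Nx k : k \notin s -> gpres_proj k x = 0.
  move=> ks; rewrite Ex raddf_sum big_seq big1 // => j js.
  rewrite [LHS]gpres_proj_proj; case: eqP => // kj.
  by rewrite kj js in ks.
exists (undup (deg t :: s)); first exact: undup_uniq.
under eq_bigr do rewrite linearP.
rewrite big_split /= -scaler_sumr; congr (_ *: _ + _).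
  have dt : deg t \in undup (deg t :: s) by rewrite mem_undup mem_head.
  rewrite (bigD1_seq _ dt (undup_uniq _)).
  rewrite /= gpres_proj_gen eqxx big1 ?addr0 // => k /negPf nk.
  by rewrite gpres_proj_gen eq_sym nk.
have [ts|ts] := boolP (deg t \in s).
  by rewrite /= undup_id.
by rewrite /= undup_id // big_cons -/(gpres_proj _) Nx // add0r.
Qed.

Definition gpres : gmod K := Gmod gpres_proj_proj gpres_proj_fin.

Definition ggen (t : T) : gpres := pgen R t.

Lemma ggenP t : gproj gpres (deg t) (ggen t) = ggen t.
Proof. by rewrite /= gpres_proj_gen eqxx. Qed.

Definition hgen (t : T) : helt gpres := Helt (ggenP t).

End Gpres.

Section Ghom.
Variable K : fieldType.

(* Linear maps that are homogeneous of degree p.                              *)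
Record ghom (p : int) (V W : gmod K) := Ghom {
  gfun :> {linear V -> W};
  ghomP : forall k x, gproj V k x = x -> gproj W (k + p) (gfun x) = gfun x }.

Definition happ p (V W : gmod K) (f : ghom p V W) (x : helt V) : helt W :=
  Helt (ghomP f (heltP x)).

Lemma gid_subproof (V : gmod K) k x :
  gproj V k x = x -> gproj V (k + 0) (idfun x) = idfun x.
Proof. by rewrite addr0. Qed.

Definition gid (V : gmod K) : ghom 0 V V :=
  @Ghom 0 V V idfun (@gid_subproof V).

(* The shift sV has the same underlying module, (sV)_k = V_(k-1), so that s   *)
(* and s^-1 below are the identity with degrees 1 and -1.                     *)
Lemma gshift_proj (V : gmod K) j k x :
  gproj V (j - 1) (gproj V (k - 1) x) =
  if j == k then gproj V (k - 1) x else 0.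
Proof. by rewrite gproj_proj (inj_eq (addIr _)). Qed.

Lemma gshift_fin (V : gmod K) (x : V) :
  exists2 s : seq int, uniq s & x = \sum_(k <- s) gproj V (k - 1) x.
Proof.
have [s us Ex] := gproj_fin x; exists [seq k + 1 | k <- s].
  by rewrite map_inj_uniq //; apply: addIr.
by rewrite big_map {1}Ex; apply: eq_bigr => k _; rewrite addrK.
Qed.

Definition gshift (V : gmod K) : gmod K :=
  @Gmod K V (fun k => gproj V (k - 1)) (@gshift_proj V) (@gshift_fin V).

Lemma susp_subproof (V : gmod K) k (x : V) :
  gproj V k x = x -> gproj V (k + 1 - 1) (idfun x) = idfun x.
Proof. by rewrite addrK. Qed.

Definition susp (V : gmod K) : ghom 1 V (gshift V) :=
  @Ghom 1 V (gshift V) idfun (@susp_subproof V).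

Definition desusp (V : gmod K) : ghom (- 1) (gshift V) V :=
  @Ghom (- 1) (gshift V) V idfun (fun k x H => H).

End Ghom.

Section Tensor.
Variable K : fieldType.

(* The tensor product of graded spaces is generated by the x (x) y with x, y  *)
(* homogeneous.                                                               *)
Inductive tens_rel (V W : gmod K) : seq (K * (helt V * helt W)) -> Prop :=
| Tens_relL a x y z w of hlin a x y z :
    tens_rel [:: (1, (z, w)); (- a, (x, w)); (- 1, (y, w))]
| Tens_relR a x y z v of hlin a x y z :
    tens_rel [:: (1, (v, z)); (- a, (v, x)); (- 1, (v, y))].

Definition tens_deg (V W : gmod K) (t : helt V * helt W) : int :=
  hdeg t.1 + hdeg t.2.

Lemma tens_relH (V W : gmod K) r :
  tens_rel r -> exists k, forall c, c \in r -> @tens_deg V W c.2 = k.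
Proof.
case=> a x y z w [Hx Hy _].
- exists (tens_deg (z, w)) => c; rewrite !inE.
  by case/or3P => /eqP -> //=; rewrite /tens_deg /= ?Hx ?Hy.
- exists (tens_deg (w, z)) => c; rewrite !inE.
  by case/or3P => /eqP -> //=; rewrite /tens_deg /= ?Hx ?Hy.
Qed.

Definition tens (V W : gmod K) : gmod K := gpres (@tens_relH V W).

Definition tpair (V W : gmod K) (x : helt V) (y : helt W) : tens V W :=
  ggen (@tens_relH V W) (x, y).

Lemma rel3 (M : lmodType K) a (A B C : M) :
  C = a *: A + B <-> 1 *: C + (- a *: A + (-1 *: B + 0)) = 0.
Proof.
rewrite addr0 scale1r scaleNr scaleN1r -opprD.
by split=> [->|/eqP]; rewrite ?subrr // subr_eq0 => /eqP.
Qed.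

Lemma tpairL (V W : gmod K) a x y z (w : helt W) : @hlin K V a x y z ->
  tpair z w = a *: tpair x w + tpair y w.
Proof.
by move=> /(Tens_relL w)/pgen_rel; rewrite !big_cons big_nil => /rel3.
Qed.

Lemma tpairR (V W : gmod K) a x y z (v : helt V) : @hlin K W a x y z ->
  tpair v z = a *: tpair v x + tpair v y.
Proof.
by move=> /(Tens_relR v)/pgen_rel; rewrite !big_cons big_nil => /rel3.
Qed.

Section Lift.
Variables (V W : gmod K) (M : lmodType K) (F : helt V -> helt W -> M).

Definition bilin : Prop :=
  (forall a x y z w, hlin a x y z -> F z w = a *: F x w + F y w) /\
  (forall a x y z v, hlin a x y z -> F v z = a *: F v x + F v y).

Hypothesis FB : bilin.

Lemma tens_liftR r :
  tens_rel r -> \sum_(c <- r) c.1 *: F c.2.1 c.2.2 = 0.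
Proof.
case: FB => FL FR; case=> a x y z w H; rewrite !big_cons big_nil; apply/rel3.
- exact: FL.
- exact: FR.
Qed.

Definition tens_lift : {linear tens V W -> M} :=
  @plift K _ (@tens_rel V W) M (fun t => F t.1 t.2) tens_liftR.

Lemma tens_liftE x y : tens_lift (tpair x y) = F x y.
Proof. exact: plift_gen. Qed.

End Lift.

Lemma tens_ind (V W : gmod K) (P : tens V W -> Prop) :
  P 0 -> (forall a x y t, P t -> P (a *: tpair x y + t)) -> forall t, P t.
Proof. by move=> P0 PD; apply: pres_ind => // a [x y] t; apply: PD. Qed.

Lemma hlin_happ p (V W : gmod K) (f : ghom p V W) a x y z :
  hlin a x y z -> hlin a (happ f x) (happ f y) (happ f z).
Proof.
case=> Hx Hy Hv; split; rewrite /hdeg /= -?/(hdeg _) ?Hx ?Hy //.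
by rewrite /hval /= -!/(hval _) Hv linearP.
Qed.

Section Tmap.
Variables (p q : int) (V V' W W' : gmod K) (f : ghom p V V') (g : ghom q W W').

(* (f (x) g)(x (x) y) = (-1)^(|g||x|) f x (x) g y                             *)
Definition tmapF (x : helt V) (y : helt W) : tens V' W' :=
  eps (q * hdeg x) *: tpair (happ f x) (happ g y).

Lemma tmapB : bilin tmapF.
Proof.
split=> a x y z w H; rewrite /tmapF.
- have [-> -> _] := H.
  by rewrite (tpairL _ (hlin_happ f H)) scalerDr !scalerA mulrC.
- by rewrite (tpairR _ (hlin_happ g H)) scalerDr !scalerA mulrC.
Qed.

Definition tmap : {linear tens V W -> tens V' W'} := tens_lift tmapB.

Lemma tmapE x y :
  tmap (tpair x y) = eps (q * hdeg x) *: tpair (happ f x) (happ g y).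
Proof. exact: tens_liftE. Qed.

End Tmap.

Section Flip.
Variables V W : gmod K.

Definition flipF (x : helt V) (y : helt W) : tens W V :=
  eps (hdeg x * hdeg y) *: tpair y x.

Lemma flipB : bilin flipF.
Proof.
split=> a x y z w H; rewrite /flipF; have [-> -> _] := H.
- by rewrite (tpairR _ H) scalerDr !scalerA mulrC.
- by rewrite (tpairL _ H) scalerDr !scalerA mulrC.
Qed.

Definition flip : {linear tens V W -> tens W V} := tens_lift flipB.

Lemma flipE x y : flip (tpair x y) = eps (hdeg x * hdeg y) *: tpair y x.
Proof. exact: tens_liftE. Qed.

End Flip.

End Tensor.

Section Words.
Variables (K : fieldType) (V : gmod K).
Implicit Types w : seq (helt V).

(* The generators of Tbar V and Sbar V are words of homogeneous elements of   *)
(* V; the empty word is set to 0, as both spaces start in arity 1.            *)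
Inductive tword_rel : seq (K * seq (helt V)) -> Prop :=
| Tword_nil : tword_rel [:: (1, [::])]
| Tword_lin a x y z p q of hlin a x y z :
    tword_rel [:: (1, p ++ z :: q); (- a, p ++ x :: q); (- 1, p ++ y :: q)].

Inductive sword_rel : seq (K * seq (helt V)) -> Prop :=
| Sword_tword r of tword_rel r : sword_rel r
| Sword_swap x y p q :
    sword_rel [:: (1, p ++ x :: y :: q);
                  (- eps (hdeg x * hdeg y), p ++ y :: x :: q)].

Lemma wdeg_cat p q : @wdeg K V (p ++ q) = wdeg p + wdeg q.
Proof. by rewrite /wdeg big_cat. Qed.

Lemma wdeg_cons x q : @wdeg K V (x :: q) = hdeg x + wdeg q.
Proof. by rewrite /wdeg big_cons. Qed.

Lemma tword_relH r :
  tword_rel r -> exists k, forall c, c \in r -> @wdeg K V c.2 = k.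
Proof.
case=> [|a x y z p q [Hx Hy _]].
  by exists (@wdeg K V [::]) => c; rewrite inE => /eqP ->.
exists (wdeg (p ++ z :: q)) => c; rewrite !inE.
by case/or3P => /eqP -> //=; rewrite !wdeg_cat !wdeg_cons ?Hx ?Hy.
Qed.

Lemma sword_relH r :
  sword_rel r -> exists k, forall c, c \in r -> @wdeg K V c.2 = k.
Proof.
case=> [r' /tword_relH //|x y p q].
exists (wdeg (p ++ x :: y :: q)) => c; rewrite !inE.
case/orP => /eqP -> //=; rewrite !wdeg_cat !wdeg_cons; congr (_ + _).
by rewrite addrCA.
Qed.

Definition Tbar : gmod K := gpres tword_relH.
Definition Sbar : gmod K := gpres sword_relH.

Definition tword w : helt Tbar := hgen tword_relH w.
Definition sword w : helt Sbar := hgen sword_relH w.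

(* Three words that agree except in one place, where w has a times the letter *)
(* of u plus that of v.                                                       *)
Definition wlin a (u v w : seq (helt V)) : Prop := exists p q x y z,
  hlin a x y z /\ [/\ u = p ++ x :: q, v = p ++ y :: q & w = p ++ z :: q].

Lemma wlin_deg a u v w : wlin a u v w ->
  map (@hdeg K V) u = map (@hdeg K V) w /\ map (@hdeg K V) v = map (@hdeg K V) w.
Proof.
by case=> p [q [x [y [z [[Hx Hy _] [-> -> ->]]]]]]; rewrite !map_cat /= Hx Hy.
Qed.

Lemma wdegE w : wdeg w = \sum_(k <- map (@hdeg K V) w) k.
Proof. by rewrite /wdeg big_map. Qed.

Lemma wlin_tword a u v w : wlin a u v w ->
  hlin a (tword u) (tword v) (tword w).
Proof.
move=> H; have [Hu Hv] := wlin_deg H.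
split; rewrite /hdeg /= ?wdegE ?Hu ?Hv //.
case: H => p [q [x [y [z [H [-> -> ->]]]]]].
have /pgen_rel := Tword_lin p q H.
by rewrite !big_cons big_nil => /rel3.
Qed.

Lemma wlin_sword a u v w : wlin a u v w ->
  hlin a (sword u) (sword v) (sword w).
Proof.
move=> H; have [Hu Hv] := wlin_deg H.
split; rewrite /hdeg /= ?wdegE ?Hu ?Hv //.
case: H => p [q [x [y [z [H [-> -> ->]]]]]].
have /pgen_rel := Sword_tword (Tword_lin p q H).
by rewrite !big_cons big_nil => /rel3.
Qed.

Lemma sword_swap p x y q :
  hval (sword (p ++ x :: y :: q)) =
  eps (hdeg x * hdeg y) *: hval (sword (p ++ y :: x :: q)).
Proof.
have /pgen_rel := Sword_swap x y p q.
rewrite !big_cons big_nil addr0 scale1r scaleNr => /eqP.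
by rewrite subr_eq0 => /eqP.
Qed.

Lemma tword_nil : hval (tword [::]) = 0.
Proof. by have /pgen_rel := Tword_nil; rewrite big_seq1 scale1r. Qed.

Lemma sword_nil : hval (sword [::]) = 0.
Proof.
by have /pgen_rel := Sword_tword Tword_nil; rewrite big_seq1 scale1r.
Qed.

Section Lift.
Variables (M : lmodType K) (F : seq (helt V) -> M).

Definition mlin : Prop :=
  F [::] = 0 /\ forall a u v w, wlin a u v w -> F w = a *: F u + F v.

Definition gsym : Prop := forall p x y q,
  F (p ++ x :: y :: q) = eps (hdeg x * hdeg y) *: F (p ++ y :: x :: q).

Hypothesis FM : mlin.

Lemma tword_liftR r : tword_rel r -> \sum_(c <- r) c.1 *: F c.2 = 0.
Proof.
case: FM => F0 FL; case=> [|a x y z p q H]; rewrite !big_cons big_nil.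
  by rewrite F0 scaler0 addr0.
by apply/rel3; apply: FL; exists p, q, x, y, z.
Qed.

Definition tword_lift : {linear Tbar -> M} := plift tword_liftR.

Lemma tword_liftE w : tword_lift (hval (tword w)) = F w.
Proof. exact: plift_gen. Qed.

Hypothesis FS : gsym.

Lemma sword_liftR r : sword_rel r -> \sum_(c <- r) c.1 *: F c.2 = 0.
Proof.
case=> [r' /tword_liftR //|x y p q]; rewrite !big_cons big_nil addr0 /=.
by rewrite scale1r FS scaleNr subrr.
Qed.

Definition sword_lift : {linear Sbar -> M} := plift sword_liftR.

Lemma sword_liftE w : sword_lift (hval (sword w)) = F w.
Proof. exact: plift_gen. Qed.

End Lift.

Lemma tword_ind (P : Tbar -> Prop) :
  P 0 -> (forall a w t, P t -> P (a *: hval (tword w) + t)) -> forall t, P t.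
Proof. exact: pres_ind. Qed.

Lemma sword_ind (P : Sbar -> Prop) :
  P 0 -> (forall a w t, P t -> P (a *: hval (sword w) + t)) -> forall t, P t.
Proof. exact: pres_ind. Qed.

(* The projections of Tbar V and Sbar V onto words of length 1.               *)
Definition lin1F w : V := if w is [:: x] then hval x else 0.

Lemma lin1M : mlin lin1F.
Proof.
split=> // a u v w [[|b [|c p]] [q [x [y [z [[_ _ H] [-> -> ->]]]]]]] /=.
- by case: q => //=; rewrite scaler0 addr0.
- by rewrite scaler0 addr0.
- by rewrite scaler0 addr0.
Qed.

Lemma lin1S : gsym lin1F.
Proof. by move=> [|b [|c p]] x y q; rewrite /= scaler0. Qed.

Definition tproj : {linear Tbar -> V} := tword_lift lin1M.
Definition sproj : {linear Sbar -> V} := sword_lift lin1M lin1S.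

End Words.

(* An (i,n-i)-unshuffle is encoded by the bit mask, with i true bits, of the  *)
(* positions that go to the left word: mask m w and mask (map negb m) w are   *)
(* the two words. Positions are numbered from 0. unshuff n i a b keeps those  *)
(* with a on the left and b on the right, None meaning no condition.          *)
Fixpoint masks (n : nat) : seq bitseq :=
  if n is n'.+1 then
    [seq true :: m | m <- masks n'] ++ [seq false :: m | m <- masks n']
  else [:: [::]].

Lemma mem_masks n m : (m \in masks n) = (size m == n).
Proof.
elim: n m => [|n IH] [|b m] //=.
- by rewrite mem_cat; apply/negP => /orP[] /mapP[? _].
- rewrite mem_cat eqSS -IH; apply/orP/idP => [[] /mapP[m' Hm [_ ->]] //|Hm].
  by case: b; [left|right]; apply/mapP; exists m.
Qed.

Lemma uniq_masks n : uniq (masks n).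
Proof.
elim: n => //= n IH; rewrite cat_uniq !map_inj_uniq ?IH ?andbT //=; last 2 first.
- by move=> ? ? [].
- by move=> ? ? [].
by apply/hasPn => m /mapP[m' _ ->]; apply/mapP => -[].
Qed.

Definition unshuff (n i : nat) (a b : option nat) : seq bitseq :=
  [seq m <- masks n | [&& count id m == i,
     oapp (fun k => nth false m k) true a &
     oapp (fun k => ~~ nth true m k) true b]].

(* Exponent of the Koszul sign: a letter sent to the right is exchanged with  *)
(* every later letter sent to the left.                                       *)
Fixpoint unsh_exp (ds : seq int) (m : bitseq) : int :=
  match ds, m with
  | d :: ds', b :: m' =>
      (if b then 0 else d * \sum_(e <- mask m' ds') e) + unsh_exp ds' m'
  | _, _ => 0
  end.

Lemma sum_lin (K : fieldType) (M : lmodType K) (I : eqType) (r : seq I)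
    (P : pred I) (a : K) (A B C : I -> M) :
  (forall i, i \in r -> P i -> C i = a *: A i + B i) ->
  \sum_(i <- r | P i) C i =
  a *: (\sum_(i <- r | P i) A i) + \sum_(i <- r | P i) B i.
Proof.
move=> H; rewrite scaler_sumr -big_split /= big_seq_cond [RHS]big_seq_cond.
by apply: eq_bigr => i /andP[]; apply: H.
Qed.

Lemma scale_lin (K : fieldType) (M : lmodType K) (e a : K) (A B C : M) :
  C = a *: A + B -> e *: C = a *: (e *: A) + e *: B.
Proof. by move=> ->; rewrite scalerDr !scalerA mulrC. Qed.

Section Masks.
Variables (K : fieldType) (V : gmod K).
Implicit Types u v w : seq (helt V).

Lemma wlin_size a u v w : @wlin K V a u v w -> size u = size w /\ size v = size w.
Proof.
by case/wlin_deg => Hu Hv; rewrite -!(size_map (@hdeg K V)) Hu Hv !size_map.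
Qed.

Lemma mask_split (T : Type) (m : bitseq) (p q : seq T) x :
  size m = size (p ++ x :: q) ->
  mask m (p ++ x :: q) =
  mask (take (size p) m) p ++ nseq (nth false m (size p)) x ++
  mask (drop (size p).+1 m) q.
Proof.
elim: p m => [|y p IH] [|b m] //=.
- by rewrite drop0; case: b.
- by case=> /IH ->; case: b.
Qed.

Lemma wlin_maskC a u v w m : @wlin K V a u v w -> size m = size w ->
  (wlin a (mask m u) (mask m v) (mask m w) /\
   [/\ mask (map negb m) u = mask (map negb m) w &
       mask (map negb m) v = mask (map negb m) w]) \/
  ([/\ mask m u = mask m w & mask m v = mask m w] /\
   wlin a (mask (map negb m) u) (mask (map negb m) v) (mask (map negb m) w)).
Proof.
case=> p [q [x [y [z [H [-> -> ->]]]]]] Hs.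
have Hs' t : size m = size (p ++ t :: q) by rewrite Hs !size_cat.
have Hn t : size (map negb m) = size (p ++ t :: q) by rewrite size_map.
have Hk : (size p < size m)%N by rewrite Hs size_cat /= addnS ltnS leq_addr.
rewrite !mask_split // (nth_map false) //.
case: (nth false m (size p)) => /=; [left|right]; split => //.
- by exists (mask (take (size p) m) p), (mask (drop (size p).+1 m) q), x, y, z.
- by do 5 eexists; split; first exact: H.
Qed.

End Masks.

Section SwapMask.

Definition swapm k (m : bitseq) : bitseq :=
  take k m ++ nth false m k.+1 :: nth false m k :: drop k.+2 m.

Lemma swapmE m1 b1 b2 m2 :
  swapm (size m1) (m1 ++ b1 :: b2 :: m2) = m1 ++ b2 :: b1 :: m2.
Proof.
elim: m1 => [|b m1 IH]; rewrite /swapm /= ?drop0 //.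
by congr (_ :: _); exact: IH.
Qed.

Lemma mask_dec2 k (m : bitseq) : (k.+2 <= size m)%N ->
  exists (m1 : bitseq) b1 b2 (m2 : bitseq), m = m1 ++ b1 :: b2 :: m2 /\ size m1 = k.
Proof.
elim: k m => [|k IH] [|b m] //=; rewrite ltnS.
  by case: m => [|b' m] // _; exists [::], b, b', m.
by move=> /IH[m1 [b1 [b2 [m2 [-> <-]]]]]; exists (b :: m1), b1, b2, m2.
Qed.

Lemma mem_unshuff n i m :
  (m \in unshuff n i None None) = (size m == n) && (count id m == i).
Proof. by rewrite mem_filter /= andbT mem_masks andbC. Qed.

Lemma perm_swapm n i k : (k.+2 <= n)%N ->
  perm_eq [seq swapm k m | m <- unshuff n i None None] (unshuff n i None None).
Proof.
move=> Hk.
have HK m : m \in unshuff n i None None ->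
    swapm k m \in unshuff n i None None /\ swapm k (swapm k m) = m.
  rewrite mem_unshuff => /andP[/eqP Hs Hc].
  have /mask_dec2[m1 [b1 [b2 [m2 [Em Em1]]]]] : (k.+2 <= size m)%N by rewrite Hs.
  rewrite -Em1 Em !swapmE mem_unshuff; split=> //.
  move: Hc; rewrite -Hs Em !size_cat /= eqxx /= !count_cat /=.
  by rewrite [(b1 + (b2 + _))%N]addnCA.
apply: uniq_perm.
- rewrite map_inj_in_uniq ?filter_uniq ?uniq_masks //.
  by move=> m m' /HK[_ Em] /HK[_ Em'] E; rewrite -Em E.
- exact/filter_uniq/uniq_masks.
- move=> m; apply/mapP/idP => [[m' /HK[Hm' _] -> //]|/HK[Hm Em]].
  by exists (swapm k m).
Qed.

End SwapMask.

Section EpsTheory.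
Variable K : fieldType.

Lemma epsD a b : @eps K (a + b) = eps a * eps b.
Proof. by rewrite /eps expfzDr // oppr_eq0 oner_eq0. Qed.

Lemma eps0 : @eps K 0 = 1.
Proof. exact: expr0z. Qed.

Lemma eps_sqr a : @eps K a * eps a = 1.
Proof.
by rewrite -epsD /eps -mulr2n -mulr_natl -[2%:R]/(2%:Z) -exprz_exp -exprnP
  sqrrN expr1n exp1rz.
Qed.

Lemma eps2 a : @eps K (a + a) = 1.
Proof. by rewrite epsD eps_sqr. Qed.

End EpsTheory.

Lemma unsh_exp_cat (d1 d2 : seq int) (m1 m2 : bitseq) : size m1 = size d1 ->
  unsh_exp (d1 ++ d2) (m1 ++ m2) = unsh_exp d1 m1 + unsh_exp d2 m2 +
    (\sum_(e <- mask (map negb m1) d1) e) * (\sum_(e <- mask m2 d2) e).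
Proof.
elim: d1 m1 => [|d d1 IH] [|b m1] //=; first by rewrite big_nil mul0r add0r addr0.
case=> Hs; rewrite IH // mask_cat // big_cat /=.
case: b => /=; rewrite ?big_cons; ring.
Qed.

Section TpairScale.
Variables (K : fieldType) (V W : gmod K).

Lemma eq_double (M : zmodType) (t : M) : t = t + t -> t = 0.
Proof. by move/eqP; rewrite addrC -subr_eq subrr => /eqP. Qed.

Definition hzero k : helt V := Helt (raddf0 (gproj V k)).

Lemma hlinZ a x z : hdeg x = hdeg z -> hval z = a *: hval x ->
  hlin a x (hzero (hdeg z)) z.
Proof. by move=> Hd Hv; split=> //; rewrite Hv addr0. Qed.

Lemma hlin0 k : hlin 1 (hzero k) (hzero k) (hzero k).
Proof. by split=> //; rewrite scaler0 addr0. Qed.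

End TpairScale.

Lemma tpairZl (K : fieldType) (V W : gmod K) a (x z : helt V) (w : helt W) :
  hdeg x = hdeg z -> hval z = a *: hval x -> tpair z w = a *: tpair x w.
Proof.
move=> Hd Hv; rewrite (tpairL w (hlinZ Hd Hv)).
have /eq_double -> : tpair (hzero V (hdeg z)) w =
  tpair (hzero V (hdeg z)) w + tpair (hzero V (hdeg z)) w.
  by rewrite {1}(tpairL w (hlin0 V _)) scale1r.
by rewrite addr0.
Qed.

Lemma tpairZr (K : fieldType) (V W : gmod K) a (x z : helt W) (w : helt V) :
  hdeg x = hdeg z -> hval z = a *: hval x -> tpair w z = a *: tpair w x.
Proof.
move=> Hd Hv; rewrite (tpairR w (hlinZ Hd Hv)).
have /eq_double -> : tpair w (hzero W (hdeg z)) =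
  tpair w (hzero W (hdeg z)) + tpair w (hzero W (hdeg z)).
  by rewrite {1}(tpairR w (hlin0 W _)) scale1r.
by rewrite addr0.
Qed.

Section DeltaS.
Variables (K : fieldType) (V : gmod K).
Implicit Types w : seq (helt V).

Definition sterm w m : tens (Sbar V) (Sbar V) :=
  eps (unsh_exp (map (@hdeg K V) w) m) *:
    tpair (sword (mask m w)) (sword (mask (map negb m) w)).

Definition deltaS_fun w : tens (Sbar V) (Sbar V) :=
  \sum_(1 <= i < size w) \sum_(m <- unshuff (size w) i None None) sterm w m.

Lemma size_unshuff n i a b m : m \in unshuff n i a b -> size m = n.
Proof. by rewrite mem_filter mem_masks => /andP[_ /eqP]. Qed.

Lemma sterm_lin a u v w m : wlin a u v w -> size m = size w ->
  sterm w m = a *: sterm u m + sterm v m.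
Proof.
move=> H Hs; rewrite /sterm; have [-> ->] := wlin_deg H.
apply: scale_lin; case: (wlin_maskC H Hs) => -[].
- by move=> /wlin_sword HL [-> ->]; apply: tpairL.
- by move=> [-> ->] /wlin_sword HL; apply: tpairR.
Qed.

Lemma deltaS_mlin : mlin deltaS_fun.
Proof.
split; first by rewrite /deltaS_fun big_geq.
move=> a u v w H; have [su sv] := wlin_size H; rewrite /deltaS_fun su sv.
apply: sum_lin => i _ _; apply: sum_lin => m Hm _.
exact/sterm_lin/(size_unshuff Hm).
Qed.

Lemma sword_swap_deg (p : seq (helt V)) x y q :
  hdeg (@sword K V (p ++ y :: x :: q)) = hdeg (sword (p ++ x :: y :: q)).
Proof.
rewrite /hdeg /= !wdeg_cat !wdeg_cons; congr (_ + _).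
exact: addrCA.
Qed.

Lemma tpair_swapL (p : seq (helt V)) x y q (t : helt (Sbar V)) :
  tpair (sword (p ++ x :: y :: q)) t =
  eps (hdeg x * hdeg y) *: tpair (sword (p ++ y :: x :: q)) t.
Proof. exact: tpairZl (sword_swap_deg p x y q) (sword_swap p x y q). Qed.

Lemma tpair_swapR (p : seq (helt V)) x y q (t : helt (Sbar V)) :
  tpair t (sword (p ++ x :: y :: q)) =
  eps (hdeg x * hdeg y) *: tpair t (sword (p ++ y :: x :: q)).
Proof. exact: tpairZr (sword_swap_deg p x y q) (sword_swap p x y q). Qed.

Lemma eps_eq2 (a b c : int) : b = a + (c + c) -> @eps K a = eps b.
Proof. by move=> ->; rewrite epsD eps2 mulr1. Qed.

Lemma sterm_swap p x y q m1 b1 b2 m2 :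
  size m1 = size p -> size m2 = size q ->
  sterm (p ++ x :: y :: q) (m1 ++ b1 :: b2 :: m2) =
  eps (hdeg x * hdeg y) *: sterm (p ++ y :: x :: q) (m1 ++ b2 :: b1 :: m2).
Proof.
move=> Hp Hq; rewrite /sterm !map_cat /= !unsh_exp_cat ?size_map //.
have Hn : size (map negb m1) = size p by rewrite size_map.
rewrite !mask_cat //= scalerA -epsD.
case: b1; case: b2 => /=; rewrite ?big_cons.
- rewrite tpair_swapL scalerA -epsD; congr (eps _ *: _); ring.
- by congr (_ *: _); apply: (@eps_eq2 _ _ (hdeg x * hdeg y)); ring.
- congr (eps _ *: _); ring.
- rewrite tpair_swapR scalerA -epsD; congr (eps _ *: _); ring.
Qed.

Lemma deltaS_sym : gsym deltaS_fun.
Proof.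
move=> p x y q; rewrite /deltaS_fun.
have -> : size (p ++ y :: x :: q) = size (p ++ x :: y :: q) by rewrite !size_cat.
set n := size _; rewrite scaler_sumr; apply: eq_bigr => i _.
have Hk : ((size p).+2 <= n)%N by rewrite /n size_cat /= !addnS !ltnS leq_addr.
rewrite -[in RHS](perm_big _ (perm_swapm i Hk)) /= big_map scaler_sumr.
apply: eq_big_seq => m /size_unshuff Hm.
have /mask_dec2[m1 [b1 [b2 [m2 [Em E1]]]]] : ((size p).+2 <= size m)%N by rewrite Hm.
rewrite Em -[X in swapm X]E1 swapmE sterm_swap //.
move: Hm; rewrite /n Em !size_cat /= E1 !addnS => -[/eqP].
by rewrite eqn_add2l => /eqP.
Qed.

Definition deltaS : {linear Sbar V -> tens (Sbar V) (Sbar V)} :=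
  sword_lift deltaS_mlin deltaS_sym.

End DeltaS.

Section WlinTheory.
Variables (K : fieldType) (V : gmod K).
Implicit Types u v w r s : seq (helt V).

Lemma wlin_cat a u v w r s : wlin a u v w ->
  wlin a (r ++ u ++ s) (r ++ v ++ s) (r ++ w ++ s).
Proof.
case=> p [q [x [y [z [H [-> -> ->]]]]]].
by exists (r ++ p), (q ++ s), x, y, z; rewrite -!catA.
Qed.

Lemma wlin1 a (p q : seq (helt V)) x y z : hlin a x y z ->
  wlin a (p ++ x :: q) (p ++ y :: q) (p ++ z :: q).
Proof. by move=> H; exists p, q, x, y, z. Qed.

Variant wlin_at_spec a k u v w : Prop :=
| WlinTake of wlin a (take k u) (take k v) (take k w)
    & nth (helt0 V) u k = nth (helt0 V) w k
    & nth (helt0 V) v k = nth (helt0 V) w k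
    & drop k.+1 u = drop k.+1 w & drop k.+1 v = drop k.+1 w
| WlinNth of hlin a (nth (helt0 V) u k) (nth (helt0 V) v k) (nth (helt0 V) w k)
    & take k u = take k w & take k v = take k w
    & drop k.+1 u = drop k.+1 w & drop k.+1 v = drop k.+1 w
| WlinDrop of wlin a (drop k.+1 u) (drop k.+1 v) (drop k.+1 w)
    & nth (helt0 V) u k = nth (helt0 V) w k
    & nth (helt0 V) v k = nth (helt0 V) w k
    & take k u = take k w & take k v = take k w.

Lemma wlin_atP a k u v w : wlin a u v w -> wlin_at_spec a k u v w.
Proof.
case=> p [q [x [y [z [H [-> -> ->]]]]]].
elim: p k => [|b p IH] [|k] /=.
- by apply: WlinNth; rewrite /= ?drop0.
- by apply: WlinTake => //=; apply: (wlin1 [::]).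
- by apply: WlinDrop; rewrite /= ?drop0 //; apply: wlin1.
- case: (IH k) => H1 H2 H3 H4 H5.
  + by apply: WlinTake => //=; have := wlin_cat [:: b] [::] H1; rewrite !cats0.
  + by apply: WlinNth; rewrite /= ?H2 ?H3.
  + by apply: WlinDrop; rewrite /= ?H4 ?H5.
Qed.

Lemma mask_nth_false w m k : (k < size w)%N -> size m = size w ->
  nth true m k = false ->
  mask m w = mask (take k m) (take k w) ++ mask (drop k.+1 m) (drop k.+1 w).
Proof.
move=> Hk Hs Hm.
have Ew : take k w ++ nth (helt0 V) w k :: drop k.+1 w = w.
  by rewrite -drop_nth // cat_take_drop.
have Ek : size (take k w) = k by rewrite size_takel // ltnW.
rewrite -{1}Ew mask_split ?Ew // Ek.
by rewrite (set_nth_default true) ?Hs // Hm.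
Qed.

End WlinTheory.

Section DeltaT.
Variables (K : fieldType) (W : gmod K).
Implicit Types w L R : seq (helt W).

Definition tterm w m : tens (Tbar W) (Tbar W) :=
  eps (unsh_exp (map (@hdeg K W) w) m) *:
    tpair (tword (mask m w)) (tword (mask (map negb m) w)).

Definition deltaZ_fun w : tens (Tbar W) (Tbar W) :=
  \sum_(1 <= i < size w)
    \sum_(m <- unshuff (size w) i None (Some (size w).-1)) tterm w m.

Lemma tterm_lin a u v w m : wlin a u v w -> size m = size w ->
  tterm w m = a *: tterm u m + tterm v m.
Proof.
move=> H Hs; rewrite /tterm; have [-> ->] := wlin_deg H.
apply: scale_lin; case: (wlin_maskC H Hs) => -[].
- by move=> /wlin_tword HL [-> ->]; apply: tpairL.
- by move=> [-> ->] /wlin_tword HL; apply: tpairR.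
Qed.

Lemma deltaZ_mlin : mlin deltaZ_fun.
Proof.
split; first by rewrite /deltaZ_fun big_geq.
move=> a u v w H; have [su sv] := wlin_size H; rewrite /deltaZ_fun su sv.
apply: sum_lin => i _ _; apply: sum_lin => m Hm _.
exact/tterm_lin/(size_unshuff Hm).
Qed.

Definition deltaZ : {linear Tbar W -> tens (Tbar W) (Tbar W)} :=
  tword_lift deltaZ_mlin.

Section Insert.

(* insA inserts delta c = \sum c' (x) c'' between L1 and L2 in the left word;  *)
(* insB appends c' to the left word and c'' to the right word, c' moving past *)
(* R.                                                                         *)
Definition insA_fun L1 L2 R (x y : helt W) : tens (Tbar W) (Tbar W) :=
  tpair (tword (L1 ++ x :: y :: L2)) (tword R).

Lemma insA_bilin L1 L2 R : bilin (insA_fun L1 L2 R).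
Proof.
split=> a x y z w H; apply: tpairL; apply: wlin_tword; first exact: wlin1.
by have := wlin1 (L1 ++ [:: w]) L2 H; rewrite -!catA.
Qed.

Definition insA L1 L2 R : {linear tens W W -> tens (Tbar W) (Tbar W)} :=
  tens_lift (insA_bilin L1 L2 R).

Definition insB_fun L R (x y : helt W) : tens (Tbar W) (Tbar W) :=
  eps (wdeg R * hdeg x) *: tpair (tword (rcons L x)) (tword (rcons R y)).

Lemma insB_bilin L R : bilin (insB_fun L R).
Proof.
split=> a x y z w H; rewrite /insB_fun.
- have [-> -> _] := H; apply: scale_lin; apply: tpairL; apply: wlin_tword.
  by rewrite -!cats1; apply: wlin1.
- apply: scale_lin; apply: tpairR; apply: wlin_tword.
  by rewrite -!cats1; apply: wlin1.
Qed.

Definition insB L R : {linear tens W W -> tens (Tbar W) (Tbar W)} :=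
  tens_lift (insB_bilin L R).

Lemma tens_lin_ext (M : lmodType K) a (f g h : {linear tens W W -> M}) :
  (forall x y, h (tpair x y) = a *: f (tpair x y) + g (tpair x y)) ->
  forall t, h t = a *: f t + g t.
Proof.
move=> H; elim/tens_ind => [|b x y t IH]; first by rewrite !raddf0 ?scaler0 addr0.
rewrite !linearP IH H !scalerDr !scalerA [b * a]mulrC.
by rewrite -!addrA; congr (_ + _); rewrite addrCA.
Qed.

Lemma insA_linL1 a u v w L R t : wlin a u v w ->
  insA w L R t = a *: insA u L R t + insA v L R t.
Proof.
move=> H; apply: tens_lin_ext => x y; rewrite !tens_liftE.
by apply: tpairL; apply: wlin_tword; apply: (wlin_cat [::]).
Qed.

Lemma insA_linL2 a u v w L R t : wlin a u v w ->
  insA L w R t = a *: insA L u R t + insA L v R t.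
Proof.
move=> H; apply: tens_lin_ext => x y; rewrite !tens_liftE.
apply: tpairL; apply: wlin_tword.
by have := wlin_cat (L ++ [:: x; y]) [::] H; rewrite !cats0 -!catA.
Qed.

Lemma insA_linR a u v w L L' t : wlin a u v w ->
  insA L L' w t = a *: insA L L' u t + insA L L' v t.
Proof.
move=> H; apply: tens_lin_ext => x y; rewrite !tens_liftE.
by apply: tpairR; apply: wlin_tword.
Qed.

Lemma insB_linL a u v w R t : wlin a u v w ->
  insB w R t = a *: insB u R t + insB v R t.
Proof.
move=> H; apply: tens_lin_ext => x y; rewrite !tens_liftE.
apply: scale_lin; apply: tpairL; apply: wlin_tword.
by rewrite -!cats1; apply: (wlin_cat [::]).
Qed.

Lemma insB_linR a u v w L t : wlin a u v w ->
  insB L w t = a *: insB L u t + insB L v t.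
Proof.
move=> H; apply: tens_lin_ext => x y; rewrite !tens_liftE /insB_fun.
have [Eu Ev] := wlin_deg H; rewrite !wdegE Eu Ev.
apply: scale_lin; apply: tpairR; apply: wlin_tword.
by rewrite -!cats1; apply: (wlin_cat [::]).
Qed.

End Insert.

Variable delta : {linear W -> tens W W}.

(* The letter at position k is replaced by its image under delta, of degree   *)
(* one more, whence the set_nth in the sign.                                  *)
Definition Aterm w k m : tens (Tbar W) (Tbar W) :=
  let ds := map (@hdeg K W) w in
  eps (\sum_(e <- take k ds) e +
       unsh_exp (set_nth 0 ds k (nth 0 ds k + 1)) m) *:
    insA (mask (take k m) (take k w)) (mask (drop k.+1 m) (drop k.+1 w))
         (mask (map negb m) w) (delta (hval (nth (helt0 W) w k))).

Definition partA_fun w : tens (Tbar W) (Tbar W) :=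
  \sum_(0 <= k < (size w).-1) \sum_(1 <= i < size w)
    \sum_(m <- unshuff (size w) i (Some k) (Some (size w).-1)) Aterm w k m.

Definition Bterm w m : tens (Tbar W) (Tbar W) :=
  let n := (size w).-1 in
  let ds := map (@hdeg K W) (take n w) in
  eps (\sum_(e <- ds) e + unsh_exp ds m) *:
    insB (mask m (take n w)) (mask (map negb m) (take n w))
         (delta (hval (nth (helt0 W) w n))).

Definition partB_fun w : tens (Tbar W) (Tbar W) :=
  \sum_(0 <= i < size w) \sum_(m <- unshuff (size w).-1 i None None) Bterm w m.

Definition deltaC_fun w : tens (Tbar W) (Tbar W) :=
  partA_fun w - flip _ _ (partA_fun w) + partB_fun w.

Lemma Aterm_lin a u v w k m : wlin a u v w -> (k < size w)%N ->
  size m = size w -> nth false m k ->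
  Aterm w k m = a *: Aterm u k m + Aterm v k m.
Proof.
move=> H Hk Hs Hm; have [Eu Ev] := wlin_deg H; have [Su Sv] := wlin_size H.
rewrite /Aterm Eu Ev; apply: scale_lin.
have Hnm : nth true (map negb m) k = false by rewrite (nth_map false) ?Hs // Hm.
have EM (x : seq (helt W)) : size x = size w -> mask (map negb m) x =
    mask (take k (map negb m)) (take k x) ++
    mask (drop k.+1 (map negb m)) (drop k.+1 x).
  by move=> Sx; apply: mask_nth_false; rewrite ?size_map ?Sx.
rewrite (EM u) // (EM v) // (EM w) //.
have [T N1 N2 D1 D2|N T1 T2 D1 D2|D N1 N2 T1 T2] := wlin_atP k H.
- rewrite N1 N2 D1 D2.
  have St : size (take k m) = size (take k w) by rewrite !size_take Hs.
  rewrite -map_take; case: (wlin_maskC T St) => -[].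
  + by move=> HL [-> ->]; apply: insA_linL1.
  + move=> [-> ->] HL; apply: insA_linR; exact: (wlin_cat [::]).
- rewrite T1 T2 D1 D2; have [_ _ ->] := N.
  by rewrite !linearP.
- rewrite N1 N2 T1 T2.
  have St : size (drop k.+1 m) = size (drop k.+1 w) by rewrite !size_drop Hs.
  rewrite -map_drop; case: (wlin_maskC D St) => -[].
  + by move=> HL [-> ->]; apply: insA_linL2.
  + move=> [-> ->] HL; apply: insA_linR.
    by have := wlin_cat (mask (take k (map negb m)) (take k w)) [::] HL;
      rewrite !cats0.
Qed.

Lemma Bterm_lin a u v w m : wlin a u v w -> size m = (size w).-1 ->
  Bterm w m = a *: Bterm u m + Bterm v m.
Proof.
move=> H Hs; have [Eu Ev] := wlin_deg H; have [Su Sv] := wlin_size H.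
rewrite /Bterm Su Sv !map_take Eu Ev; apply: scale_lin.
have [T N1 N2 D1 D2|N T1 T2 D1 D2|D N1 N2 T1 T2] := wlin_atP (size w).-1 H.
- rewrite N1 N2.
  have St : size m = size (take (size w).-1 w) by rewrite size_takel ?leq_pred.
  case: (wlin_maskC T St) => -[].
  + by move=> HL [-> ->]; apply: insB_linL.
  + by move=> [-> ->] HL; apply: insB_linR.
- by rewrite T1 T2; have [_ _ ->] := N; rewrite !linearP.
- case: D => p [q [x [y [z [_ [_ _ E]]]]]].
  have := congr1 size E; rewrite size_drop size_cat /= addnS.
  by case: (size w) => [|n]; rewrite //= subnn.
Qed.

Lemma deltaC_mlin : mlin deltaC_fun.
Proof.
split.
  by rewrite /deltaC_fun /partA_fun /partB_fun !big_geq // raddf0 subr0 addr0.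
move=> a u v w H; have [Su Sv] := wlin_size H.
have HA : partA_fun w = a *: partA_fun u + partA_fun v.
  rewrite /partA_fun Su Sv; apply: sum_lin => k; rewrite mem_index_iota => Hk _.
  apply: sum_lin => i _ _; apply: sum_lin => m Hm _.
  apply: Aterm_lin => //; first by rewrite (leq_trans Hk) // leq_pred.
    exact: size_unshuff Hm.
  by move: Hm; rewrite mem_filter => /andP[/and3P[_ ? _] _].
have HB : partB_fun w = a *: partB_fun u + partB_fun v.
  rewrite /partB_fun Su Sv; apply: sum_lin => i _ _; apply: sum_lin => m Hm _.
  exact/Bterm_lin/(size_unshuff Hm).
rewrite /deltaC_fun HA HB linearP opprD [X in X + _]addrACA.
by rewrite [LHS]addrACA -scalerN -!scalerDr.
Qed.

Definition deltaC : {linear Tbar W -> tens (Tbar W) (Tbar W)} :=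
  tword_lift deltaC_mlin.

End DeltaT.

(* Exponent of the Koszul sign in                                             *)
(*   (f_1 (x) ... (x) f_n)(x_1 (x) ... (x) x_n) =                             *)
(*     (-1)^(tens_exp [|f_1|,...] [|x_1|,...]) f_1 x_1 (x) ... (x) f_n x_n.   *)
Fixpoint tens_exp (ps ds : seq int) : int :=
  match ps, ds with
  | _ :: ps', d :: ds' => d * \sum_(p <- ps') p + tens_exp ps' ds'
  | _, _ => 0
  end.

(* The sum over n >= 1 of maps of which only finitely many are nonzero on     *)
(* any given argument.                                                        *)
Definition is_locsum (A : Type) (B : nmodType) (D : nat -> A -> B)
    (E : A -> B) : Prop :=
  forall x, exists N, forall M, (N <= M)%N -> E x = \sum_(1 <= n < M) D n x.

Definition tderiv (K : fieldType) p (V : gmod K) (D : ghom p V V)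
    (t : tens V V) : tens V V :=
  tmap D (gid V) t + tmap (gid V) D t.

Section ShLie.
Variables (K : fieldType) (g : gmod K).

Definition is_coderS (V : gmod K) p (D : ghom p (Sbar V) (Sbar V)) : Prop :=
  forall x, tderiv D (deltaS V x) = deltaS V (D x).

(* A family (l_n)_(n >= 1) of operations on g is encoded as one function l    *)
(* on sequences, l_n being its restriction to sequences of length n (the      *)
(* value of l at the empty sequence is irrelevant).                           *)
Definition shLie_map (l : seq g -> g) (n : nat) (w : seq (helt g)) : gshift g :=
  let sw := map (happ (susp g)) w in
  susp g (eps (tens_exp (nseq n (- 1)) (map (@hdeg K _) sw)) *:
          l (map (@hval K g) w)).

Definition shLie_coder (l : seq g -> g) (n : nat)
    (D : ghom (- 1) (Sbar (gshift g)) (Sbar (gshift g))) : Prop :=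
  is_coderS D /\
  forall w : seq (helt g),
    sproj _ (D (hval (sword (map (happ (susp g)) w)))) =
    if size w == n then shLie_map l n w else 0.

Record is_shLie (l : seq g -> g) : Prop := IsShLie {
  shLie_multilinear : forall p q a x y,
    l (p ++ (a *: x + y) :: q) = a *: l (p ++ x :: q) + l (p ++ y :: q);
  shLie_degree : forall w : seq (helt g), w <> [::] ->
    gproj g (wdeg w + ((size w)%:Z - 2)) (l (map (@hval K g) w)) =
    l (map (@hval K g) w);
  shLie_antisym : forall (p q : seq (helt g)) x y,
    l (map (@hval K g) (p ++ x :: y :: q)) =
    - (eps (hdeg x * hdeg y) *: l (map (@hval K g) (p ++ y :: x :: q)));
  shLie_square : exists D (E : ghom (- 1) (Sbar (gshift g)) (Sbar (gshift g))),
    [/\ forall n, (0 < n)%N -> shLie_coder l n (D n),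
        is_locsum D E
      & forall x, E (E x) = 0] }.

Definition is_derivation (l : seq g -> g) (d : ghom 1 g g) : Prop :=
  forall w : seq (helt g), w <> [::] ->
    d (l (map (@hval K g) w)) =
    eps ((size w)%:Z - 2) *:
      \sum_(0 <= j < size w) eps (wdeg (take j w)) *:
        l (map (@hval K g) (take j w) ++
           d (hval (nth (helt0 g) w j)) :: map (@hval K g) (drop j.+1 w)).

End ShLie.

Section LLinf.
Variables (K : fieldType) (g : gmod K).

Definition LLletter : gmod K := gshift (Sbar (gshift g)).
Definition LLbar : gmod K := Tbar LLletter.

(* (s (x) s) Delta s^-1 on s(Sbar(s g)).                                      *)
Definition deltaW : {linear LLletter -> tens LLletter LLletter} :=
  tmap (susp _) (susp _) \o (deltaS (gshift g) \o desusp (Sbar (gshift g))).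

Definition is_coderT p (D : ghom p LLbar LLbar) : Prop :=
  (forall x, tderiv D (deltaZ LLletter x) = deltaZ LLletter (D x)) /\
  (forall x, eps p *: tderiv D (deltaC deltaW x) = deltaC deltaW (D x)).

Definition is_LLinf (D : ghom (- 1) LLbar LLbar) : Prop :=
  is_coderT D /\ forall x, D (D x) = 0.

(* s(s x_1 ... s x_k) (x) s(s y_1 ... s y_l) (x) ... for                      *)
(* cs = [[x_1,...,x_k], [y_1,...,y_l], ...].                                  *)
Definition LLmono (cs : seq (seq (helt g))) : seq (helt LLletter) :=
  [seq happ (susp _) (sword (map (happ (susp g)) c)) | c <- cs].

Definition LLproj (x : LLbar) : gshift (gshift g) :=
  susp _ (sproj _ (desusp _ (tproj _ x))).

Definition derived_sign (m i : nat) : K := (-1) ^+ (((2 * m + i - 1) * i)./2).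

(* The value at LLmono cs, cs of arity (1,...,1,m-i), of                      *)
(*   (+-)^i_m s(s l_m(d^i (x) 1^(m-i)) (s^-1)^m) ((s^-1)^i (x) s^-1);         *)
(* the three exponents come from (s^-1)^(i+1), (s^-1)^m and d^i (x) 1^(m-i).  *)
Definition derived_map (l : seq g -> g) (d : g -> g) (m i : nat)
    (cs : seq (seq (helt g))) : gshift (gshift g) :=
  let w := flatten cs in
  let sw := map (happ (susp g)) w in
  let xs := map (@hval K g) w in
  (derived_sign m i *
   eps (tens_exp (nseq i.+1 (- 1)) (map (@hdeg K _) (LLmono cs)) +
        tens_exp (nseq m (- 1)) (map (@hdeg K _) sw) +
        tens_exp (nseq i 1 ++ nseq (m - i) 0) (map (@hdeg K _) w))) *:
  susp _ (susp g (l (map d (take i xs) ++ drop i xs))).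

Definition derived_coder (l : seq g -> g) (d : g -> g) (m i : nat)
    (D : ghom (- 1) LLbar LLbar) : Prop :=
  is_coderT D /\
  forall cs : seq (seq (helt g)),
    LLproj (D (hval (tword (LLmono cs)))) =
    if map size cs == rcons (nseq i 1%N) (m - i)%N
    then derived_map l d m i cs else 0.

End LLinf.

(* Main.v *)
(* Write V = s g, W = s Sbar V, let q be the operations l_n transported to V, a
   symmetric map of degree -1, and let theta : W -> V be - s d s^-1 s^-1 on words
   of length one and zero on longer ones.

   Let cobar be the derivation of Tbar W which splits a letter by its coproduct.
   One has deltaC = deltaZ cobar - (1 (x) cobar) (deltaZ + flip deltaZ), so a
   coderivation D of deltaZ is one of deltaC as soon as the bracket [D, cobar] is
   the map w |-> sum +- u G(v) over all unshuffles (u, v) of w, for some G. For the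
   derived homotopies the coderivation of deltaZ is explicit: its corestriction to
   W sends v x to the sum of all q(theta(v) A) R over the unshuffles (A, R) of
   x in Sbar V with A nonempty, plus gam(v) x, where gam(v c) = q(theta(v), d c) if
   c has length greater than one. Then G(v) is the letter of length one gam(v).

   The square of the sum of these coderivations is a coderivation; by induction on
   the number of letters from V it vanishes if its projection to V does, because
   ker deltaZ and ker deltaC meet in V in characteristic zero. The projection, on
   the word w y with y in Sbar V, is the sh Lie relation on theta(w) y. *)
From HB Require Import structures.
Require Import Defs.
From mathcomp Require Import all_boot all_order all_algebra.
From mathcomp Require Import boolp ring zify.

Set Implicit Arguments.
Unset Strict Implicit.
Unset Printing Implicit Defensive.

Import GRing.Theory.
Local Open Scope ring_scope.

(** The correction [gam] is forced by the bracket with cobar. Splitting the last letter c of a block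
    as c' R and feeding a piece of c' to theta produces terms q(theta(v), d c') R. Prefixing R by
    gam(v c') cancels them except when R is empty, because [Sbar] has no unit. What remains is the
    letter G, and words u G(v) are harmless since X = [D, cobar] satisfies deltaZ X = (1 (x) X)
    (deltaZ + flip deltaZ). The word gam(v) y has length at least two, so the projection to V does
    not see it and the prescribed operations are unchanged.

    All coderivations come from one construction with a table of coefficients [chi i k]: the pair
    (m, i) takes the indicator table [chi_delta], the whole sum takes [chi_one]. The coderivation
    property holds for every table with [chi i 0 = 0], linearity in the table gives the locally
    finite sum, and the square is computed for [chi_one]. No sign enters the tables: theta and q
    absorb (+-)^i_m.

    Besides the inverses of lengths in the kernel computation, the inverse of 2 makes symmetric
    operations vanish on antisymmetric splittings. *)

(** * Linear identities with Koszul signs, formal sums, unshuffles *)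

(* [ring] does not apply to modules; equations in an abelian group are decided
   by comparing the integer coefficients of the atoms. *)
Inductive zexp := ZVar of nat | ZAdd of zexp & zexp | ZOpp of zexp | ZZero.

Fixpoint zeval (M : zmodType) (e : seq M) (x : zexp) : M :=
  match x with
  | ZVar n => e`_n
  | ZAdd a b => zeval e a + zeval e b
  | ZOpp a => - zeval e a
  | ZZero => 0
  end.

(** The integer operations are the concrete ones, so that the test in [zeval_eq] evaluates to [true]
    by conversion and [zmodule] can close it with [isT]. *)
Fixpoint zcoef (x : zexp) (i : nat) : int :=
  match x with
  | ZVar n => if n == i then 1 else 0
  | ZAdd a b => intZmod.addz (zcoef a i) (zcoef b i)
  | ZOpp a => intZmod.oppz (zcoef a i)
  | ZZero => 0
  end.

Lemma zeval_coef (M : zmodType) (e : seq M) x :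
  zeval e x = \sum_(i < size e) e`_i *~ zcoef x i.
Proof.
elim: x => [n|a IHa b IHb|a IHa|] /=.
- have [lt_n|le_n] := ltnP n (size e).
    rewrite (bigD1 (Ordinal lt_n)) //= eqxx mulr1z big1 ?addr0 // => i.
    by rewrite -val_eqE /= eq_sym => /negPf ->; rewrite mulr0z.
  rewrite nth_default // big1 // => i _; case: eqP => [Ei|]; rewrite ?mulr0z //.
  by have := ltn_ord i; rewrite -Ei ltnNge le_n.
- rewrite IHa IHb -big_split; apply: eq_bigr => i _ /=.
  by rewrite -[intZmod.addz _ _]/(zcoef a i + zcoef b i) mulrzDr.
- rewrite IHa -sumrN; apply: eq_bigr => i _ /=.
  by rewrite -[intZmod.oppz _]/(- zcoef a i) mulrNz.
- by rewrite big1 // => i _; rewrite mulr0z.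
Qed.

Lemma zeval_eq (M : zmodType) (e : seq M) x y :
  all (fun i => zcoef x i == zcoef y i) (iota 0 (size e)) ->
  zeval e x = zeval e y.
Proof.
move=> /allP H; rewrite !zeval_coef; apply: eq_bigr => i _.
by rewrite (eqP (H i _)) // mem_iota add0n ltn_ord.
Qed.

(* Instances of the same operation found along different inference paths are
   only convertible, so heads are compared before unifying. *)
Ltac zhead a := lazymatch a with ?f _ => zhead f | _ => a end.

Ltac zsame a b :=
  first [constr_eq a b
  | lazymatch a with @GRing.scale _ _ ?c ?u =>
      lazymatch b with @GRing.scale _ _ ?d ?v => zsame u v; unify c d end end
  | lazymatch a with @GRing.scale _ _ _ _ => fail | _ =>
      let f := zhead a in let g := zhead b in constr_eq f g; unify a b end].

Ltac zfind t e :=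
  lazymatch e with
  | ?a :: ?e' =>
      match goal with
      | _ => let _ := match goal with _ => zsame a t end in constr:(O)
      | _ => let n := zfind t e' in constr:(S n)
      end
  end.

Ltac zmem t e :=
  lazymatch e with
  | nil => constr:(false)
  | ?a :: ?e' =>
      match goal with
      | _ => let _ := match goal with _ => zsame a t end in constr:(true)
      | _ => zmem t e'
      end
  end.

Ltac zvars t e :=
  lazymatch t with
  | @GRing.add _ ?a ?b => let e1 := zvars a e in zvars b e1
  | @GRing.opp _ ?a => zvars a e
  | @GRing.zero _ => e
  | _ => lazymatch zmem t e with true => e | false => constr:(t :: e) end
  end.

Ltac zreify t e :=
  lazymatch t with
  | @GRing.add _ ?a ?b =>
      let a' := zreify a e in let b' := zreify b e in constr:(ZAdd a' b')
  | @GRing.opp _ ?a => let a' := zreify a e in constr:(ZOpp a')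
  | @GRing.zero _ => constr:(ZZero)
  | _ => let n := zfind t e in constr:(ZVar n)
  end.

Ltac zmodule :=
  lazymatch goal with
  | |- @eq ?T ?a ?b =>
      let e0 := zvars a (@nil T) in
      let e := zvars b e0 in
      let a' := zreify a e in
      let b' := zreify b e in
      exact: (@zeval_eq _ e a' b' isT)
  end.

Section Parity.
Variable K : fieldType.

Definition oddz (z : int) : bool := odd `|z|%N.

Lemma oddz_sg (z : int) : exists k : int, z = (oddz z)%:Z + (k + k).
Proof.
rewrite /oddz; case: z => n.
  exists (n./2)%:Z; rewrite absz_nat -!PoszD addnn.
  by rewrite -{1}[n]odd_double_half.
(* If N = b + 2h, then -N = b + 2(-b - h). *)
exists (- (odd n.+1)%:Z - (n.+1./2)%:Z).
rewrite NegzE abszN absz_nat -{1}[n.+1]odd_double_half -addnn !PoszD; ring.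
Qed.

Lemma eps_oddz z : @eps K z = (-1) ^+ oddz z.
Proof. by have [k {1}->] := oddz_sg z; rewrite epsD eps2 mulr1. Qed.

Lemma oddz_char (b : bool) (k : int) : oddz (b%:Z + (k + k)) = b.
Proof.
rewrite /oddz; case: k => n.
  by rewrite -!PoszD absz_nat !oddD; case: b; case: (odd n).
rewrite NegzE -opprD -PoszD addnn doubleS.
case: b; last by rewrite add0r abszN absz_nat oddS oddS odd_double.
have -> : true%:Z - (n.*2.+2)%:Z = - (n.*2.+1)%:Z.
  by rewrite -[n.*2.+2]addn1 PoszD opprD addrCA subrr addr0.
by rewrite abszN absz_nat oddS odd_double.
Qed.

Lemma oddzD a b : oddz (a + b) = oddz a (+) oddz b.
Proof.
have [k Ea] := oddz_sg a; have [m Eb] := oddz_sg b.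
rewrite {1}Ea {1}Eb; set u := oddz a; set v := oddz b.
have -> : u%:Z + (k + k) + (v%:Z + (m + m)) =
  (u (+) v)%:Z + ((k + m + (u && v)%:Z) + (k + m + (u && v)%:Z)).
  by case: u; case: v => /=; ring.
exact: oddz_char.
Qed.

Lemma oddzN a : oddz (- a) = oddz a.
Proof. by rewrite /oddz abszN. Qed.

Lemma oddzM a b : oddz (a * b) = oddz a && oddz b.
Proof. by rewrite /oddz abszM oddM. Qed.

Lemma oddz0 : oddz 0 = false. Proof. by []. Qed.
Lemma oddz1 : oddz 1 = true. Proof. by []. Qed.

Lemma oddzS n : oddz (n.+1)%:Z = ~~ oddz n%:Z.
Proof. by rewrite /oddz !absz_nat oddS. Qed.

Lemma eps_par a b : oddz a = oddz b -> @eps K a = eps b.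
Proof. by rewrite !eps_oddz => ->. Qed.

End Parity.

Definition oddzE := (oddzD, oddzN, oddzM, oddz0, oddz1, oddzS).

Ltac odd_cases :=
  repeat lazymatch goal with |- context [oddz ?z] => case: (oddz z) end.

Ltac par := rewrite ?oddzE; odd_cases; by [].

(** A Koszul sign depends only on the parities of the degrees. After a case split on each parity the
    signs are constants and an identity in an abelian group remains. *)
Ltac signs :=
  rewrite ?scalerDr ?scalerN ?scalerA -?epsD ?eps_oddz ?oddzE;
  odd_cases;
  rewrite /= ?expr0 ?expr1 ?scale1r ?scaleN1r; zmodule.

Section LSum.
Variables (K : fieldType) (T : Type) (M : lmodType K).
Implicit Types (s : seq (K * T)) (Phi : T -> M).

(* Formal sums are lists, identified when they agree on all test functions. *)
Definition lsum s Phi : M := \sum_(c <- s) c.1 *: Phi c.2.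

Lemma lsum_nil Phi : lsum [::] Phi = 0.
Proof. exact: big_nil. Qed.

Lemma lsum_cons c s Phi : lsum (c :: s) Phi = c.1 *: Phi c.2 + lsum s Phi.
Proof. exact: big_cons. Qed.

Lemma lsum_cat s t Phi : lsum (s ++ t) Phi = lsum s Phi + lsum t Phi.
Proof. exact: big_cat. Qed.

Lemma eq_lsum s Phi Psi : Phi =1 Psi -> lsum s Phi = lsum s Psi.
Proof. by move=> E; apply: eq_bigr => c _; rewrite E. Qed.

Lemma lsumD s Phi Psi : lsum s (fun x => Phi x + Psi x) = lsum s Phi + lsum s Psi.
Proof. by rewrite -big_split; apply: eq_bigr => c _; rewrite scalerDr. Qed.

Lemma lsumZ s a Phi : lsum s (fun x => a *: Phi x) = a *: lsum s Phi.
Proof. by rewrite scaler_sumr; apply: eq_bigr => c _; rewrite !scalerA mulrC. Qed.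

Lemma lsumN s Phi : lsum s (fun x => - Phi x) = - lsum s Phi.
Proof. by rewrite -sumrN; apply: eq_bigr => c _; rewrite scalerN. Qed.

Lemma lsum0 s : lsum s (fun=> 0 : M) = 0.
Proof. by apply: big1 => c _; rewrite scaler0. Qed.

End LSum.

Lemma lsum_lin (K : fieldType) (T : Type) (M N : lmodType K)
    (f : {linear M -> N}) (s : seq (K * T)) Phi :
  f (lsum s Phi) = lsum s (fun x => f (Phi x)).
Proof. by rewrite /lsum linear_sum; apply: eq_bigr => c _; rewrite linearZ. Qed.

Lemma lsumC (K : fieldType) (T U : Type) (M : lmodType K)
    (s : seq (K * T)) (t : seq (K * U)) (Phi : T -> U -> M) :
  lsum s (fun x => lsum t (Phi x)) = lsum t (fun y => lsum s (Phi^~ y)).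
Proof.
rewrite /lsum; under eq_bigr do rewrite scaler_sumr.
rewrite exchange_big; apply: eq_bigr => c _; rewrite scaler_sumr.
by apply: eq_bigr => e _; rewrite !scalerA mulrC.
Qed.

Lemma eq_lsum_in (K : fieldType) (T : eqType) (M : lmodType K)
    (s : seq (K * T)) (Phi Psi : T -> M) :
  (forall c, c \in s -> Phi c.2 = Psi c.2) -> lsum s Phi = lsum s Psi.
Proof. by move=> E; apply: eq_big_seq => c /E ->. Qed.

Section Unshuffle.
Variables (K : fieldType) (V : gmod K).
Local Notation word := (seq (helt V)).
Implicit Types (u v w L R : word).

(* Unlike in the coproducts, the unshuffles with an empty part are included. *)
Fixpoint unsh w : seq (K * (word * word)) :=
  if w is x :: w' then
    [seq (c.1, (x :: c.2.1, c.2.2)) | c <- unsh w'] ++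
    [seq (eps (hdeg x * wdeg c.2.1) * c.1, (c.2.1, x :: c.2.2)) | c <- unsh w']
  else [:: (1, ([::], [::]))].

Definition us (M : lmodType K) w (Phi : word -> word -> M) : M :=
  lsum (unsh w) (fun p => Phi p.1 p.2).

Lemma wdeg_nil : @wdeg K V [::] = 0.
Proof. exact: big_nil. Qed.

Section Us.
Variable M : lmodType K.
Implicit Types (Phi Psi : word -> word -> M).

Lemma us_nil Phi : us [::] Phi = Phi [::] [::].
Proof. by rewrite /us lsum_cons lsum_nil addr0 scale1r. Qed.

Lemma us_cons x w Phi :
  us (x :: w) Phi = us w (fun L R => Phi (x :: L) R) +
    us w (fun L R => eps (hdeg x * wdeg L) *: Phi L (x :: R)).
Proof.
rewrite /us /= lsum_cat /lsum !big_map; congr (_ + _).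
by apply: eq_bigr => c _ /=; rewrite scalerA mulrC.
Qed.

Lemma unsh_deg w c : c \in unsh w -> wdeg c.2.1 + wdeg c.2.2 = wdeg w.
Proof.
elim: w c => [|x w IH] c /=; first by rewrite inE => /eqP -> /=; rewrite wdeg_nil.
rewrite mem_cat => /orP[] /mapP[e /IH E ->] /=; rewrite !wdeg_cons -E.
  by rewrite addrA.
by rewrite addrCA.
Qed.

Lemma unsh_size w c : c \in unsh w -> (size c.2.1 + size c.2.2)%N = size w.
Proof.
elim: w c => [|x w IH] c /=; first by rewrite inE => /eqP ->.
by rewrite mem_cat => /orP[] /mapP[e /IH E ->] /=; rewrite -E ?addnS.
Qed.

Lemma eq_us w Phi Psi :
  (forall L R, wdeg L + wdeg R = wdeg w -> (size L + size R = size w)%N ->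
     Phi L R = Psi L R) -> us w Phi = us w Psi.
Proof.
move=> E; apply: eq_lsum_in => c Hc.
by apply: E; [exact: unsh_deg|exact: unsh_size].
Qed.

Lemma eq_us1 w Phi Psi : (forall L R, Phi L R = Psi L R) -> us w Phi = us w Psi.
Proof. by move=> E; apply: eq_us. Qed.

Lemma usD w Phi Psi : us w (fun L R => Phi L R + Psi L R) = us w Phi + us w Psi.
Proof. exact: lsumD. Qed.

Lemma usZ w a Phi : us w (fun L R => a *: Phi L R) = a *: us w Phi.
Proof. exact: lsumZ. Qed.

Lemma usN w Phi : us w (fun L R => - Phi L R) = - us w Phi.
Proof. exact: lsumN. Qed.

Lemma us0 w : us w (fun _ _ => 0 : M) = 0.
Proof. exact: lsum0. Qed.

(** This is multiplicativity of the unshuffle coproduct for concatenation. It is mostly used as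
    [us_rcons], because [deltaZ] singles out the last letter. *)
Lemma us_cat u v Phi :
  us (u ++ v) Phi = us u (fun L R => us v (fun L' R' =>
    eps (wdeg R * wdeg L') *: Phi (L ++ L') (R ++ R'))).
Proof.
elim: u Phi => [|x u IH] Phi.
  by rewrite us_nil; apply: eq_us1 => L R; rewrite wdeg_nil mul0r eps0 scale1r.
rewrite cat_cons !us_cons !IH; congr (_ + _); apply: eq_us1 => L R.
rewrite -usZ; apply: eq_us1 => L' R'; rewrite wdeg_cat wdeg_cons !scalerA -!epsD.
by congr (_ *: _); apply: eps_par; par.
Qed.

Lemma us_rcons w x Phi :
  us (w ++ [:: x]) Phi =
  us w (fun L R => eps (wdeg R * hdeg x) *: Phi (L ++ [:: x]) R) +
  us w (fun L R => Phi L (R ++ [:: x])).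
Proof.
rewrite us_cat -usD; apply: eq_us1 => L R; rewrite us_cons !us_nil wdeg_cons.
by rewrite wdeg_nil mulr0 !cats0 addr0 eps0 mulr0 eps0 !scale1r.
Qed.

Lemma us_coassoc w (Phi : word -> word -> word -> M) :
  us w (fun u v => us u (fun a b => Phi a b v)) =
  us w (fun a t => us t (fun b v => Phi a b v)).
Proof.
elim: w Phi => [|x w IH] Phi; first by rewrite !us_nil.
rewrite !us_cons.
have -> : us w (fun L R => us (x :: L) (fun a b => Phi a b R)) =
    us w (fun L R => us L (fun a b => Phi (x :: a) b R)) +
    us w (fun L R => us L (fun a b => eps (hdeg x * wdeg a) *: Phi a (x :: b) R)).
  by rewrite -usD; apply: eq_us1 => L R; rewrite us_cons.
have -> : us w (fun L R => eps (hdeg x * wdeg L) *: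
      us (x :: R) (fun b v => Phi L b v)) =
    us w (fun L R => us R (fun b v =>
      eps (hdeg x * wdeg L) *: Phi L (x :: b) v)) +
    us w (fun L R => us R (fun b v =>
      eps (hdeg x * (wdeg L + wdeg b)) *: Phi L b (x :: v))).
  rewrite -usD; apply: eq_us1 => L R; rewrite us_cons scalerDr -!usZ.
  congr (_ + _); apply: eq_us1 => L' R'.
  by rewrite !scalerA -!epsD mulrDr.
rewrite -addrA !IH; congr (_ + _); congr (_ + _).
rewrite -IH; apply: eq_us1 => L R; rewrite -usZ.
by apply: eq_us => L' R' <- _.
Qed.

Lemma us_comm w Phi :
  us w Phi = us w (fun L R => eps (wdeg L * wdeg R) *: Phi R L).
Proof.
elim: w Phi => [|x w IH] Phi; first by rewrite !us_nil wdeg_nil mul0r eps0 scale1r.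
rewrite !us_cons addrC IH [X in _ + X]IH; congr (_ + _); apply: eq_us1 => L R.
  rewrite wdeg_cons !scalerA -!epsD; congr (_ *: _); apply: eps_par; par.
rewrite wdeg_cons !scalerA -!epsD; congr (_ *: _); apply: eps_par; par.
Qed.

End Us.

Lemma us_lin (M N : lmodType K) (f : {linear M -> N}) w Phi :
  f (us w Phi) = us w (fun L R => f (Phi L R)).
Proof. exact: lsum_lin. Qed.

End Unshuffle.

(** * Cobar differential and Zinbiel coderivations on words *)

Section Multilinear.
Variables (K : fieldType) (V : gmod K) (M : lmodType K).
Local Notation word := (seq (helt V)).

(** A [helt] carries a degree and two of them cannot be added in general, so linearity is tested on
    triples related by [hlin]. *)
Definition hlinear (Psi : helt V -> M) : Prop :=
  forall a x y z, hlin a x y z -> Psi z = a *: Psi x + Psi y.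

Definition mlinear (Phi : word -> M) : Prop :=
  forall p q, hlinear (fun x => Phi (p ++ x :: q)).

Definition mlinear2 (Phi : word -> word -> M) : Prop :=
  (forall R, mlinear (Phi^~ R)) /\ (forall L, mlinear (Phi L)).

Lemma mlinear_cat (Phi : word -> M) p q :
  mlinear Phi -> mlinear (fun w => Phi (p ++ w ++ q)).
Proof.
move=> H p' q' a x y z Hl; rewrite /= -!catA !cat_cons !(catA p).
exact: H Hl.
Qed.

Lemma mlinear_suffix (Phi : word -> M) q :
  mlinear Phi -> mlinear (fun w => Phi (w ++ q)).
Proof. exact: (@mlinear_cat Phi [::]). Qed.

Lemma mlinear_prefix (Phi : word -> M) p :
  mlinear Phi -> mlinear (fun w => Phi (p ++ w)).
Proof.
move=> /(mlinear_cat p [::]) H p' q' a x y z Hl.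
by have := H p' q' a x y z Hl; rewrite !cats0.
Qed.

Lemma mlinear_bilin (Phi : word -> M) p q :
  mlinear Phi -> bilin (fun x y => Phi (p ++ x :: y :: q)).
Proof.
move=> H; split=> a x y z w Hl; first exact: H Hl.
by have /= := H (p ++ [:: w]) q _ _ _ _ Hl; rewrite -!catA /=.
Qed.

Lemma hlinearZ (e : K) (Psi : helt V -> M) :
  hlinear Psi -> hlinear (fun x => e *: Psi x).
Proof. by move=> H a x y z /H ->; rewrite scalerDr !scalerA [e * a]mulrC. Qed.

Lemma hlinearD (Psi Psi' : helt V -> M) :
  hlinear Psi -> hlinear Psi' -> hlinear (fun x => Psi x + Psi' x).
Proof.
by move=> H H' a x y z Hl; rewrite (H _ _ _ _ Hl) (H' _ _ _ _ Hl) scalerDr; zmodule.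
Qed.

Lemma hlinear0 (Psi : helt V -> M) x : hlinear Psi -> hval x = 0 -> Psi x = 0.
Proof.
move=> H Hx; apply: eq_double; rewrite -{2}[Psi x]scale1r.
by apply: H; split; rewrite // Hx scaler0 addr0.
Qed.

Lemma mlinear0 (Phi : word -> M) p x q :
  mlinear Phi -> hval x = 0 -> Phi (p ++ x :: q) = 0.
Proof. by move=> H; apply: hlinear0 (H p q). Qed.

Lemma mlinearZ (e : K) (Phi : word -> M) :
  mlinear Phi -> mlinear (fun w => e *: Phi w).
Proof. by move=> H p q; apply: hlinearZ; apply: H. Qed.

Lemma wdeg_hlin p q a (x y z : helt V) : hlin a x y z ->
  wdeg (p ++ x :: q) = wdeg (p ++ z :: q) /\ 
  wdeg (p ++ y :: q) = wdeg (p ++ z :: q).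
Proof. by case=> Hx Hy _; rewrite !wdeg_cat !wdeg_cons Hx Hy. Qed.

Lemma mlinear_eps (f : int -> int) (Phi : word -> M) :
  mlinear Phi -> mlinear (fun w => eps (f (wdeg w)) *: Phi w).
Proof.
move=> H p q a x y z Hl; have [-> ->] := wdeg_hlin p q Hl.
by rewrite (H _ _ _ _ _ _ Hl) scalerDr !scalerA [a * _]mulrC.
Qed.

Lemma us_mlinear (Phi : word -> word -> M) :
  mlinear2 Phi -> mlinear (fun w => us w Phi).
Proof.
move=> H p; elim: p Phi H => [|t p IH] Phi [HL HR] q a x y z Hl /=.
  rewrite !us_cons scalerDr addrACA -!usZ -!usD; apply: eq_us1 => L R.
  have [-> -> _] := Hl; rewrite (HR L [::] R _ _ _ _ Hl) (HL R [::] L _ _ _ _ Hl) /=.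
  by rewrite !scalerDr !scalerA [a * _]mulrC; zmodule.
rewrite !us_cons scalerDr addrACA; congr (_ + _).
  apply: (IH (fun L R => Phi (t :: L) R)) Hl; split=> [R|L].
    exact: (mlinear_prefix [:: t] (HL R)).
  exact: HR.
apply: (IH (fun L R => eps (hdeg t * wdeg L) *: Phi L (t :: R))) Hl; split=> [R|L].
  exact: (mlinear_eps (fun k => hdeg t * k) (HL (t :: R))).
exact: (mlinearZ _ (mlinear_prefix [:: t] (HR L))).
Qed.

End Multilinear.

Section Cobar.
Variables (K : fieldType) (W : gmod K).
Local Notation word := (seq (helt W)).
Variable spl : helt W -> seq (K * (helt W * helt W)).

Definition sp (M : lmodType K) x (Psi : helt W -> helt W -> M) : M :=
  lsum (spl x) (fun p => Psi p.1 p.2).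

Hypothesis spl_deg : forall x c, c \in spl x ->
  hdeg c.2.1 + hdeg c.2.2 = hdeg x + 1.
Hypothesis sp_anti : forall (M : lmodType K) x (Psi : helt W -> helt W -> M),
  bilin Psi ->
  sp x Psi = - sp x (fun a b => eps (hdeg a * hdeg b) *: Psi b a).
Hypothesis sp_hlinear : forall (M : lmodType K) (Psi : helt W -> helt W -> M),
  bilin Psi -> hlinear (fun x => sp x Psi).

Fixpoint cobar (w : word) : seq (K * word) :=
  if w is x :: w' then
    [seq (c.1, c.2.1 :: c.2.2 :: w') | c <- spl x] ++
    [seq (eps (hdeg x) * c.1, x :: c.2) | c <- cobar w']
  else [::].

Definition ds (M : lmodType K) w (Phi : word -> M) : M := lsum (cobar w) Phi.

Section Ds.
Variable M : lmodType K.
Implicit Types (Phi : word -> M) (Psi : helt W -> helt W -> M).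

Lemma eq_sp x Psi Psi' :
  (forall a b, hdeg a + hdeg b = hdeg x + 1 -> Psi a b = Psi' a b) ->
  sp x Psi = sp x Psi'.
Proof. by move=> E; apply: eq_lsum_in => c /spl_deg; apply: E. Qed.

Lemma spD x Psi Psi' : sp x (fun a b => Psi a b + Psi' a b) = sp x Psi + sp x Psi'.
Proof. exact: lsumD. Qed.

Lemma spZ x e Psi : sp x (fun a b => e *: Psi a b) = e *: sp x Psi.
Proof. exact: lsumZ. Qed.

Lemma ds_nil Phi : ds [::] Phi = 0.
Proof. exact: lsum_nil. Qed.

Lemma ds_cons x w Phi : ds (x :: w) Phi =
  sp x (fun a b => Phi (a :: b :: w)) + eps (hdeg x) *: ds w (fun u => Phi (x :: u)).
Proof.
rewrite /ds /= lsum_cat /lsum !big_map scaler_sumr; congr (_ + _).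
by apply: eq_bigr => c _ /=; rewrite scalerA.
Qed.

Lemma cobar_deg w c : c \in cobar w -> wdeg c.2 = wdeg w + 1.
Proof.
elim: w c => [|x w IH] c //=; rewrite mem_cat => /orP[] /mapP[e].
  by move=> /spl_deg E -> /=; rewrite !wdeg_cons addrA E; ring.
by move=> /IH E -> /=; rewrite !wdeg_cons E; ring.
Qed.

Lemma eq_ds w Phi Phi' :
  (forall u, wdeg u = wdeg w + 1 -> Phi u = Phi' u) -> ds w Phi = ds w Phi'.
Proof. by move=> E; apply: eq_lsum_in => c /cobar_deg; apply: E. Qed.

Lemma dsD w Phi Phi' : ds w (fun u => Phi u + Phi' u) = ds w Phi + ds w Phi'.
Proof. exact: lsumD. Qed.

Lemma dsZ w e Phi : ds w (fun u => e *: Phi u) = e *: ds w Phi.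
Proof. exact: lsumZ. Qed.

Lemma ds_us w (U : gmod K) (w' : seq (helt U))
    (Phi : word -> seq (helt U) -> seq (helt U) -> M) :
  ds w (fun u => us w' (Phi u)) = us w' (fun L R => ds w (fun u => Phi u L R)).
Proof. exact: lsumC. Qed.

Lemma sp_us x (U : gmod K) (w : seq (helt U))
    (Phi : helt W -> helt W -> seq (helt U) -> seq (helt U) -> M) :
  sp x (fun a b => us w (Phi a b)) = us w (fun L R => sp x (fun a b => Phi a b L R)).
Proof. exact: lsumC. Qed.

Lemma ds_cat u v Phi : ds (u ++ v) Phi =
  ds u (fun u' => Phi (u' ++ v)) + eps (wdeg u) *: ds v (fun v' => Phi (u ++ v')).
Proof.
elim: u Phi => [|x u IH] Phi.
  by rewrite ds_nil wdeg_nil eps0 scale1r add0r.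
rewrite cat_cons !ds_cons IH wdeg_cons scalerDr addrA; congr (_ + _).
by rewrite scalerA epsD.
Qed.

Lemma ds_rcons w x Phi : ds (w ++ [:: x]) Phi =
  ds w (fun u => Phi (u ++ [:: x])) +
  eps (wdeg w) *: sp x (fun a b => Phi (w ++ [:: a; b])).
Proof. by rewrite ds_cat ds_cons ds_nil scaler0 addr0. Qed.

Lemma ds_mlinear Phi : mlinear Phi -> mlinear (fun w => ds w Phi).
Proof.
move=> H p; elim: p Phi H => [|t p IH] Phi H q a x y z Hl /=.
  rewrite !ds_cons; have [-> -> _] := Hl.
  rewrite (sp_hlinear (mlinear_bilin [::] q H) Hl) /=.
  have -> : ds q (fun u => Phi (z :: u)) =
      a *: ds q (fun u => Phi (x :: u)) + ds q (fun u => Phi (y :: u)).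
    by rewrite -dsZ -dsD; apply: eq_ds => u _; exact: (H [::] u _ _ _ _ Hl).
  by rewrite !scalerDr !scalerA [eps _ * a]mulrC; zmodule.
rewrite !ds_cons (IH (fun u => Phi (t :: u)) _ _ _ _ _ _ Hl); last first.
  exact: (mlinear_prefix [:: t]).
have -> : sp t (fun a0 b => Phi [:: a0, b & p ++ z :: q]) =
    a *: sp t (fun a0 b => Phi [:: a0, b & p ++ x :: q]) +
    sp t (fun a0 b => Phi [:: a0, b & p ++ y :: q]).
  rewrite -spZ -spD; apply: eq_sp => c d _.
  exact: (H [:: c, d & p] q _ _ _ _ Hl).
by rewrite !scalerDr !scalerA [eps _ * a]mulrC; zmodule.
Qed.

(* The terms with the two parts of a letter on different sides cancel because
   the splitting is graded antisymmetric. *)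
Lemma ds_unsh w (Phi : word -> word -> M) : mlinear2 Phi ->
  ds w (fun u => us u Phi) = us w (fun L R =>
    ds L (fun L' => Phi L' R) + eps (wdeg L) *: ds R (fun R' => Phi L R')).
Proof.
elim: w Phi => [|x w IH] Phi [HL HR].
  by rewrite ds_nil us_nil !ds_nil scaler0 addr0.
have HA : mlinear2 (fun L R => Phi (x :: L) R).
  by split=> [R|L]; [exact: (mlinear_prefix [:: x] (HL R))|exact: HR].
have HB : mlinear2 (fun L R => eps (hdeg x * wdeg L) *: Phi L (x :: R)).
  split=> [R|L]; first exact: (mlinear_eps (fun k => hdeg x * k) (HL (x :: R))).
  exact: (mlinearZ _ (mlinear_prefix [:: x] (HR L))).
have E1 : ds w (fun u => us (x :: u) Phi) =
    us w (fun L R => ds L (fun L' => Phi (x :: L') R) +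
      eps (wdeg L) *: ds R (fun R' => Phi (x :: L) R')) +
    us w (fun L R => ds L (fun L' => eps (hdeg x * wdeg L') *: Phi L' (x :: R)) +
      eps (wdeg L) *: ds R (fun R' => eps (hdeg x * wdeg L) *: Phi L (x :: R'))).
  by rewrite -(IH _ HA) -(IH _ HB) -dsD; apply: eq_ds => u _; rewrite us_cons.
rewrite ds_cons {}E1 !us_cons.
have -> : sp x (fun a b => us [:: a, b & w] Phi) = us w (fun L R => sp x (fun a b =>
    Phi [:: a, b & L] R + eps (hdeg b * wdeg L) *: Phi (a :: L) (b :: R) +
    (eps (hdeg a * (hdeg b + wdeg L)) *: Phi (b :: L) (a :: R) +
     eps ((hdeg a + hdeg b) * wdeg L) *: Phi L [:: a, b & R]))).
  rewrite -sp_us; apply: eq_sp => a b _; rewrite !us_cons.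
  rewrite -!usD; apply: eq_us1 => L R; rewrite !wdeg_cons.
  by rewrite scalerA -!epsD -mulrDl [hdeg b + hdeg a]addrC.
have E2 L R : sp x (fun a b =>
    Phi [:: a, b & L] R + eps (hdeg b * wdeg L) *: Phi (a :: L) (b :: R) +
    (eps (hdeg a * (hdeg b + wdeg L)) *: Phi (b :: L) (a :: R) +
     eps ((hdeg a + hdeg b) * wdeg L) *: Phi L [:: a, b & R])) =
    sp x (fun a b => Phi [:: a, b & L] R) +
    eps ((hdeg x + 1) * wdeg L) *: sp x (fun a b => Phi L [:: a, b & R]).
  rewrite !spD -addrA; congr (_ + _).
  have -> : sp x (fun a b => eps ((hdeg a + hdeg b) * wdeg L) *: Phi L [:: a, b & R]) =
    eps ((hdeg x + 1) * wdeg L) *: sp x (fun a b => Phi L [:: a, b & R]).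
    by rewrite -spZ; apply: eq_sp => a b ->.
  rewrite addrA [X in X + _](_ : _ = 0) ?add0r //.
  rewrite sp_anti; last first.
    split=> a u v z t Hl.
      rewrite (HL _ [::] L _ _ _ _ Hl) /=.
      by rewrite scalerDr !scalerA [a * _]mulrC.
    have [-> -> _] := Hl; rewrite (HR _ [::] R _ _ _ _ Hl) /=.
    by rewrite scalerDr !scalerA [a * _]mulrC.
  apply/eqP; rewrite addrC subr_eq0; apply/eqP.
  apply: eq_sp => a b _; rewrite scalerA -epsD; congr (_ *: _).
  by apply: eps_par; par.
under eq_us1 do rewrite E2.
rewrite scalerDr -!usZ -!usD; apply: eq_us1 => L R.
rewrite !ds_cons dsZ wdeg_cons.
have -> : ds L (fun L' => eps (hdeg x * wdeg L') *: Phi L' (x :: R)) =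
    eps (hdeg x * (wdeg L + 1)) *: ds L (fun L' => Phi L' (x :: R)).
  by rewrite -dsZ; apply: eq_ds => u ->.
by signs.
Qed.

End Ds.

Section Zcoder.
Variable F : word -> helt W.
Hypothesis F_deg : forall w, hdeg (F w) = wdeg w - 1.
Hypothesis F_lin : forall a p x y z q, hlin a x y z ->
  hlin a (F (p ++ x :: q)) (F (p ++ y :: q)) (F (p ++ z :: q)).

(* The coderivation of deltaZ with corestriction F: a block is a subword with its
   last letter in place j, the other letters being moved next to it. *)
Definition zcoder w : seq (K * word) :=
  flatten [seq [seq (eps (wdeg c.2.1) * c.1,
      c.2.1 ++ F (c.2.2 ++ [:: nth (helt0 W) w j]) :: drop j.+1 w)
    | c <- unsh (take j w)] | j <- iota 0 (size w)].

Definition Ds (M : lmodType K) w (Phi : word -> M) : M := lsum (zcoder w) Phi.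

Section DsTheory.
Variable M : lmodType K.
Implicit Types (Phi : word -> M).

Lemma DsE w Phi : Ds w Phi = \sum_(j <- iota 0 (size w)) us (take j w)
  (fun u v => eps (wdeg u) *:
     Phi (u ++ F (v ++ [:: nth (helt0 W) w j]) :: drop j.+1 w)).
Proof.
rewrite /Ds /lsum big_flatten big_map; apply: eq_bigr => j _.
by rewrite big_map; apply: eq_bigr => c _ /=; rewrite scalerA mulrC.
Qed.

Lemma Ds_nil Phi : Ds [::] Phi = 0.
Proof. exact: lsum_nil. Qed.

Lemma Ds_rcons w x Phi : Ds (w ++ [:: x]) Phi =
  Ds w (fun u => Phi (u ++ [:: x])) +
  us w (fun u v => eps (wdeg u) *: Phi (u ++ [:: F (v ++ [:: x])])).
Proof.
rewrite !DsE size_cat addn1 -addn1 iotaD big_cat big_seq1 /= add0n.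
rewrite take_size_cat // nth_cat ltnn subnn /= drop_oversize ?size_cat ?addn1 //.
congr (_ + _); apply: eq_big_seq => j; rewrite mem_iota add0n /= => lt_j.
rewrite takel_cat ?(ltnW lt_j) // nth_cat lt_j drop_cat.
have [lt_j1|] := ltnP j.+1 (size w).
  by apply: eq_us1 => u v; rewrite -!catA.
move=> le_j; have -> : j.+1 = size w by apply/eqP; rewrite eqn_leq lt_j.
by apply: eq_us1 => u v; rewrite subnn drop_size -!catA.
Qed.

Lemma zcoder_deg w c : c \in zcoder w -> wdeg c.2 = wdeg w - 1.
Proof.
move=> /flattenP[s /mapP[j]]; rewrite mem_iota add0n /= => lt_j -> /mapP[e He ->] /=.
have -> : wdeg w = wdeg (take j w) + (hdeg (nth (helt0 W) w j) + wdeg (drop j.+1 w)).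
  by rewrite -wdeg_cons -(drop_nth (helt0 W)) // -wdeg_cat cat_take_drop.
rewrite -(unsh_deg He) !wdeg_cat wdeg_cons F_deg wdeg_cat wdeg_cons wdeg_nil; ring.
Qed.

Lemma eq_Ds w Phi Phi' :
  (forall u, wdeg u = wdeg w - 1 -> Phi u = Phi' u) -> Ds w Phi = Ds w Phi'.
Proof. by move=> E; apply: eq_lsum_in => c /zcoder_deg; apply: E. Qed.

Lemma DsD w Phi Phi' : Ds w (fun u => Phi u + Phi' u) = Ds w Phi + Ds w Phi'.
Proof. exact: lsumD. Qed.

Lemma DsZ w e Phi : Ds w (fun u => e *: Phi u) = e *: Ds w Phi.
Proof. exact: lsumZ. Qed.

(** A block stays together, so it ends up on the side to which the new letter is sent; hence D is
    also a coderivation of the coproduct by all unshuffles. *)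
Lemma us_Ds w (Phi : word -> word -> M) :
  Ds w (fun u => us u Phi) = us w (fun L R =>
    Ds L (fun L' => Phi L' R) + eps (wdeg L) *: Ds R (fun R' => Phi L R')).
Proof.
elim/last_ind: w Phi => [|w x IH] Phi.
  by rewrite us_nil !Ds_nil scaler0 addr0.
rewrite -cats1 Ds_rcons us_rcons.
have -> : Ds w (fun u => us (u ++ [:: x]) Phi) = us w (fun L R =>
    Ds L (fun L' => eps (wdeg R * hdeg x) *: Phi (L' ++ [:: x]) R) +
    eps (wdeg L) *: Ds R (fun R' => eps (wdeg R' * hdeg x) *: Phi (L ++ [:: x]) R')) +
    us w (fun L R => Ds L (fun L' => Phi L' (R ++ [:: x])) +
      eps (wdeg L) *: Ds R (fun R' => Phi L (R' ++ [:: x]))).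
  rewrite -(IH (fun L R => eps (wdeg R * hdeg x) *: Phi (L ++ [:: x]) R)).
  by rewrite -(IH (fun L R => Phi L (R ++ [:: x]))) -DsD; apply: eq_Ds => u _;
    rewrite us_rcons.
have -> : us w (fun u v => eps (wdeg u) *: us (u ++ [:: F (v ++ [:: x])]) Phi) =
    us w (fun u v => us u (fun L R => eps (wdeg L + wdeg R) *:
       (eps (wdeg R * (wdeg v + hdeg x - 1)) *: Phi (L ++ [:: F (v ++ [:: x])]) R))) +
    us w (fun u v => us u (fun L R => eps (wdeg L + wdeg R) *:
       Phi L (R ++ [:: F (v ++ [:: x])]))).
  rewrite -usD; apply: eq_us1 => u v; rewrite us_rcons scalerDr -!usZ.
  by congr (_ + _); apply: eq_us => L R -> _; rewrite // F_deg wdeg_cat wdeg_cons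
    wdeg_nil addr0.
rewrite !us_coassoc.
(* When the block goes to the left, its letters must move past the right word before coassociativity
   can group them with the left word. *)
under [X in _ + (X + _)]eq_us1 do rewrite us_comm.
rewrite -[X in _ + (X + _)]us_coassoc.
rewrite -!usD; apply: eq_us1 => L R; rewrite !Ds_rcons wdeg_cat wdeg_cons wdeg_nil addr0.
have -> : Ds R (fun R' => eps (wdeg R' * hdeg x) *: Phi (L ++ [:: x]) R') =
    eps ((wdeg R - 1) * hdeg x) *: Ds R (fun R' => Phi (L ++ [:: x]) R').
  by rewrite -DsZ; apply: eq_Ds => u ->.
rewrite DsZ !scalerDr.
have -> : us L (fun a b => eps (wdeg b * wdeg R) *: (eps (wdeg a + wdeg R) *:
    (eps (wdeg R * (wdeg b + hdeg x - 1)) *: Phi (a ++ [:: F (b ++ [:: x])]) R))) =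
    eps (wdeg R * hdeg x) *: us L (fun u v => eps (wdeg u) *:
      Phi (u ++ [:: F (v ++ [:: x])]) R).
  rewrite -usZ; apply: eq_us1 => a b; rewrite !scalerA -!epsD; congr (_ *: _).
  by apply: eps_par; par.
have -> : us R (fun b v => eps (wdeg L + wdeg b) *: Phi L (b ++ [:: F (v ++ [:: x])])) =
    eps (wdeg L) *: us R (fun u v => eps (wdeg u) *: Phi L (u ++ [:: F (v ++ [:: x])])).
  by rewrite -usZ; apply: eq_us1 => a b; rewrite !scalerA -!epsD.
by signs.
Qed.

End DsTheory.

End Zcoder.

End Cobar.

Section Bracket.
Variables (K : fieldType) (W : gmod K).
Local Notation word := (seq (helt W)).
Variable spl : helt W -> seq (K * (helt W * helt W)).
Hypothesis spl_deg : forall x c, c \in spl x ->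
  hdeg c.2.1 + hdeg c.2.2 = hdeg x + 1.
Hypothesis sp_anti : forall (M : lmodType K) x (Psi : helt W -> helt W -> M),
  bilin Psi ->
  sp spl x Psi = - sp spl x (fun a b => eps (hdeg a * hdeg b) *: Psi b a).
Variable F : word -> helt W.
Hypothesis F_deg : forall w, hdeg (F w) = wdeg w - 1.
Hypothesis F_lin : forall a p x y z q, hlin a x y z ->
  hlin a (F (p ++ x :: q)) (F (p ++ y :: q)) (F (p ++ z :: q)).
Variable G : word -> helt W.
Hypothesis G_nil : hval (G [::]) = 0.
Hypothesis FG_ds : forall (M : lmodType K) (Psi : helt W -> M) v x,
  hlinear Psi ->
  ds spl (v ++ [:: x]) (fun u => Psi (F u)) = Psi (G (v ++ [:: x])).
(** The right side is what the induction on the last letter x in [Ds_ds] requires: the induction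
    hypothesis yields the words u G(v) x, whereas the unshuffles of w x that keep x out of the
    argument of G yield u x G(v). *)
Hypothesis FG_sp : forall (M : lmodType K) (Psi : helt W -> helt W -> M) v x,
  bilin Psi ->
  sp spl (F (v ++ [:: x])) Psi + eps (wdeg v) *: sp spl x (fun a b =>
    Psi (F (v ++ [:: a])) b +
    eps ((wdeg v + 1) * hdeg a) *: Psi a (F (v ++ [:: b]))) =
  eps (wdeg v * hdeg x) *: Psi x (G v) - Psi (G v) x.

Lemma mlinear2_F (M : lmodType K) (Phi : word -> M) x :
  mlinear Phi ->
  mlinear2 (fun L R => eps (wdeg L) *: Phi (L ++ [:: F (R ++ [:: x])])).
Proof.
move=> H; split=> [R|L].
  exact: (mlinear_eps id (mlinear_suffix _ H)).
apply: mlinearZ => p q a u v w Hl; apply: H L [::] _ _ _ _ _.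
by rewrite -!catA; apply: F_lin.
Qed.

(* Apart from cancelling pairs, there remain the splittings inside a block,
   evaluated by FG_ds, and those of a letter produced by F or of the last letter
   of a block, evaluated by FG_sp. *)
Lemma Ds_ds (M : lmodType K) w (Phi : word -> M) : mlinear Phi ->
  Ds F w (fun u => ds spl u Phi) + ds spl w (fun u => Ds F u Phi) =
  us w (fun u v => Phi (u ++ [:: G v])).
Proof.
elim/last_ind: w Phi => [|w x IH] Phi H.
  by rewrite Ds_nil ds_nil us_nil addr0 (mlinear0 [::] [::] H).
have HA : mlinear (fun u => Phi (u ++ [:: x])) by exact: mlinear_suffix.
rewrite -cats1 Ds_rcons ds_rcons us_rcons.
have -> : Ds F w (fun u => ds spl (u ++ [:: x]) Phi) =
    Ds F w (fun u => ds spl u (fun u' => Phi (u' ++ [:: x]))) +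
    - eps (wdeg w) *: Ds F w (fun u => sp spl x (fun a b => Phi (u ++ [:: a; b]))).
  rewrite -DsZ -DsD; apply: (eq_Ds F_deg) => u Hu; rewrite ds_rcons Hu.
  by congr (_ + _ *: _); rewrite epsD -[- 1]add0r epsD [eps (- 1)]eps_oddz /=
    eps0 mul1r mulrN1.
have -> : us w (fun u v => eps (wdeg u) *: ds spl (u ++ [:: F (v ++ [:: x])]) Phi) =
    us w (fun u v => eps (wdeg u) *: ds spl u (fun u' =>
      Phi (u' ++ [:: F (v ++ [:: x])]))) +
    us w (fun u v => sp spl (F (v ++ [:: x])) (fun a b => Phi (u ++ [:: a; b]))).
  rewrite -usD; apply: eq_us1 => u v; rewrite ds_rcons scalerDr scalerA.
  by rewrite eps_sqr scale1r.
have -> : ds spl w (fun u => Ds F (u ++ [:: x]) Phi) =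
    ds spl w (fun u => Ds F u (fun u' => Phi (u' ++ [:: x]))) +
    us w (fun L R => ds spl L (fun L' => eps (wdeg L') *:
      Phi (L' ++ [:: F (R ++ [:: x])])) +
      eps (wdeg L) *: ds spl R (fun R' => eps (wdeg L) *:
      Phi (L ++ [:: F (R' ++ [:: x])]))).
  rewrite -(ds_unsh spl_deg sp_anti w (mlinear2_F x H)) -dsD.
  by apply: (eq_ds spl_deg) => u _; rewrite Ds_rcons.
(* Apart from blocks inside w, a block ends in a, or ends in b and leaves a outside, or ends in b
   and contains a. *)
have -> : sp spl x (fun a b => Ds F (w ++ [:: a; b]) Phi) =
    Ds F w (fun u => sp spl x (fun a b => Phi (u ++ [:: a; b]))) +
    us w (fun u v => sp spl x (fun a b =>
      eps (wdeg u) *: Phi (u ++ [:: F (v ++ [:: a]); b]) +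
      (eps (wdeg v * hdeg a + wdeg u + hdeg a) *: Phi (u ++ [:: a; F (v ++ [:: b])]) +
       eps (wdeg u) *: Phi (u ++ [:: F (v ++ [:: a; b])])))).
  have -> : Ds F w (fun u => sp spl x (fun a b => Phi (u ++ [:: a; b]))) =
      sp spl x (fun a b => Ds F w (fun u => Phi (u ++ [:: a; b]))) by exact: lsumC.
  rewrite -sp_us -spD; apply: (eq_sp spl_deg) => a b _.
  rewrite -[[:: a; b]]/([:: a] ++ [:: b]) catA Ds_rcons Ds_rcons us_rcons -addrA.
  congr (_ + _); first by apply: eq_lsum => u; rewrite -catA.
  rewrite -!usD; apply: eq_us1 => u v; rewrite !wdeg_cat !wdeg_cons wdeg_nil -!catA /=.
  by rewrite scalerA -epsD addr0 -addrA.
have IHx := IH _ HA; rewrite scalerDr scaleNr.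
set A1 := Ds F w _ in IHx *; set A3 := ds spl w _ in IHx *; set A2 := Ds F w _.
set B1 := us w _; set B2 := us w _; set B3 := us w _; set B4 := us w _.
transitivity (A1 + A3 + (B1 + B3 + (B2 + eps (wdeg w) *: B4))); first by zmodule.
rewrite {}IHx {A1 A2 A3}.
have -> : B1 + B3 = us w (fun u v =>
    ds spl v (fun v' => Phi (u ++ [:: F (v' ++ [:: x])]))).
  rewrite -usD; apply: eq_us1 => u v.
  have -> : ds spl u (fun L' => eps (wdeg L') *: Phi (L' ++ [:: F (v ++ [:: x])])) =
      eps (wdeg u + 1) *: ds spl u (fun L' => Phi (L' ++ [:: F (v ++ [:: x])])).
    by rewrite -dsZ; apply: (eq_ds spl_deg) => u' ->.
  by rewrite dsZ; signs.
rewrite {}/B2 {}/B4 {B1 B3} -usZ -!usD; apply: eq_us => u v Ew _.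
have HP : bilin (fun a b => Phi (u ++ [:: a; b])) := mlinear_bilin u [::] H.
have HP1 : hlinear (fun a => Phi (u ++ [:: a])) := H u [::].
have := FG_sp v x HP; have := FG_ds v x HP1; rewrite ds_rcons => <-.
rewrite -!catA /=.
move=> E.
have -> : eps (wdeg w) *: sp spl x (fun a b =>
    eps (wdeg u) *: Phi (u ++ [:: F (v ++ [:: a]); b]) +
    (eps (wdeg v * hdeg a + wdeg u + hdeg a) *: Phi (u ++ [:: a; F (v ++ [:: b])]) +
     eps (wdeg u) *: Phi (u ++ [:: F (v ++ [:: a; b])]))) =
    eps (wdeg v) *: sp spl x (fun a b => Phi (u ++ [:: F (v ++ [:: a]); b]) +
      eps ((wdeg v + 1) * hdeg a) *: Phi (u ++ [:: a; F (v ++ [:: b])])) +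
    eps (wdeg v) *: sp spl x (fun a b => Phi (u ++ [:: F (v ++ [:: a; b])])).
  by rewrite -!spZ -spD; apply: (eq_sp spl_deg) => a b _; rewrite -Ew; signs.
by rewrite [X in _ + (_ + X)]addrA E; zmodule.
Qed.

Lemma Ds_mlinear (M : lmodType K) (Phi : word -> M) :
  mlinear Phi -> mlinear (fun w => Ds F w Phi).
Proof.
move=> H p q; elim/last_ind: q p Phi H => [|q t IH] p Phi H a x y z Hl.
  rewrite !Ds_rcons scalerDr addrACA; congr (_ + _).
    rewrite -DsZ -DsD; apply: eq_lsum => u; exact: (H u [::] _ _ _ _ Hl).
  rewrite -usZ -usD; apply: eq_us1 => u v.
  rewrite (H u [::] _ _ _ _ (F_lin v [::] Hl)).
  by rewrite scalerDr !scalerA [a * _]mulrC.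
rewrite -cats1 -!cat_cons !catA !Ds_rcons scalerDr addrACA; congr (_ + _).
  exact: (IH p _ (mlinear_suffix _ H)).
exact: (us_mlinear (mlinear2_F t H) p q Hl).
Qed.

End Bracket.

(** * Homogeneous representatives *)

Section Homogeneous.
Variables (K : fieldType) (T : choiceType) (deg : T -> int).
Variable R : seq (K * T) -> Prop.
Hypothesis RH : forall r, R r -> exists k, forall c, c \in r -> deg c.2 = k.
Local Notation P := (gpres RH).

Lemma gpres_split (k : int) (x : P) : gproj P k x = x ->
  exists2 s : seq (K * T), {in s, forall c, deg c.2 = k}
    & x = lsum s (fun t => pgen R t : P).
Proof.
move=> <-; elim/pres_ind: x => [|a t x [s Hs Ex]].
  by exists [::]; rewrite // raddf0 lsum_nil.
rewrite linearP Ex /= (gpres_proj_gen RH); have [Et|_] := eqVneq (deg t) k; last first.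
  by exists s; rewrite // scaler0 add0r.
exists ((a, t) :: s); last by rewrite lsum_cons.
by move=> c; rewrite inE => /predU1P[->|/Hs].
Qed.

Lemma ghom_gen p (V : gmod K) (f : {linear P -> V}) :
  (forall t, gproj V (deg t + p) (f (pgen R t)) = f (pgen R t)) ->
  forall k x, gproj P k x = x -> gproj V (k + p) (f x) = f x.
Proof.
move=> H k x /gpres_split[s Hs ->]; rewrite lsum_lin lsum_lin.
by apply: eq_lsum_in => c /Hs <-; apply: H.
Qed.

End Homogeneous.

Section HlinearSum.
Variables (K : fieldType) (V : gmod K) (M : lmodType K) (T : eqType).

(** Functions such as [tpair] take homogeneous elements and are not maps on the module. This
    evaluates them at the image of a word under a coderivation by expanding the value of that
    image. *)
Lemma hlinear_lsum_val (Psi : helt V -> M) (z : helt V) (s : seq (K * T))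
    (h : T -> helt V) :
  hlinear Psi -> {in s, forall c, hdeg (h c.2) = hdeg z} ->
  hval z = lsum s (fun t => hval (h t)) -> Psi z = lsum s (fun t => Psi (h t)).
Proof.
move=> HP; elim: s z => [|c s IH] z Hs.
  by rewrite !lsum_nil; apply: hlinear0.
rewrite !lsum_cons => Ez.
have Hy : gproj V (hdeg z) (lsum s (fun t => hval (h t))) =
    lsum s (fun t => hval (h t)).
  rewrite lsum_lin; apply: eq_lsum_in => e es.
  by rewrite -(Hs e) ?heltP // inE es orbT.
rewrite (HP c.1 (h c.2) (Helt Hy) z); last by split; rewrite ?(Hs c) ?mem_head.
by rewrite (IH (Helt Hy)) // => e es; rewrite Hs // inE es orbT.
Qed.

End HlinearSum.

Section TensorHlinear.
Variables (K : fieldType) (V W : gmod K).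

Lemma tpair_hlinearL (y : helt W) : hlinear (fun x : helt V => tpair x y).
Proof. by move=> a u v w /tpairL. Qed.

Lemma tpair_hlinearR (x : helt V) : hlinear (fun y : helt W => tpair x y).
Proof. by move=> a u v w /tpairR. Qed.

Lemma tword_mlinear : mlinear (fun w : seq (helt V) => hval (tword w)).
Proof.
by move=> p q a x y z /(wlin1 p q)/wlin_tword[].
Qed.

Lemma mlinear_tpairL (y : helt W) :
  mlinear (fun w : seq (helt V) => tpair (tword w) y).
Proof. by move=> p q a u v w /(wlin1 p q)/wlin_tword/tpairL. Qed.

Lemma mlinear_tpairR (x : helt V) :
  mlinear (fun w : seq (helt W) => tpair x (tword w)).
Proof. by move=> p q a u v w /(wlin1 p q)/wlin_tword/tpairR. Qed.

Lemma mlinear_mlin (M : lmodType K) (F : seq (helt V) -> M) :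
  F [::] = 0 -> mlinear F -> mlin F.
Proof.
by move=> F0 H; split=> // a u v w [p [q [x [y [z [Hl [-> -> ->]]]]]]]; apply: H.
Qed.

Lemma tpair0l (x : helt V) (y : helt W) : hval x = 0 -> tpair x y = 0.
Proof. exact: (hlinear0 (tpair_hlinearL y)). Qed.

Lemma tpair0r (x : helt V) (y : helt W) : hval y = 0 -> tpair x y = 0.
Proof. exact: (hlinear0 (tpair_hlinearR x)). Qed.

End TensorHlinear.

Section SplitLetter.
Variables (K : fieldType) (W : gmod K) (delta : {linear W -> tens W W}).
Hypothesis delta_deg : forall k x, gproj W k x = x ->
  gproj (tens W W) (k + 1) (delta x) = delta x.

(** The presentation of delta x is chosen by [cid2] and is not canonical. Sums over it are
    meaningful against bilinear functions, where [sp_tens_lift] shows that they depend on delta x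
    alone. *)
Definition letter_split (x : helt W) : seq (K * (helt W * helt W)) :=
  let: exist2 s _ _ := cid2 (gpres_split (delta_deg (heltP x))) in s.

Lemma letter_split_deg x c : c \in letter_split x ->
  hdeg c.2.1 + hdeg c.2.2 = hdeg x + 1.
Proof. by rewrite /letter_split; case: cid2 => s Hs _ /Hs. Qed.

Lemma letter_splitE x :
  delta (hval x) = lsum (letter_split x) (fun p => tpair p.1 p.2).
Proof.
rewrite /letter_split; case: cid2 => s _ ->; apply: eq_lsum => t.
by case: t.
Qed.

Lemma sp_tens_lift (M : lmodType K) (Psi : helt W -> helt W -> M) x
    (B : bilin Psi) :
  sp letter_split x Psi = tens_lift B (delta (hval x)).
Proof.
by rewrite letter_splitE lsum_lin; apply: eq_lsum => t; rewrite tens_liftE.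
Qed.

Lemma letter_split_hlinear (M : lmodType K) (Psi : helt W -> helt W -> M) :
  bilin Psi -> hlinear (fun x => sp letter_split x Psi).
Proof.
by move=> B a x y z [_ _ Hz]; rewrite !(sp_tens_lift _ B) Hz linearP linearP.
Qed.

Lemma letter_split_anti (M : lmodType K) x (Psi : helt W -> helt W -> M) :
  (forall y, flip W W (delta y) = - delta y) -> bilin Psi ->
  sp letter_split x Psi =
  - sp letter_split x (fun a b => eps (hdeg a * hdeg b) *: Psi b a).
Proof.
move=> H B; rewrite (sp_tens_lift _ B) -[delta _]opprK -H raddfN.
have -> : flip W W (delta (hval x)) = lsum (letter_split x)
    (fun t => eps (hdeg t.1 * hdeg t.2) *: tpair t.2 t.1 : tens W W).
  by rewrite letter_splitE lsum_lin; apply: eq_lsum => t; rewrite flipE.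
congr (- _); apply: etrans (lsum_lin _ _ _) _.
by apply: eq_lsum => t; rewrite linearZ tens_liftE.
Qed.

End SplitLetter.

Section MaskSums.
Variables (K : fieldType) (V : gmod K) (M : lmodType K).
Local Notation word := (seq (helt V)).

Lemma big_masksS n (f : bitseq -> M) :
  \sum_(m <- masks n.+1) f m =
  \sum_(m <- masks n) f (true :: m) + \sum_(m <- masks n) f (false :: m).
Proof. by rewrite /= big_cat !big_map. Qed.

Lemma big_masks_rcons n (f : bitseq -> M) :
  \sum_(m <- masks n.+1) f m =
  \sum_(m <- masks n) f (m ++ [:: true]) + \sum_(m <- masks n) f (m ++ [:: false]).
Proof.
elim: n f => [|n IH] f; first by rewrite big_masksS !big_seq1.
rewrite big_masksS (IH (fun m => f (true :: m))) (IH (fun m => f (false :: m))).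
by rewrite (big_masksS n (fun m => f (m ++ [:: true])))
  (big_masksS n (fun m => f (m ++ [:: false]))) addrACA.
Qed.

Lemma us_masks w (Phi : word -> word -> M) :
  us w Phi = \sum_(m <- masks (size w)) eps (unsh_exp (map (@hdeg K V) w) m) *:
    Phi (mask m w) (mask (map negb m) w).
Proof.
elim: w Phi => [|x w IH] Phi.
  by rewrite us_nil big_seq1 /= eps0 scale1r.
rewrite us_cons !IH [size _]/= big_masksS; congr (_ + _); apply: eq_bigr => m _ /=.
  by rewrite add0r.
by rewrite scalerA -epsD addrC wdegE map_mask.
Qed.

Lemma big_unshuff n a b A B (f : bitseq -> M) :
  \sum_(a <= i < b) \sum_(m <- unshuff n i A B) f m =
  \sum_(m <- masks n | [&& (a <= count id m)%N, (count id m < b)%N,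
     oapp (fun k => nth false m k) true A &
     oapp (fun k => ~~ nth true m k) true B]) f m.
Proof.
under eq_bigr do rewrite big_filter big_mkcond.
rewrite exchange_big [RHS]big_mkcond; apply: eq_bigr => m _.
set C := _ && oapp _ _ B.
transitivity (\sum_(a <= i < b | i == count id m) if C then f m else 0).
  by rewrite [RHS]big_mkcond; apply: eq_bigr => i _; rewrite /= [i == _]eq_sym; case: eqP.
by rewrite big_nat1_eq; case: (a <= _)%N; case: (_ < b)%N.
Qed.

End MaskSums.

(** * The coproducts of the bar coalgebra *)

Section LinearPredicate.
Variables (K : fieldType) (U V M : lmodType K).

(** Linearity is handled as a predicate on bare functions, because the two sides compared by
    [tbar_ext] and [tens_ext] are composites without a declared linear structure. *)
Lemma linear_compp (f : V -> M) (g : U -> V) :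
  linear f -> linear g -> linear (fun x => f (g x)).
Proof. by move=> Hf Hg a x y; rewrite Hg Hf. Qed.

Lemma linear_addp (f g : U -> M) :
  linear f -> linear g -> linear (fun x => f x + g x).
Proof. by move=> Hf Hg a x y; rewrite Hf Hg scalerDr addrACA. Qed.

Lemma linear_scalep (c : K) (f : U -> M) : linear f -> linear (fun x => c *: f x).
Proof. by move=> Hf a x y; rewrite Hf scalerDr !scalerA mulrC. Qed.

Lemma linear_subp (f g : U -> M) :
  linear f -> linear g -> linear (fun x => f x - g x).
Proof.
move=> Hf Hg a x y; rewrite Hf Hg opprD scalerBr addrACA; congr (_ + _).
Qed.

End LinearPredicate.

Section ZinbielCoproduct.
Variables (K : fieldType) (W : gmod K).
Local Notation word := (seq (helt W)).

Definition wpair (L R : word) : tens (Tbar W) (Tbar W) := tpair (tword L) (tword R).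

Lemma wpair_nill R : wpair [::] R = 0.
Proof. by apply: tpair0l; apply: tword_nil. Qed.

Lemma mask_nseq0 (T : Type) (m : bitseq) (s : seq T) :
  count id m = 0 -> mask m s = [::].
Proof. by elim: m s => [|[] m IH] [|y s] //=; rewrite add0n => /IH. Qed.

Lemma deltaZ_nil : deltaZ W (hval (tword [::])) = 0.
Proof. by rewrite tword_liftE /deltaZ_fun big_geq. Qed.

Lemma big_masks_last n (f : bitseq -> tens (Tbar W) (Tbar W)) :
  \sum_(m <- masks n.+1 | ~~ nth true m n) f m = \sum_(m <- masks n) f (m ++ [:: false]).
Proof.
rewrite big_mkcond big_masks_rcons big1_seq ?add0r => [|m /andP[_]]; last first.
  by rewrite mem_masks => /eqP <-; rewrite nth_cat ltnn subnn.
apply: eq_big_seq => m; rewrite mem_masks => /eqP <-.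
by rewrite nth_cat ltnn subnn.
Qed.

(** The bounds on the arity lose nothing: an empty left word is 0 in [Tbar], and the right word is
    never empty because it contains x. *)
Lemma deltaZ_rcons w x : deltaZ W (hval (tword (w ++ [:: x]))) =
  us w (fun L R => wpair L (R ++ [:: x])).
Proof.
rewrite tword_liftE /deltaZ_fun big_unshuff size_cat addn1.
set n := size w.
transitivity (\sum_(m <- masks n.+1 | ~~ nth true m n) tterm (w ++ [:: x]) m).
  rewrite big_mkcond [RHS]big_mkcond; apply: eq_big_seq => m; rewrite mem_masks => /eqP Hm /=.
  case: ifP => [/and3P[_ _ ->]//|]; case: ifP => // Hn /negbT.
  rewrite !negb_and orbF -!leqNgt leqn0 => /orP[/eqP Hc|Hc].
    by rewrite /tterm -/(wpair _ _) mask_nseq0 // wpair_nill scaler0.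
  have Ha : all id m by rewrite all_count eqn_leq count_size Hm.
  by move: Hn; have /= -> := allP Ha (nth true m n) _; rewrite // mem_nth // Hm.
rewrite big_masks_last us_masks; apply: eq_big_seq => m.
rewrite mem_masks => /eqP Hm; rewrite /tterm -/(wpair _ _) map_cat unsh_exp_cat ?size_map //=.
by rewrite map_cat !mask_cat ?size_map //= !big_nil !(mulr0, addr0) cats0.
Qed.

End ZinbielCoproduct.

Section SplitCoproduct.
Variables (K : fieldType) (W : gmod K) (delta : {linear W -> tens W W}).
Local Notation word := (seq (helt W)).
Hypothesis delta_deg : forall k x, gproj W k x = x ->
  gproj (tens W W) (k + 1) (delta x) = delta x.
Local Notation spl := (letter_split delta_deg).
Local Notation wpair := (@wpair K W).
Hypothesis delta_anti : forall x, flip W W (delta x) = - delta x.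

Lemma insA_sp L1 L2 R x : insA L1 L2 R (delta (hval x)) =
  sp spl x (fun a b => wpair (L1 ++ [:: a, b & L2]) R).
Proof. by rewrite (sp_tens_lift _ _ (insA_bilin L1 L2 R)). Qed.

Lemma insB_sp L R x : insB L R (delta (hval x)) =
  sp spl x (fun a b => eps (wdeg R * hdeg a) *: wpair (L ++ [:: a]) (R ++ [:: b])).
Proof.
transitivity (sp spl x (insB_fun L R)); first by rewrite (sp_tens_lift _ _ (insB_bilin L R)).
by apply: eq_lsum => t; rewrite !cats1.
Qed.

Definition split_exp w k m : int :=
  let ds := map (@hdeg K W) w in
  \sum_(e <- take k ds) e + unsh_exp (set_nth 0 ds k (nth 0 ds k + 1)) m.

Lemma sum_mask_set_nth (d : seq int) (m : bitseq) k : size m = size d ->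
  nth false m k ->
  \sum_(e <- mask m (set_nth 0 d k (nth 0 d k + 1))) e = \sum_(e <- mask m d) e + 1.
Proof.
elim: d m k => [|e d IH] [|b m] [|k] //= [Hs].
  by move=> ->; rewrite /= !big_cons addrAC.
by move=> Hk; case: b; rewrite /= ?big_cons IH ?addrA.
Qed.

Lemma set_nth_cat (T : Type) (x0 y : T) (s t : seq T) k : (k < size s)%N ->
  set_nth x0 (s ++ t) k y = set_nth x0 s k y ++ t.
Proof. by elim: s k => [|z s IH] [|k] //= /IH ->. Qed.

Lemma big_masks_nth0 (M : lmodType K) n (f : bitseq -> M) :
  \sum_(m <- masks n.+1 | nth false m 0) f m = \sum_(m <- masks n) f (true :: m).
Proof.
by rewrite big_mkcond big_masksS [X in _ + X]big1 ?addr0.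
Qed.

Lemma big_masks_nthS (M : lmodType K) n k (f : bitseq -> M) :
  \sum_(m <- masks n.+1 | nth false m k.+1) f m =
  \sum_(m <- masks n | nth false m k) f (true :: m) +
  \sum_(m <- masks n | nth false m k) f (false :: m).
Proof. by rewrite big_mkcond big_masksS -!big_mkcond. Qed.

(** A letter before place k that goes right contributes its degree twice to [split_exp]: once
    because delta passes it, once because the degree of letter k is raised by one. These cancel
    modulo two, leaving the sign of the plain unshuffle and the passage of delta past the left
    letters. *)
Lemma big_masks_split (M : lmodType K) w (Phi : word -> word -> M) :
  \sum_(0 <= k < size w) \sum_(m <- masks (size w) | nth false m k)
    eps (split_exp w k m) *: sp spl (nth (helt0 W) w k) (fun a b =>
      Phi (mask (take k m) (take k w) ++ [:: a, b & mask (drop k.+1 m) (drop k.+1 w)])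
        (mask (map negb m) w)) =
  us w (fun L R => ds spl L (fun L' => Phi L' R)).
Proof.
elim: w Phi => [|x w IH] Phi; first by rewrite big_geq // us_nil ds_nil.
rewrite us_cons [size (x :: w)]/= big_nat_recl // big_masks_nth0.
under [X in _ + X]eq_bigr do rewrite big_masks_nthS.
rewrite big_split addrA; congr (_ + _).
  under [in RHS]eq_us1 do rewrite ds_cons.
  rewrite usD; congr (_ + _).
    rewrite us_masks; apply: eq_bigr => m _; rewrite /split_exp /= big_nil.
    by rewrite !add0r !drop0.
  rewrite usZ -(IH (fun L R => Phi (x :: L) R)) scaler_sumr; apply: eq_bigr => k _.
  rewrite scaler_sumr; apply: eq_bigr => m _.
  by rewrite /split_exp /= big_cons scalerA -epsD add0r addrA.
(* The letter x passes the left word before it is split, when its degree is one less than that of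
   L'. *)
rewrite -[RHS](_ : us w (fun L R => ds spl L (fun L' =>
    eps (hdeg x * (wdeg L' - 1)) *: Phi L' (x :: R))) = _); last first.
  apply: eq_us1 => L R; rewrite -dsZ; apply: eq_ds => [|u ->].
    exact: letter_split_deg.
  by rewrite addrK.
rewrite -(IH (fun L R => eps (hdeg x * (wdeg L - 1)) *: Phi L (x :: R))).
apply: eq_big_nat => k /andP[_ lt_k]; rewrite big_seq_cond [RHS]big_seq_cond.
apply: eq_bigr => m; rewrite mem_masks => /andP[/eqP Hs Hk].
rewrite -!spZ; apply: eq_sp => [|a b Hab]; first exact: letter_split_deg.
rewrite /= scalerA -epsD; congr (_ *: _); rewrite /split_exp /= big_cons.
have -> : wdeg (mask (take k m) (take k w) ++
    [:: a, b & mask (drop k.+1 m) (drop k.+1 w)]) =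
    \sum_(e <- mask m (set_nth 0 (map (@hdeg K W) w) k
      (nth 0 (map (@hdeg K W) w) k + 1))) e.
  rewrite sum_mask_set_nth ?size_map // -map_mask -wdegE.
  rewrite -[in RHS](cat_take_drop k w) (drop_nth (helt0 W) lt_k) mask_split; last first.
    by rewrite -drop_nth // cat_take_drop.
  rewrite size_takel ?(ltnW lt_k) // Hk /= !wdeg_cat !wdeg_cons [hdeg a + (_ + _)]addrA Hab; ring.
by apply: eps_par; par.
Qed.

Lemma partA_rcons w x : partA_fun delta (w ++ [:: x]) =
  us w (fun L R => ds spl L (fun L' => wpair L' (R ++ [:: x]))).
Proof.
rewrite -(big_masks_split w (fun L R => wpair L (R ++ [:: x]))) /partA_fun.
rewrite size_cat addn1 [_.+1.-1]/=; apply: eq_big_nat => k /andP[_ lt_k].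
rewrite big_unshuff.
transitivity (\sum_(m <- masks (size w).+1 | ~~ nth true m (size w))
    if nth false m k then Aterm delta (w ++ [:: x]) k m else 0).
  rewrite big_mkcond [RHS]big_mkcond; apply: eq_big_seq => m.
  rewrite mem_masks => /eqP Hm /=.
  case: (boolP (~~ nth true m (size w))) => Hn; rewrite ?andbF //.
  case: (boolP (nth false m k)) => Hk; rewrite ?andbF // !andbT.
  case: ifP => // /negbT; rewrite negb_and -!leqNgt leqn0 => /orP[|] Hc.
    have lt_km : (k < size m)%N by rewrite Hm ltnW.
    have : has id m by apply/hasP; exists true => //; rewrite -[true]Hk mem_nth.
    by rewrite has_count (eqP Hc).
  have Ha : all id m by rewrite all_count eqn_leq count_size Hm.
  by move: Hn; have /= -> := allP Ha (nth true m (size w)) _; rewrite // mem_nth // Hm.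
rewrite big_masks_last [RHS]big_mkcond; apply: eq_big_seq => m.
rewrite mem_masks => /eqP Hm; rewrite nth_cat Hm lt_k; case: ifP => // Hk.
rewrite /Aterm insA_sp map_cat !take_cat ?size_map lt_k !nth_cat ?size_map lt_k Hm lt_k.
rewrite !drop_cat ?size_map Hm.
have -> : mask (if (k.+1 < size w)%N then drop k.+1 m ++ [:: false]
      else drop (k.+1 - size w) [:: false])
    (if (k.+1 < size w)%N then drop k.+1 w ++ [:: x]
      else drop (k.+1 - size w) [:: x]) = mask (drop k.+1 m) (drop k.+1 w).
  case: ltnP => Hk1; first by rewrite mask_cat ?size_drop ?Hm // cats0.
  by rewrite (drop_oversize Hk1) (eqP lt_k) /= mask0.
rewrite map_cat mask_cat ?size_map //= set_nth_cat ?size_map //.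
rewrite unsh_exp_cat; last by rewrite size_set_nth size_map (maxn_idPr lt_k).
by rewrite /= !big_nil !mulr0 !addr0.
Qed.

Lemma partB_rcons w x : partB_fun delta (w ++ [:: x]) =
  eps (wdeg w) *: us w (fun L R => sp spl x (fun a b =>
    eps (wdeg R * hdeg a) *: wpair (L ++ [:: a]) (R ++ [:: b]))).
Proof.
rewrite /partB_fun big_unshuff size_cat addn1 [_.+1.-1]/= us_masks scaler_sumr.
rewrite big_mkcond; apply: eq_big_seq => m; rewrite mem_masks => /eqP Hm.
rewrite /= andbT ltnS -{1}Hm count_size /Bterm size_cat addn1 [_.+1.-1]/=.
rewrite take_size_cat // insB_sp nth_cat ltnn subnn /=.
by rewrite scalerA -epsD (wdegE w).
Qed.

Lemma cobar_mlin : mlin (fun w => ds spl w (fun u => hval (tword u))).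
Proof.
apply: mlinear_mlin; first exact: ds_nil.
apply: ds_mlinear (@tword_mlinear _ _); first exact: letter_split_deg.
exact: letter_split_hlinear.
Qed.

Lemma cobar_ghom k (x : Tbar W) : gproj (Tbar W) k x = x ->
  gproj (Tbar W) (k + 1) (tword_lift cobar_mlin x) = tword_lift cobar_mlin x.
Proof.
move: k x; apply: ghom_gen => w; rewrite -[pgen _ _]/(hval (tword w)) tword_liftE.
rewrite lsum_lin; apply: eq_lsum_in => c /(cobar_deg (@letter_split_deg _ _ _ delta_deg)) <-.
exact: (heltP (tword c.2)).
Qed.

Definition cobar_map : ghom 1 (Tbar W) (Tbar W) := Ghom cobar_ghom.

Lemma cobar_mapE w : cobar_map (hval (tword w)) = ds spl w (fun u => hval (tword u)).
Proof. exact: tword_liftE. Qed.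

Lemma happ_cobar_map (M : lmodType K) (Psi : helt (Tbar W) -> M) w :
  hlinear Psi -> Psi (happ cobar_map (tword w)) = ds spl w (fun u => Psi (tword u)).
Proof.
move=> H; apply: (hlinear_lsum_val H); last exact: cobar_mapE.
by move=> c /(cobar_deg (@letter_split_deg _ _ _ delta_deg)).
Qed.

(** This is the coproduct by all unshuffles: [deltaZ] has those with the last letter on the right,
    its flip the others. *)
Definition deltaU (x : Tbar W) : tens (Tbar W) (Tbar W) :=
  deltaZ W x + flip _ _ (deltaZ W x).

Lemma flip_wpair L R : flip _ _ (wpair L R) = eps (wdeg L * wdeg R) *: wpair R L.
Proof. exact: flipE. Qed.

Lemma deltaU_tword w : deltaU (hval (tword w)) = us w wpair.
Proof.
elim/last_ind: w => [|w x _].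
  by rewrite /deltaU deltaZ_nil raddf0 addr0 us_nil wpair_nill.
rewrite /deltaU -cats1 deltaZ_rcons us_rcons addrC; congr (_ + _).
rewrite us_lin us_comm; apply: eq_us1 => L R; rewrite flip_wpair scalerA -epsD wdeg_cat.
rewrite wdeg_cons wdeg_nil; congr (_ *: _); apply: eps_par; par.
Qed.

Lemma tmap_wpair p q (D : ghom p (Tbar W) (Tbar W)) (D' : ghom q (Tbar W) (Tbar W)) L R :
  tmap D D' (wpair L R) = eps (q * wdeg L) *: tpair (happ D (tword L)) (happ D' (tword R)).
Proof. exact: tmapE. Qed.

Lemma deltaU_linear : linear deltaU.
Proof.
move=> a x y; rewrite /deltaU linearP linearP scalerDr; zmodule.
Qed.

Lemma tbar_ext (M : lmodType K) (f g : Tbar W -> M) : linear f -> linear g ->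
  (forall w, f (hval (tword w)) = g (hval (tword w))) -> f =1 g.
Proof.
move=> Hf Hg H; elim/tword_ind => [|a w t IH]; last by rewrite Hf Hg H IH.
have E (h : Tbar W -> M) : linear h -> h 0 = 0.
  by move=> Hh; have := Hh 1 0 0; rewrite !scale1r addr0 => /eq_double.
by rewrite !E.
Qed.

Lemma partA_flip w x : flip _ _ (partA_fun delta (w ++ [:: x])) =
  us w (fun L R => eps (wdeg R * hdeg x + wdeg L + hdeg x) *:
    ds spl R (fun R' => wpair (L ++ [:: x]) R')).
Proof.
rewrite partA_rcons us_lin us_comm; apply: eq_us1 => L R.
rewrite lsum_lin -!dsZ; apply: eq_ds => [|u Hu]; first exact: letter_split_deg.
rewrite flip_wpair scalerA -epsD Hu wdeg_cat wdeg_cons wdeg_nil.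
by congr (_ *: _); apply: eps_par; par.
Qed.

(** On a word w x the first term has four kinds of summands: cobar on the left word (part A), cobar
    on the letters of w in the right word, the halves of x on different sides (part B), and both
    halves on the right. The second term removes the second and fourth kinds and, from the
    unshuffles with x on the left, contributes minus the flip of part A. *)
Lemma deltaC_cobar x : deltaC delta x =
  deltaZ W (cobar_map x) - tmap (gid _) cobar_map (deltaU x).
Proof.
move: x; apply: tbar_ext => [a x y|a x y|w]; first exact: linearP.
  move: a x y; apply: linear_subp.
    exact: linear_compp (linearP (deltaZ W)) (linearP cobar_map).
  exact: linear_compp (linearP (tmap (gid _) cobar_map)) deltaU_linear.
rewrite deltaU_tword cobar_mapE tword_liftE.
elim/last_ind: w => [|w x _].
  rewrite ds_nil us_nil wpair_nill !raddf0 /deltaC_fun /partA_fun /partB_fun !big_geq //.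
  by rewrite !raddf0 !addr0.
have tmapE' L R : tmap (gid (Tbar W)) cobar_map (wpair L R) =
    eps (wdeg L) *: ds spl R (wpair L).
  rewrite tmap_wpair mul1r; congr (_ *: _).
  have -> : happ (gid (Tbar W)) (tword L) = tword L by apply: helt_eq => //; exact: addr0.
  exact: (happ_cobar_map R (tpair_hlinearR (tword L))).
rewrite -cats1 /deltaC_fun partA_flip partA_rcons partB_rcons.
have -> : deltaZ W (ds spl (w ++ [:: x]) (fun u => hval (tword u))) =
    ds spl w (fun u => us u (fun L R => wpair L (R ++ [:: x]))) +
    eps (wdeg w) *: sp spl x (fun a b => us (w ++ [:: a]) (fun L R => wpair L (R ++ [:: b]))).
  rewrite ds_rcons addrC linearP addrC; congr (_ + _ *: _).
    by apply: etrans (lsum_lin _ _ _) _; apply: eq_lsum => u; rewrite deltaZ_rcons.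
  apply: etrans (lsum_lin _ _ _) _; apply: eq_lsum => t.
  by rewrite -deltaZ_rcons -catA.
rewrite (ds_unsh (@letter_split_deg _ _ _ delta_deg)); last 2 first.
- by move=> M y Psi; apply: letter_split_anti.
- split=> [R|L]; first exact: mlinear_tpairL.
  exact: (mlinear_suffix _ (mlinear_tpairR (tword L))).
have -> : sp spl x (fun a b => us (w ++ [:: a]) (fun L R => wpair L (R ++ [:: b]))) =
    us w (fun L R => sp spl x (fun a b =>
      eps (wdeg R * hdeg a) *: wpair (L ++ [:: a]) (R ++ [:: b]))) +
    us w (fun L R => sp spl x (fun a b => wpair L (R ++ [:: a; b]))).
  rewrite -!sp_us -spD; apply: eq_sp => [|a b _]; first exact: letter_split_deg.
  by rewrite us_rcons; congr (_ + _); apply: eq_us1 => L R; rewrite -catA.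
rewrite us_lin us_rcons scalerDr -!usZ.
rewrite -!usD -!usN -!usD; apply: eq_us => L R Ew _.
rewrite !tmapE' ds_rcons wdeg_cat wdeg_cons wdeg_nil -Ew.
rewrite addr0; signs.
Qed.

End SplitCoproduct.

(** * Coderivations from block maps *)

Section TensorExt.
Variables (K : fieldType) (V W : gmod K).

Lemma tens_ext (M : lmodType K) (f g : tens V W -> M) : linear f -> linear g ->
  (forall x y, f (tpair x y) = g (tpair x y)) -> f =1 g.
Proof.
move=> Hf Hg H; elim/tens_ind => [|a x y t IH]; last by rewrite Hf Hg H IH.
have E (h : tens V W -> M) : linear h -> h 0 = 0.
  by move=> Hh; have := Hh 1 0 0; rewrite !scale1r addr0 => /eq_double.
by rewrite !E.
Qed.

Lemma happ_gid (x : helt V) : happ (gid V) x = x.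
Proof. by apply: helt_eq => //; apply: addr0. Qed.

End TensorExt.

Section Tderiv.
Variables (K : fieldType) (V : gmod K) (p : int) (D : ghom p V V).

Lemma tderiv_tpair x y : tderiv D (tpair x y) =
  tpair (happ D x) y + eps (p * hdeg x) *: tpair x (happ D y).
Proof. by rewrite /tderiv !tmapE !happ_gid mul0r eps0 scale1r. Qed.

Lemma tderiv_linear : linear (tderiv D).
Proof. exact: linear_addp (linearP (tmap D (gid V))) (linearP (tmap (gid V) D)). Qed.

HB.instance Definition _ :=
  GRing.isLinear.Build K (tens V V) (tens V V) _ (tderiv D) tderiv_linear.

Lemma tderivZ a t : tderiv D (a *: t) = a *: tderiv D t.
Proof. exact: linearZ. Qed.

Lemma tderiv_flip t : flip _ _ (tderiv D t) = tderiv D (flip _ _ t).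
Proof.
move: t; apply: tens_ext => [||x y].
- exact: linear_compp (linearP (flip V V)) tderiv_linear.
- exact: linear_compp tderiv_linear (linearP (flip V V)).
rewrite flipE tderiv_tpair addrC linearP !flipE.
rewrite tderivZ tderiv_tpair /hdeg /= -!/(hdeg _); signs.
Qed.

End Tderiv.

Section Coderivation.
Variables (K : fieldType) (W : gmod K) (delta : {linear W -> tens W W}).
Local Notation word := (seq (helt W)).
Hypothesis delta_deg : forall k x, gproj W k x = x ->
  gproj (tens W W) (k + 1) (delta x) = delta x.
Local Notation spl := (letter_split delta_deg).
Local Notation wpair := (@wpair K W).
Hypothesis delta_anti : forall x, flip W W (delta x) = - delta x.
Variable F : word -> helt W.
Hypothesis F_deg : forall w, hdeg (F w) = wdeg w - 1.
Hypothesis F_lin : forall a p x y z q, hlin a x y z ->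
  hlin a (F (p ++ x :: q)) (F (p ++ y :: q)) (F (p ++ z :: q)).
Variable G : word -> helt W.
Hypothesis G_deg : forall w, hdeg (G w) = wdeg w.
Hypothesis G_lin : forall a p x y z q, hlin a x y z ->
  hlin a (G (p ++ x :: q)) (G (p ++ y :: q)) (G (p ++ z :: q)).
Hypothesis G_nil : hval (G [::]) = 0.
Hypothesis FG_ds : forall (M : lmodType K) (Psi : helt W -> M) v x,
  hlinear Psi ->
  ds spl (v ++ [:: x]) (fun u => Psi (F u)) = Psi (G (v ++ [:: x])).
Hypothesis FG_sp : forall (M : lmodType K) (Psi : helt W -> helt W -> M) v x,
  bilin Psi ->
  sp spl (F (v ++ [:: x])) Psi + eps (wdeg v) *: sp spl x (fun a b =>
    Psi (F (v ++ [:: a])) b +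
    eps ((wdeg v + 1) * hdeg a) *: Psi a (F (v ++ [:: b]))) =
  eps (wdeg v * hdeg x) *: Psi x (G v) - Psi (G v) x.

Lemma Ds_mlin : mlin (fun w => Ds F w (fun u => hval (tword u))).
Proof.
apply: mlinear_mlin; first exact: Ds_nil.
exact: (Ds_mlinear F_lin (@tword_mlinear _ _)).
Qed.

Lemma Ds_ghom k (x : Tbar W) : gproj (Tbar W) k x = x ->
  gproj (Tbar W) (k - 1) (tword_lift Ds_mlin x) = tword_lift Ds_mlin x.
Proof.
move: k x; apply: ghom_gen => w; rewrite -[pgen _ _]/(hval (tword w)) tword_liftE.
rewrite lsum_lin; apply: eq_lsum_in => c /(zcoder_deg F_deg) <-.
exact: (heltP (tword c.2)).
Qed.

Definition zmap : ghom (- 1) (Tbar W) (Tbar W) := Ghom Ds_ghom.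

Lemma zmapE w : zmap (hval (tword w)) = Ds F w (fun u => hval (tword u)).
Proof. exact: tword_liftE. Qed.

Lemma happ_zmap (M : lmodType K) (Psi : helt (Tbar W) -> M) w :
  hlinear Psi -> Psi (happ zmap (tword w)) = Ds F w (fun u => Psi (tword u)).
Proof.
move=> H; apply: (hlinear_lsum_val H); last exact: zmapE.
by move=> c /(zcoder_deg F_deg).
Qed.

Lemma tderiv_wpair L R : tderiv zmap (wpair L R) =
  Ds F L (fun L' => wpair L' R) + eps (wdeg L) *: Ds F R (fun R' => wpair L R').
Proof.
rewrite tderiv_tpair (happ_zmap L (tpair_hlinearL (tword R))).
rewrite (happ_zmap R (tpair_hlinearR (tword L))).
by congr (_ + _ *: _); apply: eps_par; rewrite oddzE.
Qed.

Lemma zmap_deltaZ x : tderiv zmap (deltaZ W x) = deltaZ W (zmap x).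
Proof.
move: x; apply: tbar_ext => [||w].
- exact: linear_compp (tderiv_linear zmap) (linearP (deltaZ W)).
- exact: linear_compp (linearP (deltaZ W)) (linearP zmap).
elim/last_ind: w => [|w x _]; rewrite -?cats1.
  by rewrite zmapE Ds_nil deltaZ_nil /tderiv !raddf0 addr0.
rewrite deltaZ_rcons zmapE.
have -> : deltaZ W (Ds F (w ++ [:: x]) (fun u => hval (tword u))) =
    Ds F w (fun u => us u (fun L R => wpair L (R ++ [:: x]))) +
    us w (fun u v => us u (fun L R =>
      eps (wdeg L + wdeg R) *: wpair L (R ++ [:: F (v ++ [:: x])]))).
  apply: etrans (lsum_lin _ _ _) _; rewrite -/(Ds F _ _) Ds_rcons; congr (_ + _).
    by apply: eq_lsum => u; rewrite deltaZ_rcons.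
  apply: eq_us1 => u v; rewrite deltaZ_rcons -usZ.
  by apply: eq_us => L R -> _.
rewrite us_coassoc us_Ds // -usD.
apply: etrans (us_lin _ _ _) _; apply: eq_us1 => L R.
rewrite -[LHS]/(tderiv zmap (wpair L (R ++ [:: x]))) tderiv_wpair Ds_rcons scalerDr addrA.
congr (_ + _).
by rewrite -usZ; apply: eq_us1 => u v; rewrite scalerA -epsD.
Qed.

Lemma us_wordG_mlin : mlin (fun w => us w (fun u v => hval (tword (u ++ [:: G v])))).
Proof.
apply: mlinear_mlin.
  rewrite us_nil; apply: (mlinear0 [::] [::]) G_nil.
  exact: tword_mlinear.
apply: us_mlinear; split=> [R|L].
  exact: (mlinear_suffix _ (@tword_mlinear _ _)).
move=> p q a x y z Hl; apply: (tword_mlinear L [::]); exact: G_lin Hl.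
Qed.

Lemma us_wordG_ghom k (x : Tbar W) : gproj (Tbar W) k x = x ->
  gproj (Tbar W) (k + 0) (tword_lift us_wordG_mlin x) = tword_lift us_wordG_mlin x.
Proof.
move: k x; apply: ghom_gen => w; rewrite -[pgen _ _]/(hval (tword w)) tword_liftE.
rewrite lsum_lin; apply: eq_lsum_in => c /unsh_deg Hc.
have <- : wdeg (c.2.1 ++ [:: G c.2.2]) = wdeg w + 0.
  by rewrite wdeg_cat wdeg_cons wdeg_nil G_deg !addr0.
exact: (heltP (tword _)).
Qed.

Definition xmap : ghom 0 (Tbar W) (Tbar W) := Ghom us_wordG_ghom.

Lemma xmapE w : xmap (hval (tword w)) =
  us w (fun u v => hval (tword (u ++ [:: G v]))).
Proof. exact: tword_liftE. Qed.

Lemma happ_xmap (M : lmodType K) (Psi : helt (Tbar W) -> M) w :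
  hlinear Psi -> Psi (happ xmap (tword w)) =
    us w (fun u v => Psi (tword (u ++ [:: G v]))).
Proof.
move=> H; apply: (hlinear_lsum_val (h := fun c => tword (c.1 ++ [:: G c.2])) H).
  move=> c /unsh_deg Hc; rewrite /hdeg /= wdeg_cat wdeg_cons wdeg_nil G_deg.
  by rewrite !addr0.
exact: xmapE.
Qed.

Lemma xmap_deltaZ x : deltaZ W (xmap x) = tmap (gid _) xmap (deltaU x).
Proof.
move: x; apply: tbar_ext => [||w].
- exact: linear_compp (linearP (deltaZ W)) (linearP xmap).
- exact: linear_compp (linearP (tmap (gid _) xmap)) (@deltaU_linear _ _).
rewrite deltaU_tword xmapE us_lin us_lin.
have -> : us w (fun L R => deltaZ W (hval (tword (L ++ [:: G R])))) =
    us w (fun u v => us u (fun L R => wpair L (R ++ [:: G v]))).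
  by apply: eq_us1 => u v; rewrite deltaZ_rcons.
rewrite us_coassoc; apply: eq_us1 => L R; rewrite tmap_wpair mul0r eps0 scale1r.
by rewrite happ_gid (happ_xmap R (tpair_hlinearR (tword L))).
Qed.

Local Notation cobar_map := (cobar_map delta_deg).

Lemma zmap_cobar x : zmap (cobar_map x) + cobar_map (zmap x) = xmap x.
Proof.
move: x; apply: tbar_ext => [||w].
- apply: linear_addp.
    exact: linear_compp (linearP zmap) (linearP cobar_map).
  exact: linear_compp (linearP cobar_map) (linearP zmap).
- exact: (linearP xmap).
rewrite cobar_mapE zmapE xmapE.
rewrite -(Ds_ds (@letter_split_deg _ _ _ delta_deg) _ F_deg F_lin G_nil FG_ds FG_sp);
  last 2 first.
- by move=> M y Psi; apply: letter_split_anti.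
- exact: tword_mlinear.
rewrite addrC; congr (_ + _); apply: etrans (lsum_lin _ _ _) _; apply: eq_lsum => u.
  by rewrite cobar_mapE.
by rewrite zmapE.
Qed.

(** D (x) 1 and 1 (x) cobar anticommute, both being odd, so only the bracket on the second factor
    survives. *)
Lemma tderiv_cobar t : tderiv zmap (tmap (gid _) cobar_map t) +
  tmap (gid _) cobar_map (tderiv zmap t) = tmap (gid _) xmap t.
Proof.
move: t; apply: tens_ext => [||x y].
- apply: linear_addp.
    exact: linear_compp (linearP (tderiv zmap)) (linearP (tmap (gid _) cobar_map)).
  exact: linear_compp (linearP (tmap (gid _) cobar_map)) (linearP (tderiv zmap)).
- exact: (linearP (tmap (gid _) xmap)).
have TL a (u v : tens (Tbar W) (Tbar W)) : tmap (gid (Tbar W)) cobar_map (u + a *: v) =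
    tmap (gid (Tbar W)) cobar_map u + a *: tmap (gid (Tbar W)) cobar_map v.
  by rewrite addrC linearP addrC.
rewrite tderiv_tpair TL !tmapE tderivZ tderiv_tpair !happ_gid.
have -> : hdeg (happ zmap x) = hdeg x - 1 by [].
have -> : tpair x (happ xmap y) =
    tpair x (happ zmap (happ cobar_map y)) + tpair x (happ cobar_map (happ zmap y)).
  rewrite -[X in X + _]scale1r; apply: tpairR; split.
  - by rewrite /hdeg /= addrK addr0.
  - by rewrite /hdeg /= subrK addr0.
  - by rewrite scale1r; symmetry; apply: zmap_cobar.
signs.
Qed.

Lemma zmap_deltaU x : tderiv zmap (deltaU x) = deltaU (zmap x).
Proof.
rewrite /deltaU -zmap_deltaZ tderiv_flip.
exact: (linearD (tderiv zmap)).
Qed.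

(** Moving D past cobar in the two terms of [deltaC_cobar] leaves deltaZ X and (1 (x) X) [deltaU],
    which cancel by [xmap_deltaZ]. *)
Lemma zmap_deltaC x : eps (- 1) *: tderiv zmap (deltaC delta x) = deltaC delta (zmap x).
Proof.
rewrite !deltaC_cobar // -zmap_deltaU.
have -> : tderiv zmap (deltaZ W (cobar_map x) - tmap (gid _) cobar_map (deltaU x)) =
    tderiv zmap (deltaZ W (cobar_map x)) -
    tderiv zmap (tmap (gid _) cobar_map (deltaU x)) by exact: linearB.
have -> : cobar_map (zmap x) = xmap x - zmap (cobar_map x).
  by rewrite -zmap_cobar addrC addKr.
have -> : deltaZ W (xmap x - zmap (cobar_map x)) =
    deltaZ W (xmap x) - deltaZ W (zmap (cobar_map x)) by exact: linearB.
rewrite xmap_deltaZ -tderiv_cobar zmap_deltaZ.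
signs.
Qed.

End Coderivation.

(** * Graded symmetric functions and derivations *)

Section GradedSymmetric.
Variables (K : fieldType) (V : gmod K) (M : lmodType K).
Local Notation word := (seq (helt V)).

Lemma gsym_prefix (Phi : word -> M) p : gsym Phi -> gsym (fun w => Phi (p ++ w)).
Proof. by move=> H q x y r; rewrite !catA H. Qed.

Lemma gsym_suffix (Phi : word -> M) r : gsym Phi -> gsym (fun w => Phi (w ++ r)).
Proof. by move=> H p x y t; rewrite -!catA /= H. Qed.

Lemma wdeg_swap p (x y : helt V) q : wdeg (p ++ y :: x :: q) = wdeg (p ++ x :: y :: q).
Proof. by rewrite !wdeg_cat !wdeg_cons [hdeg y + _]addrCA. Qed.

Lemma gsym_eps (f : int -> int) (Phi : word -> M) :
  gsym Phi -> gsym (fun w => eps (f (wdeg w)) *: Phi w).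
Proof. by move=> H p x y q; rewrite wdeg_swap H !scalerA mulrC. Qed.

Lemma gsymZ e (Phi : word -> M) : gsym Phi -> gsym (fun w => e *: Phi w).
Proof. by move=> H p x y q; rewrite H !scalerA mulrC. Qed.

Definition gsym2 (Phi : word -> word -> M) : Prop :=
  (forall R, gsym (Phi^~ R)) /\ (forall L, gsym (Phi L)).

Lemma us_gsym (Phi : word -> word -> M) : gsym2 Phi -> gsym (fun w => us w Phi).
Proof.
move=> H p; elim: p Phi H => [|t p IH] Phi [HL HR] x y q /=.
  rewrite !us_cons -!usD -usZ; apply: eq_us1 => L R; rewrite !wdeg_cons.
  have /= -> := HL R [::] x y L; have /= -> := HR L [::] x y R.
  by signs.
rewrite !us_cons scalerDr; congr (_ + _).
  by apply: (IH (fun L R => Phi (t :: L) R)); split=> [R|L];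
    [exact: (gsym_prefix [:: t] (HL R))|exact: HR].
apply: (IH (fun L R => eps (hdeg t * wdeg L) *: Phi L (t :: R))); split=> [R|L].
  exact: (gsym_eps (fun k => hdeg t * k) (HL (t :: R))).
exact: (gsymZ _ (gsym_prefix [:: t] (HR L))).
Qed.

End GradedSymmetric.

Section UsNil.
Variables (K : fieldType) (V : gmod K) (M : lmodType K).
Local Notation word := (seq (helt V)).

Lemma us_nill w (f : word -> M) :
  us w (fun L R => if L is [::] then f R else 0) = f w.
Proof.
elim: w f => [|x w IH] f; first by rewrite us_nil.
rewrite us_cons us0 add0r -[RHS](IH (fun R => f (x :: R))); apply: eq_us1 => L R.
by case: L => [|y L]; rewrite ?scaler0 // wdeg_nil mulr0 eps0 scale1r.
Qed.

Lemma us_nilr w (f : word -> M) :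
  us w (fun L R => if R is [::] then f L else 0) = f w.
Proof.
elim: w f => [|x w IH] f; first by rewrite us_nil.
rewrite us_cons (IH (fun L => f (x :: L))) (eq_us1 _ (Psi := fun _ _ => 0)).
  by rewrite us0 addr0.
by move=> L R; rewrite scaler0.
Qed.

End UsNil.

Section Derivation.
Variables (K : fieldType) (V : gmod K) (d : ghom 1 V V).
Local Notation word := (seq (helt V)).

Fixpoint deriv_words (w : word) : seq (K * word) :=
  if w is x :: w' then
    (1, happ d x :: w') :: [seq (eps (hdeg x) * c.1, x :: c.2) | c <- deriv_words w']
  else [::].

Definition dv (M : lmodType K) w (Phi : word -> M) : M := lsum (deriv_words w) Phi.

Section Dv.
Variable M : lmodType K.
Implicit Types (Phi : word -> M).

Lemma dv_nil Phi : dv [::] Phi = 0.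
Proof. exact: lsum_nil. Qed.

Lemma dv_cons x w Phi :
  dv (x :: w) Phi = Phi (happ d x :: w) + eps (hdeg x) *: dv w (fun u => Phi (x :: u)).
Proof.
rewrite /dv /= lsum_cons scale1r /lsum big_map scaler_sumr; congr (_ + _).
by apply: eq_bigr => c _; rewrite scalerA.
Qed.

Lemma deriv_words_deg w c : c \in deriv_words w -> wdeg c.2 = wdeg w + 1.
Proof.
elim: w c => [|x w IH] c //=; rewrite inE => /predU1P[->|/mapP[e /IH E ->]] /=.
  by rewrite !wdeg_cons /hdeg /= addrAC.
by rewrite !wdeg_cons E addrA.
Qed.

Lemma deriv_words_size w c : c \in deriv_words w -> size c.2 = size w.
Proof.
by elim: w c => [|x w IH] c //=; rewrite inE => /predU1P[->|/mapP[e /IH E ->]] //=;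
  rewrite E.
Qed.

Lemma eq_dv w Phi Phi' :
  (forall u, wdeg u = wdeg w + 1 -> size u = size w -> Phi u = Phi' u) ->
  dv w Phi = dv w Phi'.
Proof.
move=> E; apply: eq_lsum_in => c Hc.
by apply: E; [exact: deriv_words_deg|exact: deriv_words_size].
Qed.

Lemma dvD w Phi Phi' : dv w (fun u => Phi u + Phi' u) = dv w Phi + dv w Phi'.
Proof. exact: lsumD. Qed.

Lemma dvZ w e Phi : dv w (fun u => e *: Phi u) = e *: dv w Phi.
Proof. exact: lsumZ. Qed.

Lemma dv_cat u v Phi : dv (u ++ v) Phi =
  dv u (fun u' => Phi (u' ++ v)) + eps (wdeg u) *: dv v (fun v' => Phi (u ++ v')).
Proof.
elim: u Phi => [|x u IH] Phi.
  by rewrite dv_nil wdeg_nil eps0 scale1r add0r.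
rewrite cat_cons !dv_cons IH wdeg_cons scalerDr addrA; congr (_ + _).
by rewrite scalerA epsD.
Qed.

Lemma hlinear_happ (Psi : helt V -> M) :
  hlinear Psi -> hlinear (fun x => Psi (happ d x)).
Proof. by move=> H a x y z /(hlin_happ d)/H. Qed.

Lemma dv_mlinear Phi : mlinear Phi -> mlinear (fun w => dv w Phi).
Proof.
move=> H p q a x y z Hl; rewrite !dv_cat !dv_cons.
have [Ex Ey _] := Hl; rewrite Ex Ey.
rewrite (hlinear_happ (H p q) Hl).
have -> : dv p (fun u => Phi (u ++ z :: q)) = a *: dv p (fun u => Phi (u ++ x :: q)) +
    dv p (fun u => Phi (u ++ y :: q)).
  by rewrite -dvZ -dvD; apply: eq_dv => u _ _; exact: (H u q _ _ _ _ Hl).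
have -> : dv q (fun u => Phi (p ++ z :: u)) = a *: dv q (fun u => Phi (p ++ x :: u)) +
    dv q (fun u => Phi (p ++ y :: u)).
  by rewrite -dvZ -dvD; apply: eq_dv => u _ _; exact: (H p u _ _ _ _ Hl).
by rewrite !scalerDr !scalerA ![a * _]mulrC ?[_ * a * _]mulrAC; zmodule.
Qed.

Lemma dv_gsym Phi : gsym Phi -> gsym (fun w => dv w Phi).
Proof.
move=> H p; elim: p Phi H => [|t p IH] Phi H x y q.
  rewrite !dv_cons; have /= -> := H [::] (happ d x) y q.
  have /= -> := H [::] x (happ d y) q.
  have -> : dv q (fun u => Phi [:: x, y & u]) =
      eps (hdeg x * hdeg y) *: dv q (fun u => Phi [:: y, x & u]).
    by rewrite -dvZ; apply: eq_dv => u _ _; exact: (H [::]).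
  by rewrite -[hdeg (happ d x)]/(hdeg x + 1) -[hdeg (happ d y)]/(hdeg y + 1); signs.
rewrite !cat_cons !dv_cons (IH _ (gsym_prefix [:: t] H)).
rewrite -!cat_cons (H (_ :: p)) /= scalerDr !scalerA; congr (_ + _ *: _).
by rewrite mulrC.
Qed.

(** By symmetry the differentiated letter returns from the front to its place. As its degree has
    gone up by one, the two passages leave exactly the sign of the derivation. *)
Lemma us_extract w Phi : gsym Phi ->
  us w (fun L R => if L is [:: x] then Phi (happ d x :: R) else 0) = dv w Phi.
Proof.
elim: w Phi => [|x w IH] Phi H; first by rewrite us_nil dv_nil.
rewrite us_cons dv_cons -(us_nill w (fun R => Phi (happ d x :: R))); congr (_ + _).
rewrite -(IH _ (gsym_prefix [:: x] H)) -usZ; apply: eq_us1 => -[|z [|z' L]] R;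
  rewrite ?scaler0 //.
have /= -> := H [::] (happ d z) x R.
rewrite wdeg_cons wdeg_nil addr0 scalerA -epsD; congr (_ *: _); apply: eps_par.
by rewrite -[hdeg (happ d z)]/(hdeg z + 1); par.
Qed.

Hypothesis d2 : forall x, d (d x) = 0.

Lemma dv_dv w Phi : mlinear Phi -> dv w (fun u => dv u Phi) = 0.
Proof.
elim: w Phi => [|x w IH] Phi H; first by rewrite dv_nil.
rewrite dv_cons dv_cons.
have -> : Phi (happ d (happ d x) :: w) = 0.
  by apply: (mlinear0 [::] w H); apply: d2.
have -> : dv w (fun u => dv (x :: u) Phi) = dv w (fun u => Phi (happ d x :: u)).
  rewrite -[RHS]addr0 -(scaler0 _ (eps (hdeg x))) -(IH _ (mlinear_prefix [:: x] H)).
  by rewrite -dvZ -dvD; apply: eq_dv => u _ _; rewrite dv_cons.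
by rewrite -[hdeg (happ d x)]/(hdeg x + 1); signs.
Qed.

End Dv.

Lemma dv_lin (M N : lmodType K) (f : {linear M -> N}) w Phi :
  f (dv w Phi) = dv w (fun u => f (Phi u)).
Proof. exact: lsum_lin. Qed.

End Derivation.

(** * The operations on the suspended space *)

Section ShiftExponent.

Definition shift_exp (ds : seq int) : int := tens_exp (nseq (size ds) (- 1)) ds.

Lemma shift_exp_cons x ds : shift_exp (x :: ds) = shift_exp ds - x * (size ds)%:Z.
Proof.
rewrite /shift_exp /= addrC; congr (_ + _); rewrite -mulrN; congr (_ * _).
by elim: (size ds) => [|n IH]; rewrite ?big_nil // big_cons IH intS opprD.
Qed.

Lemma shift_exp_cat ds es : shift_exp (ds ++ es) =
  shift_exp ds + shift_exp es - (\sum_(x <- ds) x) * (size es)%:Z.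
Proof.
elim: ds => [|x ds IH]; first by rewrite big_nil mul0r subr0 add0r.
by rewrite cat_cons !shift_exp_cons IH big_cons size_cat PoszD; ring.
Qed.

End ShiftExponent.

Section ShLieOperations.
Variables (K : fieldType) (g : gmod K) (l : seq g -> g).
Hypothesis Hl : is_shLie l.
Local Notation V := (gshift g).
Local Notation word := (seq (helt V)).

Definition desus (x : helt V) : helt g := happ (desusp g) x.

Lemma sus_desus x : happ (susp g) (desus x) = x.
Proof. by apply: helt_eq => //; apply: subrK. Qed.

Lemma map_sus_desus z : map (happ (susp g)) (map desus z) = z.
Proof. by rewrite -map_comp map_id_in // => x _; apply: sus_desus. Qed.

Lemma map_hval_desus z : map (@hval K g) (map desus z) = map (@hval K V) z.
Proof. by rewrite -map_comp; apply: eq_map. Qed.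

Lemma wdeg_desus z : wdeg (map desus z) = wdeg z - (size z)%:Z.
Proof.
elim: z => [|x z IH]; first by rewrite !wdeg_nil.
by rewrite /= !wdeg_cons IH intS -[hdeg (desus x)]/(hdeg x - 1); ring.
Qed.

(** The empty word is sent to 0 because l is arbitrary there, while [qval_deg] requires a
    homogeneous value on every word. *)
Definition qval (z : word) : V :=
  if z is [::] then 0
  else eps (shift_exp (map (@hdeg K V) z)) *: (l (map (@hval K V) z) : V).

Lemma qval_deg z : gproj V (wdeg z - 1) (qval z) = qval z.
Proof.
case: z => [|x z]; first exact: raddf0.
have H0 : map desus (x :: z) <> [::] by [].
have H := shLie_degree Hl H0.
rewrite /qval; set v := x :: z in H *.
rewrite linearZ; congr (_ *: _).
move: H; rewrite map_hval_desus wdeg_desus size_map => H.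
rewrite -[RHS]H /=; congr (gproj g _ _); ring.
Qed.

Definition q z : helt V := Helt (qval_deg z).

Lemma qval_mlinear : mlinear qval.
Proof.
move=> p r a x y z [Ex Ey Ez].
have E t : qval (p ++ t :: r) = eps (shift_exp (map (@hdeg K V) (p ++ t :: r))) *:
    (l (map (@hval K V) (p ++ t :: r)) : V) by case: p.
rewrite !E !map_cat !map_cons Ex Ey Ez (shLie_multilinear Hl).
by rewrite scalerDr !scalerA mulrC.
Qed.

Lemma q_hlin a p x y z r : hlin a x y z ->
  hlin a (q (p ++ x :: r)) (q (p ++ y :: r)) (q (p ++ z :: r)).
Proof.
move=> H; have [Ex Ey] := wdeg_hlin p r H.
by split; rewrite /hdeg /= ?Ex ?Ey //; apply: qval_mlinear H.
Qed.

(** Modulo two, (|x| - 1)(|y| - 1) + 1 differs from |x||y| by |x| + |y|, which is the change of the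
    shift exponent when x and y are exchanged. *)
Lemma qval_gsym : gsym qval.
Proof.
move=> p x y r.
have E u t : qval (p ++ u :: t :: r) =
    eps (shift_exp (map (@hdeg K V) (p ++ u :: t :: r))) *:
    (l (map (@hval K V) (p ++ u :: t :: r)) : V) by case: p.
have := shLie_antisym Hl (map desus p) (map desus r) (desus x) (desus y).
rewrite -[desus x :: _]/(map desus (x :: y :: r)) -[desus y :: _]/(map desus (y :: x :: r)).
rewrite -!map_cat !map_hval_desus => El; rewrite !E El !map_cat !map_cons.
rewrite !shift_exp_cat !shift_exp_cons.
rewrite -[hdeg (desus x)]/(hdeg x - 1) -[hdeg (desus y)]/(hdeg y - 1) /=.
rewrite -scaleN1r.
have -> : -1 = @eps K 1 by rewrite eps_oddz.
by rewrite !scalerA -!epsD; congr (_ *: _); apply: eps_par; rewrite /= ?big_cons ?intS; par.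
Qed.

Variable d : ghom 1 g g.
Hypothesis d2 : forall x, d (d x) = 0.
Hypothesis dl : is_derivation l d.

Lemma dV_deg k (x : V) : gproj V k x = x -> gproj V (k + 1) (d x : V) = d x.
Proof. by move=> /(ghomP d); rewrite /= addrAC. Qed.

Definition dV : ghom 1 V V := @Ghom K 1 V V (gfun d) dV_deg.

Lemma dv_sum (M : lmodType K) w (Phi : word -> M) :
  dv dV w Phi = \sum_(0 <= j < size w) eps (wdeg (take j w)) *:
    Phi (take j w ++ happ dV (nth (helt0 V) w j) :: drop j.+1 w).
Proof.
elim: w Phi => [|x w IH] Phi; first by rewrite dv_nil big_geq.
rewrite dv_cons [size _]/= big_nat_recl //= wdeg_nil eps0 scale1r drop0.
congr (_ + _); rewrite IH scaler_sumr; apply: eq_bigr => j _.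
by rewrite wdeg_cons scalerA epsD.
Qed.

(** Suspended operations are odd in every arity, so the shift exponents turn the sign (-1)^(n-2) of
    the derivation rule into one minus sign independent of n. *)
Lemma qval_deriv z : dV (qval z) = - dv dV z qval.
Proof.
case: z => [|x z]; first by rewrite dv_nil oppr0 raddf0.
rewrite /qval; set w := x :: z.
have H0 : map desus w <> [::] by [].
have := dl H0; rewrite map_hval_desus size_map => E.
transitivity (eps (shift_exp (map (@hdeg K V) w)) *: (d (l (map (@hval K V) w)) : V)).
  exact: linearZ.
rewrite {}E dv_sum -sumrN [X in _ *: X](_ : _ = \sum_(0 <= j < size w)
    eps ((size w)%:Z - 2 + (wdeg (take j w) - j%:Z)) *:
    (l (map (@hval K V) (take j w ++ happ dV (nth (helt0 V) w j) :: drop j.+1 w)) : V)).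
  rewrite scaler_sumr; apply: eq_big_nat => j /andP[_ lt_j].
  rewrite /qval; case Ew: (_ ++ _) => [|y u]; first by case: (take j w) Ew.
  rewrite -{y u}Ew -scaleN1r -[-1](_ : @eps K 1 = _); last by rewrite eps_oddz.
  rewrite !scalerA -!epsD; congr (_ *: _).
  have -> : map (@hdeg K V) w =
      map (@hdeg K V) (take j w ++ nth (helt0 V) w j :: drop j.+1 w).
    by rewrite -drop_nth // cat_take_drop.
  rewrite !map_cat !map_cons !shift_exp_cat !shift_exp_cons.
  have -> : (size w)%:Z = j%:Z + (1 + (size (map (@hdeg K V) (drop j.+1 w)))%:Z).
    by rewrite size_map size_drop -intS -PoszD; congr Posz; rewrite subnSK // subnKC // ltnW.
  rewrite -[hdeg (happ dV _)]/(hdeg _ + 1); apply: eps_par.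
  by rewrite /= ?intS; par.
rewrite scaler_sumr; apply: eq_big_nat => j /andP[_ lt_j].
rewrite scalerA -epsD -map_take wdeg_desus size_takel ?(ltnW lt_j) //.
congr (_ *: l _).
rewrite map_cat map_hval_desus map_cons -map_drop map_hval_desus.
by rewrite (nth_map (helt0 V)).
Qed.

End ShLieOperations.

Section SbarCoproduct.
Variables (K : fieldType) (V : gmod K).
Local Notation word := (seq (helt V)).

Lemma sbar_ext (M : lmodType K) (f h : Sbar V -> M) : linear f -> linear h ->
  (forall w, f (hval (sword w)) = h (hval (sword w))) -> f =1 h.
Proof.
move=> Hf Hh H; elim/sword_ind => [|a w t IH]; last by rewrite Hf Hh H IH.
have E (k : Sbar V -> M) : linear k -> k 0 = 0.
  by move=> Hk; have := Hk 1 0 0; rewrite !scale1r addr0 => /eq_double.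
by rewrite !E.
Qed.

Lemma sword_mlinear : mlinear (fun w : word => hval (sword w)).
Proof. by move=> p q a x y z /(wlin1 p q)/wlin_sword[]. Qed.

Lemma sword_gsym : gsym (fun w : word => hval (sword w)).
Proof. by move=> p x y q; apply: sword_swap. Qed.

Lemma sproj_deg k (c : Sbar V) :
  gproj (Sbar V) k c = c -> gproj V k (sproj V c) = sproj V c.
Proof.
move=> Hc; have := @ghom_gen _ _ _ _ (@sword_relH K V) 0 V (sproj V).
move=> /(_ _ k c Hc); rewrite addr0; apply => w.
rewrite addr0 -[pgen _ w]/(hval (sword w)) sword_liftE.
case: w => [|x [|y w]] /=; rewrite ?raddf0 //.
by rewrite wdeg_cons wdeg_nil addr0 heltP.
Qed.

Lemma deltaS_sword w : deltaS V (hval (sword w)) =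
  us w (fun L R => tpair (sword L) (sword R)).
Proof.
rewrite sword_liftE /deltaS_fun big_unshuff us_masks big_mkcond.
apply: eq_big_seq => m; rewrite mem_masks => /eqP Hm /=; rewrite andbT.
case: ifP => // /negbT; rewrite negb_and -!leqNgt leqn0 => /orP[/eqP Hc|Hc].
  by rewrite mask_nseq0 // tpair0l ?scaler0 //; apply: sword_nil.
rewrite tpair0r ?scaler0 // mask_nseq0 ?sword_nil //.
apply/eqP; rewrite count_map -leqn0 -(leq_add2l (count id m)) addn0 count_predC.
by rewrite Hm.
Qed.

End SbarCoproduct.

Section Letters.
Variables (K : fieldType) (g : gmod K).
Local Notation V := (gshift g).
Local Notation W := (LLletter g).
Local Notation word := (seq (helt V)).

Definition mono (y : word) : helt W := happ (susp _) (sword y).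

Lemma mono_nil : hval (mono [::]) = 0.
Proof. exact: sword_nil. Qed.

Lemma mono_hlin (a : K) p x y z q : hlin a x y z ->
  hlin a (mono (p ++ x :: q)) (mono (p ++ y :: q)) (mono (p ++ z :: q)).
Proof. by move=> /(wlin1 p q)/wlin_sword; apply: hlin_happ. Qed.

Lemma mono_mlinear (M : lmodType K) (Psi : helt W -> M) :
  hlinear Psi -> mlinear (fun y => Psi (mono y)).
Proof. by move=> H p q a x y z /(mono_hlin p q)/H. Qed.

Lemma hlinear_scale (M : lmodType K) (U : gmod K) (Psi : helt U -> M) a x z :
  hlinear Psi -> hdeg x = hdeg z -> hval z = a *: hval x -> Psi z = a *: Psi x.
Proof.
move=> H Hd Hv; rewrite (H _ _ _ _ (hlinZ Hd Hv)).
by rewrite (hlinear0 H (x := hzero U (hdeg z))) ?addr0.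
Qed.

Lemma helt_mono_ext (M : lmodType K) (Psi Psi' : helt W -> M) :
  hlinear Psi -> hlinear Psi' -> (forall y, Psi (mono y) = Psi' (mono y)) ->
  Psi =1 Psi'.
Proof.
move=> H H' E x.
have [s Hs Ex] := gpres_split (heltP x : gproj (Sbar V) (hdeg x - 1) (hval x) = hval x).
have D : {in s, forall c, hdeg (mono c.2) = hdeg x}.
  by move=> c /Hs Ec; rewrite -[LHS]/(wdeg c.2 + 1) Ec subrK.
rewrite (hlinear_lsum_val H D Ex) (hlinear_lsum_val H' D Ex).
by apply: eq_lsum => y; apply: E.
Qed.

Lemma hdeg_mono y : hdeg (mono y) = wdeg y + 1.
Proof. by []. Qed.

Lemma deltaW_mono y : deltaW g (hval (mono y)) =
  us y (fun L R => eps (wdeg L) *: tpair (mono L) (mono R)).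
Proof.
transitivity (tmap (susp _) (susp _) (deltaS V (hval (sword y)))); first by [].
rewrite deltaS_sword us_lin; apply: eq_us1 => L R.
by rewrite tmapE mul1r.
Qed.

Lemma deltaW_deg k (x : W) : gproj W k x = x ->
  gproj (tens W W) (k + 1) (deltaW g x) = deltaW g x.
Proof.
move=> Hx; have [s Hs Ex] := gpres_split (Hx : gproj (Sbar V) (k - 1) x = x).
have -> : deltaW g x = lsum s (fun y => deltaW g (hval (mono y))).
  by rewrite Ex; apply: etrans (lsum_lin _ _ _) _.
rewrite lsum_lin; apply: eq_lsum_in => c /Hs Ec; rewrite deltaW_mono us_lin.
apply: eq_us => L R Ey _; rewrite linearZ; congr (_ *: _).
have <- : hdeg (mono L) + hdeg (mono R) = k + 1.
  rewrite !hdeg_mono; have -> : k = wdeg c.2 + 1 by rewrite Ec subrK.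
  by rewrite -Ey; ring.
exact: (ggenP (@tens_relH K W W) (mono L, mono R)).
Qed.

(** The coproduct of [Sbar] is cocommutative; the suspensions replace |A||B| by (|A|+1)(|B|+1) in
    the sign of the flip, which together with the sign of s (x) s gives the minus. *)
Lemma deltaW_anti x : flip W W (deltaW g x) = - deltaW g x.
Proof.
have L := linearP (deltaW g).
move: x; apply: (@sbar_ext _ V) => [||y].
- exact: (linear_compp (linearP (flip W W)) L).
- by move=> a x y; rewrite L opprD scalerN.
rewrite -[hval (sword y)]/(hval (mono y)) deltaW_mono us_lin us_comm -usN.
apply: eq_us1 => A B; rewrite linearZ /= flipE !hdeg_mono.
signs.
Qed.

Lemma sp_mono (M : lmodType K) (Psi : helt W -> helt W -> M) y : bilin Psi ->
  sp (letter_split deltaW_deg) (mono y) Psi =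
  us y (fun L R => eps (wdeg L) *: Psi (mono L) (mono R)).
Proof.
move=> B; rewrite (sp_tens_lift _ _ B) deltaW_mono us_lin; apply: eq_us1 => L R.
by rewrite linearZ tens_liftE.
Qed.

End Letters.

(** * The block map of the derived homotopies *)

Section BlockMap.
Variables (K : fieldType) (g : gmod K) (l : seq g -> g).
Hypothesis charK : [pchar K] =i pred0.
Hypothesis Hl : is_shLie l.
Variable d : ghom 1 g g.
Hypothesis d2 : forall x, d (d x) = 0.
Hypothesis dl : is_derivation l d.
Local Notation V := (gshift g).
Local Notation W := (LLletter g).
Local Notation vword := (seq (helt V)).
Local Notation wword := (seq (helt W)).
Local Notation spl := (letter_split (@deltaW_deg K g)).
Local Notation q := (q Hl).
Local Notation dV := (dV d).

(** A shift keeps the underlying module, so no desuspension is written. With this minus sign the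
    numbers (+-)^i_m are absorbed, see [derived_exp]. *)
Definition theta_fun (c : W) : V := - dV (sproj V c).

Lemma theta_linear : linear theta_fun.
Proof.
have L := linear_compp (linearP dV) (linearP (sproj V)).
by move=> a x y; rewrite /theta_fun L opprD scalerN.
Qed.

HB.instance Definition _ := GRing.isLinear.Build K W V _ theta_fun theta_linear.

Lemma theta_deg k c : gproj W k c = c -> gproj V (k + 0) (theta_fun c) = theta_fun c.
Proof.
move=> Hc; have := ghomP dV (sproj_deg (Hc : gproj (Sbar V) (k - 1) c = c)).
by rewrite subrK addr0 /theta_fun => H; rewrite raddfN /= H.
Qed.

Definition theta : ghom 0 W V := Ghom theta_deg.
Definition th (x : helt W) : helt V := happ theta x.

Lemma th_deg x : hdeg (th x) = hdeg x.
Proof. exact: addr0. Qed.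

Lemma th_hlin a x y z : hlin a x y z -> hlin a (th x) (th y) (th z).
Proof. exact: hlin_happ. Qed.

Lemma wdeg_th v : wdeg (map th v) = wdeg v.
Proof.
by elim: v => [|x v IH]; rewrite ?wdeg_nil //= !wdeg_cons IH th_deg.
Qed.

Lemma th_mono1 x : hval (th (mono [:: x])) = - hval (happ dV x).
Proof.
rewrite -[LHS]/(- dV (sproj V (hval (sword [:: x])))).
by rewrite sword_liftE.
Qed.

Lemma th_mono0 y : size y != 1 -> hval (th (mono y)) = 0.
Proof.
move=> Hy; rewrite -[LHS]/(- dV (sproj V (hval (sword y)))) sword_liftE.
by case: y Hy => [|x [|z y]] //= _; rewrite raddf0 oppr0.
Qed.

Lemma dV_th x : hval (happ dV (th x)) = 0.
Proof.
rewrite -[LHS]/(dV (- dV (sproj V (hval x)))) raddfN /=.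
by rewrite [X in - X]d2 oppr0.
Qed.

Lemma hlinear_th (M : lmodType K) (Psi : helt V -> M) :
  hlinear Psi -> hlinear (fun x => Psi (th x)).
Proof. by move=> H a x y z /th_hlin/H. Qed.

Lemma mlinear_th (M : lmodType K) (Phi : vword -> M) :
  mlinear Phi -> mlinear (fun v => Phi (map th v)).
Proof. by move=> H p r a x y z Hl'; rewrite !map_cat !map_cons (hlinear_th (H _ _) Hl'). Qed.

Lemma double_eq0 (M : lmodType K) (x : M) : x = - x -> x = 0.
Proof.
move=> E; have : (2%:R : K) *: x = 0.
  by rewrite -[2%:R]/(1 + 1) scalerDl scale1r {1}E addNr.
move/eqP; rewrite scaler_eq0 => /orP[|/eqP //] E2.
by have := charK 2; rewrite !inE E2.
Qed.

(** The two parts of a split letter are antisymmetric, whereas Phi is symmetric and [th] preserves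
    degrees. The sum equals its opposite, and 2 is invertible. *)
Lemma ds_th_sym (M : lmodType K) v (Phi : vword -> M) :
  mlinear Phi -> gsym Phi -> ds spl v (fun u => Phi (map th u)) = 0.
Proof.
elim: v Phi => [|x v IH] Phi HL HS; first by rewrite ds_nil.
rewrite ds_cons (IH (fun u => Phi (th x :: u))) ?scaler0 ?addr0; last 2 first.
- exact: (mlinear_prefix [:: th x]).
- exact: (gsym_prefix [:: th x]).
apply: double_eq0; rewrite {1}letter_split_anti; last 2 first.
- exact: deltaW_anti.
- exact: (mlinear_bilin [::] v (mlinear_th HL)).
congr (- _); apply: eq_lsum => -[a b] /=.
by rewrite (HS [::] (th b)) !th_deg scalerA mulrC -epsD [_ * hdeg b]mulrC eps2 scale1r.
Qed.

(* chi i k is the coefficient of l_(i+k) in arity (1,...,1,k), with i ones. *)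
Variable chi : nat -> nat -> K.
Hypothesis chi0 : forall i, chi i 0 = 0.

Definition phi_fun (z y : vword) : Sbar V :=
  us y (fun A R => chi (size z) (size A) *: hval (sword (q (z ++ A) :: R))).

Lemma phi_letter_mlinear z R : mlinear (fun A : vword =>
  chi (size z) (size A) *: (hval (sword (q (z ++ A) :: R)) : Sbar V)).
Proof.
move=> p r a x y t H; rewrite !size_cat /=.
apply: scale_lin; apply: (@sword_mlinear _ V [::] R).
by rewrite !catA; apply: q_hlin H.
Qed.

Lemma gsym_size (M : lmodType K) (f : nat -> K) (Phi : vword -> M) :
  gsym Phi -> gsym (fun y => f (size y) *: Phi y).
Proof.
move=> H p x y r; have -> : size (p ++ y :: x :: r) = size (p ++ x :: y :: r).
  by rewrite !size_cat.
by rewrite H !scalerA mulrC.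
Qed.

Lemma q_swap_deg p x y r : hdeg (q (p ++ y :: x :: r)) = hdeg (q (p ++ x :: y :: r)).
Proof. by rewrite -[LHS]/(wdeg _ - 1) wdeg_swap. Qed.

Lemma phi_letter_gsym z R : gsym (fun A : vword =>
  chi (size z) (size A) *: (hval (sword (q (z ++ A) :: R)) : Sbar V)).
Proof.
apply: (gsym_size (chi (size z))) => p x y r.
have H : hlinear (fun t => hval (sword (t :: R)) : Sbar V).
  exact: (@sword_mlinear _ V [::] R).
rewrite !catA; apply: hlinear_scale H _ _; first exact: q_swap_deg.
exact: qval_gsym.
Qed.

Lemma phi_mlin z : mlin (phi_fun z).
Proof.
apply: mlinear_mlin; first by rewrite /phi_fun us_nil chi0 scale0r.
apply: us_mlinear; split=> [R|L]; first exact: phi_letter_mlinear.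
exact: (mlinearZ _ (mlinear_prefix [:: q (z ++ L)] (@sword_mlinear _ V))).
Qed.

Lemma phi_gsym z : gsym (phi_fun z).
Proof.
apply: us_gsym; split=> [R|L]; first exact: phi_letter_gsym.
exact: (gsymZ _ (gsym_prefix [:: q (z ++ L)] (@sword_gsym _ V))).
Qed.

Definition phi z : {linear Sbar V -> Sbar V} := sword_lift (phi_mlin z) (phi_gsym z).

Lemma phiE z y : phi z (hval (sword y)) = phi_fun z y.
Proof. exact: sword_liftE. Qed.

(** The empty word is 0 in [Sbar], which forces the value 0 here. The missing term t is what [G]
    records in [F_ds] and [F_sp]. *)
Definition scons_fun (t : helt V) (y : vword) : Sbar V :=
  if y is [::] then 0 else hval (sword (t :: y)).

Lemma scons_mlin t : mlin (scons_fun t).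
Proof.
apply: mlinear_mlin => // p r a x y z H.
have E u : scons_fun t (p ++ u :: r) = hval (sword ((t :: p) ++ u :: r)) by case: p.
by rewrite !E; apply: sword_mlinear H.
Qed.

Lemma scons_gsym t : gsym (scons_fun t).
Proof.
move=> p x y r.
have E u v : scons_fun t (p ++ u :: v :: r) = hval (sword ((t :: p) ++ u :: v :: r)).
  by case: p.
by rewrite !E; apply: sword_gsym.
Qed.

Definition scons t : {linear Sbar V -> Sbar V} := sword_lift (scons_mlin t) (scons_gsym t).

Lemma sconsE t y : scons t (hval (sword y)) = scons_fun t y.
Proof. exact: sword_liftE. Qed.

(** With z coming from [th], each term applies q to one differentiated letter more than z has, and
    to the remaining letters of y; hence the indices of chi. For y of length one the coefficient is
    0 by [chi0]. *)
Definition gam_fun (z y : vword) : V :=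
  chi (size z).+1 (size y).-1 *: dv dV y (fun u => hval (q (z ++ u))).

Lemma gam_letter_mlinear z : mlinear (fun u : vword => hval (q (z ++ u)) : V).
Proof. exact: (mlinear_prefix z (qval_mlinear Hl)). Qed.

Lemma gam_letter_gsym z : gsym (fun u : vword => hval (q (z ++ u)) : V).
Proof. exact: (gsym_prefix z (qval_gsym Hl)). Qed.

Lemma gam_mlin z : mlin (gam_fun z).
Proof.
apply: mlinear_mlin; first by rewrite /gam_fun dv_nil scaler0.
move=> p r a x y t H; rewrite /gam_fun !size_cat.
apply: scale_lin; exact: (dv_mlinear dV (gam_letter_mlinear z) p r H).
Qed.

Lemma gam_gsym z : gsym (gam_fun z).
Proof.
apply: (gsym_size (fun n => chi (size z).+1 n.-1)).
exact: (dv_gsym dV (gam_letter_gsym z)).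
Qed.

Definition gamL z : {linear Sbar V -> V} := sword_lift (gam_mlin z) (gam_gsym z).

Lemma gamLE z y : gamL z (hval (sword y)) = gam_fun z y.
Proof. exact: sword_liftE. Qed.

Lemma gamL_deg z k (c : Sbar V) : gproj (Sbar V) k c = c ->
  gproj V (k + wdeg z) (gamL z c) = gamL z c.
Proof.
move: k c; apply: ghom_gen => y; rewrite -[pgen _ _]/(hval (sword y)) gamLE.
rewrite /gam_fun linearZ; congr (_ *: _); rewrite dv_lin.
apply: eq_dv => u Eu _; rewrite -[RHS]heltP.
rewrite -[hdeg (q _)]/(wdeg (z ++ u) - 1) wdeg_cat Eu.
by congr (gproj V _ _); ring.
Qed.

Lemma phi_deg z k (c : Sbar V) : gproj (Sbar V) k c = c ->
  gproj (Sbar V) (k + (wdeg z - 1)) (phi z c) = phi z c.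
Proof.
move: k c; apply: ghom_gen => y; rewrite -[pgen _ _]/(hval (sword y)) phiE.
rewrite us_lin; apply: eq_us => A R Ey _; rewrite linearZ; congr (_ *: _).
rewrite -[RHS]heltP -[hdeg (sword _)]/(wdeg (q (z ++ A) :: R)).
rewrite wdeg_cons -[hdeg (q _)]/(wdeg (z ++ A) - 1) wdeg_cat -Ey.
by congr (gproj _ _ _); ring.
Qed.

Lemma scons_deg t k (c : Sbar V) : gproj (Sbar V) k c = c ->
  gproj (Sbar V) (k + hdeg t) (scons t c) = scons t c.
Proof.
move: k c; apply: ghom_gen => y; rewrite -[pgen _ _]/(hval (sword y)) sconsE.
case: y => [|x y]; first exact: raddf0.
rewrite /scons_fun -[RHS]heltP -[hdeg (sword _)]/(wdeg (t :: x :: y)) wdeg_cons.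
by rewrite addrC.
Qed.

(** The last letter is the word to be differentiated, the others enter through [th]; [gam_val_rcons]
    is the form used later. *)
Definition gam_val (w : wword) : V :=
  if w is x :: w' then gamL (map th (belast x w')) (hval (last x w')) else 0.

Lemma gam_val_rcons v x : gam_val (v ++ [:: x]) = gamL (map th v) (hval x).
Proof. by case: v => [|y v] //=; rewrite cats1 belast_rcons last_rcons. Qed.

Lemma gam_val_deg w : gproj V (wdeg w - 1) (gam_val w) = gam_val w.
Proof.
elim/last_ind: w => [|v x _]; first exact: raddf0.
rewrite -cats1 gam_val_rcons wdeg_cat wdeg_cons wdeg_nil.
have := gamL_deg (map th v) (heltP x : gproj (Sbar V) (hdeg x - 1) (hval x) = hval x).
rewrite wdeg_th => H; rewrite -[RHS]H; congr (gproj V _ _); ring.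
Qed.

Definition gam w : helt V := Helt (gam_val_deg w).
Definition G w : helt W := mono [:: gam w].

Definition F_val (w : wword) : W :=
  if w is x :: w' then eps (wdeg (belast x w')) *:
    (phi (map th (belast x w')) (hval (last x w')) +
     scons (gam (belast x w')) (hval (last x w')) : Sbar V)
  else 0.

Lemma F_val_rcons v x : F_val (v ++ [:: x]) =
  eps (wdeg v) *: (phi (map th v) (hval x) + scons (gam v) (hval x) : Sbar V).
Proof. by case: v => [|y v] //=; rewrite cats1 belast_rcons last_rcons. Qed.

Lemma F_val_deg w : gproj W (wdeg w - 1) (F_val w) = F_val w.
Proof.
elim/last_ind: w => [|v x _]; first exact: raddf0.
rewrite -cats1 F_val_rcons wdeg_cat wdeg_cons wdeg_nil.
have Hx : gproj (Sbar V) (hdeg x - 1) (hval x) = hval x := heltP x.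
have := phi_deg (map th v) Hx; have := scons_deg (gam v) Hx.
rewrite -[hdeg (gam v)]/(wdeg v - 1) wdeg_th => H1 H2.
have -> : gproj W (wdeg v + (hdeg x + 0) - 1) = gproj (Sbar V) (hdeg x - 1 + (wdeg v - 1)).
  by rewrite -[LHS]/(gproj (Sbar V) _); congr (gproj (Sbar V) _); ring.
by rewrite linearZ linearD H1 H2.
Qed.

Definition F w : helt W := Helt (F_val_deg w).

Lemma F_deg w : hdeg (F w) = wdeg w - 1.
Proof. by []. Qed.

Lemma gam_deg w : hdeg (gam w) = wdeg w - 1.
Proof. by []. Qed.

Lemma G_deg w : hdeg (G w) = wdeg w.
Proof. by rewrite hdeg_mono wdeg_cons wdeg_nil gam_deg addr0 subrK. Qed.

Lemma sbar_param_linear (M : lmodType K) a (f1 f2 f3 : {linear Sbar V -> M}) :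
  (forall y, f3 (hval (sword y)) = a *: f1 (hval (sword y)) + f2 (hval (sword y))) ->
  forall c, f3 c = a *: f1 c + f2 c.
Proof.
move=> H; apply: sbar_ext => [||y]; [exact: linearP| |exact: H].
by apply: linear_addp; [apply: linear_scalep|]; exact: linearP.
Qed.

Lemma phi_paramP a p x y z r c : hlin a x y z ->
  phi (p ++ z :: r) c = a *: phi (p ++ x :: r) c + phi (p ++ y :: r) c.
Proof.
move=> H; apply: sbar_param_linear => w; rewrite !phiE /phi_fun !size_cat /=.
rewrite -usZ -usD; apply: eq_us1 => A R; apply: scale_lin.
apply: (@sword_mlinear _ V [::] R).
by rewrite -!catA; apply: q_hlin.
Qed.

Lemma scons_paramP a x y z c : hlin a x y z -> scons z c = a *: scons x c + scons y c.
Proof.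
move=> H; apply: sbar_param_linear => w; rewrite !sconsE.
case: w => [|t w]; first by rewrite /= scaler0 addr0.
exact: (@sword_mlinear _ V [::] (t :: w) _ _ _ _ H).
Qed.

Lemma gamL_paramP a p x y z r c : hlin a x y z ->
  gamL (p ++ z :: r) c = a *: gamL (p ++ x :: r) c + gamL (p ++ y :: r) c.
Proof.
move=> H; apply: sbar_param_linear => w; rewrite !gamLE /gam_fun !size_cat.
apply: scale_lin; rewrite -dvZ -dvD; apply: eq_dv => u _ _.
rewrite -!catA; exact: (qval_mlinear Hl p (r ++ u) H).
Qed.

Lemma gam_hlin a p x y z r : hlin a x y z ->
  hlin a (gam (p ++ x :: r)) (gam (p ++ y :: r)) (gam (p ++ z :: r)).
Proof.
move=> H; have [Ex Ey] := wdeg_hlin p r H.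
split; rewrite ?gam_deg ?Ex ?Ey // -![hval (gam _)]/(gam_val _).
elim/last_ind: r {Ex Ey} => [|r t _].
  by rewrite !gam_val_rcons; have [_ _ ->] := H; rewrite linearP.
rewrite -cats1 -!cat_cons !catA !gam_val_rcons !map_cat !map_cons.
exact/gamL_paramP/th_hlin.
Qed.

Lemma G_hlin a p x y z r : hlin a x y z ->
  hlin a (G (p ++ x :: r)) (G (p ++ y :: r)) (G (p ++ z :: r)).
Proof. by move=> H; apply: (mono_hlin [::] [::]); apply: gam_hlin. Qed.

Lemma F_hlin a p x y z r : hlin a x y z ->
  hlin a (F (p ++ x :: r)) (F (p ++ y :: r)) (F (p ++ z :: r)).
Proof.
move=> H; have [Ex Ey] := wdeg_hlin p r H.
split; rewrite ?F_deg ?Ex ?Ey // -![hval (F _)]/(F_val _).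
elim/last_ind: r {Ex Ey} => [|r t _].
  rewrite !F_val_rcons; apply: scale_lin; have [_ _ ->] := H; rewrite !linearP.
  by rewrite scalerDr addrACA.
rewrite -cats1 -!cat_cons !catA !F_val_rcons.
have [Ex Ey] := wdeg_hlin p r H; rewrite Ex Ey; apply: scale_lin.
rewrite !map_cat !map_cons (phi_paramP _ _ _ (th_hlin H)).
by rewrite (scons_paramP _ (gam_hlin p r H)) scalerDr addrACA.
Qed.

Lemma hval_mono1_0 (t : helt V) : hval t = 0 -> hval (mono [:: t]) = 0.
Proof.
apply: (hlinear0 (Psi := fun t => hval (mono [:: t]))).
exact: (@sword_mlinear _ V [::] [::]).
Qed.

Lemma G_nil : hval (G [::]) = 0.
Proof. exact: hval_mono1_0. Qed.

Lemma F_mono (M : lmodType K) (Psi : helt W -> M) v y : hlinear Psi ->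
  Psi (F (v ++ [:: mono y])) = eps (wdeg v) *:
    (us y (fun A R => chi (size v) (size A) *:
       Psi (mono (q (map th v ++ A) :: R))) +
     (if y is [::] then 0 else Psi (mono (gam v :: y)))).
Proof.
move=> H.
(* The lists present the value of [F] as a combination of monomials of the right degree, as
   [hlinear_lsum_val] requires. *)
pose s1 := [seq (c.1 * chi (size v) (size c.2.1), q (map th v ++ c.2.1) :: c.2.2)
  | c <- unsh y].
pose s2 : seq (K * vword) := if y is [::] then [::] else [:: (1, gam v :: y)].
pose s := [seq (eps (wdeg v) * c.1, c.2) | c <- s1 ++ s2].
have Es (N : lmodType K) (f : vword -> N) : lsum s f = eps (wdeg v) *:
    (us y (fun A R => chi (size v) (size A) *: f (q (map th v ++ A) :: R)) +
     (if y is [::] then 0 else f (gam v :: y))).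
  transitivity (eps (wdeg v) *: lsum (s1 ++ s2) f).
    by rewrite /lsum big_map scaler_sumr; apply: eq_bigr => c _; rewrite scalerA.
  rewrite lsum_cat; congr (_ *: (_ + _)).
    by rewrite /lsum big_map; apply: eq_bigr => c _ /=; rewrite scalerA.
  by rewrite /s2; case: (y) => [|t r]; rewrite ?lsum_nil // lsum_cons lsum_nil addr0 scale1r.
rewrite -(Es _ (fun w => Psi (mono w))); apply: hlinear_lsum_val => //.
  move=> c /mapP[e]; rewrite mem_cat => /orP[|] He ->.
    move: He => /mapP[u /unsh_deg Hu ->] /=; rewrite hdeg_mono F_deg wdeg_cons.
    rewrite -[hdeg (q _)]/(wdeg _ - 1) !wdeg_cat !wdeg_cons wdeg_nil hdeg_mono wdeg_th -Hu.
    by ring.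
  move: He; rewrite /s2; case: (y) => [|t r] //; rewrite inE => /eqP -> /=.
  rewrite hdeg_mono F_deg wdeg_cons gam_deg wdeg_cat [wdeg [:: mono _]]wdeg_cons.
  by rewrite wdeg_nil hdeg_mono; ring.
rewrite -[LHS]/(F_val _) F_val_rcons (Es W (fun w => hval (mono w))).
rewrite phiE sconsE /phi_fun size_map; congr (_ *: (_ + _)).
Qed.

Lemma gam_mono (M : lmodType K) (Psi : helt V -> M) v y : hlinear Psi ->
  Psi (gam (v ++ [:: mono y])) =
  chi (size v).+1 (size y).-1 *: dv dV y (fun u => Psi (q (map th v ++ u))).
Proof.
move=> H; pose s := [seq (chi (size v).+1 (size y).-1 * c.1, c.2) | c <- deriv_words dV y].
have Es (N : lmodType K) (f : vword -> N) : lsum s f =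
    chi (size v).+1 (size y).-1 *: dv dV y f.
  by rewrite /lsum big_map scaler_sumr; apply: eq_bigr => c _; rewrite scalerA.
rewrite -(Es _ (fun u => Psi (q (map th v ++ u)))).
apply: (hlinear_lsum_val (h := fun u => q (map th v ++ u))) => //.
  move=> c /mapP[e /deriv_words_deg He ->] /=.
  rewrite gam_deg -[LHS]/(wdeg _ - 1) !wdeg_cat wdeg_cons wdeg_nil hdeg_mono wdeg_th He.
  by ring.
rewrite -[LHS]/(gam_val _) gam_val_rcons gamLE.
by rewrite (Es V (fun u => hval (q (map th v ++ u)))) /gam_fun size_map.
Qed.

(** [th] is zero on the left parts of length other than one and is - d on single letters, so
    splitting off a part and applying [th] differentiates the word. *)
Lemma us_extract_th (M : lmodType K) u (Phi : vword -> M) :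
  mlinear Phi -> gsym Phi ->
  us u (fun L A => Phi (th (mono L) :: A)) = - dv dV u Phi.
Proof.
move=> HL HS; rewrite -(us_extract dV _ HS) -usN; apply: eq_us1 => L A.
case: L => [|x [|y L]].
- by rewrite oppr0; apply: (mlinear0 [::] A HL); apply: th_mono0.
- rewrite -scaleN1r; apply: hlinear_scale (HL [::] A) _ _.
    by rewrite th_deg hdeg_mono wdeg_cons wdeg_nil addr0.
  by rewrite th_mono1 scaleN1r.
- by rewrite oppr0; apply: (mlinear0 [::] A HL); apply: th_mono0.
Qed.

Lemma q_prefix_mlinear (M : lmodType K) (Psi : helt V -> M) A :
  hlinear Psi -> mlinear (fun z => Psi (q (z ++ A))).
Proof. by move=> H p r a x y z Hx; apply: H; rewrite -!catA; apply: q_hlin. Qed.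

Lemma q_suffix_mlinear (M : lmodType K) (Psi : helt V -> M) z :
  hlinear Psi -> mlinear (fun A => Psi (q (z ++ A))).
Proof. by move=> H p r a x y t Hx; apply: H; rewrite !catA; apply: q_hlin. Qed.

Lemma q_gsym (M : lmodType K) (Psi : helt V -> M) :
  hlinear Psi -> gsym (fun z => Psi (q z)).
Proof.
move=> H p x y r; apply: hlinear_scale H _ _; first exact: q_swap_deg.
exact: qval_gsym.
Qed.

Lemma mlinear_size (M : lmodType K) (f : nat -> K) (Phi : vword -> M) :
  mlinear Phi -> mlinear (fun y => f (size y) *: Phi y).
Proof.
move=> H p r a x y z Hx; rewrite !size_cat /=; exact: scale_lin (H p r _ _ _ _ Hx).
Qed.

(** Splittings before the last letter vanish by [ds_th_sym]. Splitting the last letter puts a second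
    differential on its word, and the total is 0 by [dv_dv]. *)
Lemma gam_ds (M : lmodType K) (Psi : helt V -> M) v :
  hlinear Psi -> ds spl v (fun u => Psi (gam u)) = 0.
Proof.
move=> H; elim/last_ind: v => [|v x _]; first exact: ds_nil.
have HM : mlinear (fun u => Psi (gam u)).
  by move=> p r a t y z Ht; apply: H; apply: gam_hlin.
rewrite -cats1; move: x.
apply: (@helt_mono_ext _ _ _ (fun x => ds spl (v ++ [:: x]) (fun u => Psi (gam u)))
  (fun=> 0)).
- move=> a x y z; apply: (ds_mlinear (@letter_split_deg _ _ _ (@deltaW_deg K g)) _ HM v [::]).
  exact: letter_split_hlinear.
- by move=> a x y z _; rewrite scaler0 addr0.
move=> y; rewrite ds_rcons.
have -> : ds spl v (fun u => Psi (gam (u ++ [:: mono y]))) = 0.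
  pose Phi z := chi (size z).+1 (size y).-1 *: dv dV y (fun u => Psi (q (z ++ u))).
  rewrite -(@ds_th_sym _ v Phi).
  - by apply: eq_lsum => u; rewrite gam_mono // /Phi size_map.
  - apply: (mlinear_size (fun n => chi n.+1 (size y).-1)) => p r a x1 x2 x3 Hx.
    rewrite -dvZ -dvD; apply: eq_dv => u _ _.
    exact: (q_prefix_mlinear u H p r Hx).
  - apply: (gsym_size (fun n => chi n.+1 (size y).-1)) => p x1 x2 r.
    rewrite -dvZ; apply: eq_dv => u _ _.
    exact: (gsym_suffix u (q_gsym H)).
rewrite add0r sp_mono; last first.
  split=> a x1 x2 x3 w Hx; first exact: (HM v [:: w] _ _ _ _ Hx).
  by have := HM (v ++ [:: w]) [::] _ _ _ _ Hx; rewrite -!catA.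
(* One letter of y is differentiated by [th] and another by [gam], so the indices of chi move by
   two. *)
pose Phi u := chi (size v).+2 (size u).-2 *:
  dv dV u (fun w => Psi (q (map th v ++ w))).
rewrite [X in _ *: X](_ : _ = dv dV y Phi); last first.
  rewrite -us_extract; last first.
    apply: (gsym_size (fun n => chi (size v).+2 n.-2)); apply: dv_gsym.
    exact: (gsym_prefix _ (q_gsym H)).
  apply: eq_us1 => L R.
  have -> : v ++ [:: mono L; mono R] = (v ++ [:: mono L]) ++ [:: mono R] by rewrite -catA.
  rewrite gam_mono // size_cat addn1.
  rewrite map_cat.
  have Z : hval (th (mono L)) = 0 -> chi (size v).+2 (size R).-1 *:
      dv dV R (fun u => Psi (q ((map th v ++ [:: th (mono L)]) ++ u))) = 0.
    move=> Z; rewrite [X in _ *: X](_ : _ = dv dV R (fun=> 0 : M)) ?[dv _ _ _]lsum0 ?scaler0 //.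
    apply: eq_dv => u _ _; rewrite -catA.
    exact: (mlinear0 (map th v) u (q_suffix_mlinear [::] H)).
  case: L Z => [|x [|x' L]] Z; [by rewrite Z ?scaler0 ?th_mono0| |by rewrite Z ?scaler0 ?th_mono0].
  rewrite /Phi /= dv_cons.
  rewrite (mlinear0 [::] R (q_suffix_mlinear (map th v) H)) ?add0r; last exact: d2.
  rewrite scalerA mulrC -scalerA; congr (_ *: _); rewrite -!dvZ.
  apply: eq_dv => u _ _; rewrite wdeg_cons wdeg_nil addr0.
  rewrite -catA /=; set A := Psi _; set B := Psi _.
  have -> : A = - B.
    rewrite -scaleN1r; apply: hlinear_scale (q_suffix_mlinear [::] H (map th v) u) _ _.
      by rewrite th_deg hdeg_mono wdeg_cons wdeg_nil addr0.
    by rewrite th_mono1 scaleN1r.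
  by rewrite -[hdeg (happ dV x)]/(hdeg x + 1); signs.
rewrite [X in _ *: X](_ : _ = 0) ?scaler0 //.
rewrite -[RHS](scaler0 _ (chi (size v).+2 (size y).-2)).
rewrite -(dv_dv (d := dV) (fun x => d2 x) y (q_suffix_mlinear (map th v) H)) -dvZ.
by apply: eq_dv => u _ Hu; rewrite /Phi Hu.
Qed.

Lemma mono_cons_hlinear (M : lmodType K) (Psi : helt W -> M) R : hlinear Psi ->
  hlinear (fun t => Psi (mono (t :: R))).
Proof. by move=> H; exact: (mono_mlinear H [::] R). Qed.

(** Splittings before the last letter vanish by symmetry. Splitting the last letter y makes [phi]
    contribute gam(v u) B for all unshuffles (u, B) of y, while [scons] subtracts those with B
    nonempty. The term with B empty is [G]. *)
Lemma F_ds (M : lmodType K) (Psi : helt W -> M) v x : hlinear Psi ->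
  ds spl (v ++ [:: x]) (fun u => Psi (F u)) = Psi (G (v ++ [:: x])).
Proof.
move=> H.
have HM : mlinear (fun u => Psi (F u)).
  by move=> p r a t y z Ht; apply: H; apply: F_hlin.
move: x.
apply: (@helt_mono_ext _ _ _ (fun x => ds spl (v ++ [:: x]) (fun u => Psi (F u)))
  (fun x => Psi (G (v ++ [:: x])))).
- move=> a x y z; apply: (ds_mlinear (@letter_split_deg _ _ _ (@deltaW_deg K g)) _ HM v [::]).
  exact: letter_split_hlinear.
- by move=> a x y z Hx; apply: H; apply: G_hlin.
move=> y; rewrite ds_rcons.
have HR R : hlinear (fun t => Psi (mono (t :: R))) := mono_cons_hlinear R H.
have -> : ds spl v (fun u => Psi (F (u ++ [:: mono y]))) = 0.
  transitivity (eps (wdeg v + 1) *: (ds spl v (fun u => us y (fun A R =>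
      chi (size u) (size A) *: Psi (mono (q (map th u ++ A) :: R)))) +
      ds spl v (fun u => if y is [::] then 0 else Psi (mono (gam u :: y))))).
    rewrite -dsD -dsZ; apply: eq_ds => [|u Eu]; first exact: letter_split_deg.
    by rewrite F_mono // Eu.
  rewrite (ds_us spl v y (fun u A R =>
    chi (size u) (size A) *: Psi (mono (q (map th u ++ A) :: R)))).
  rewrite [us _ _](_ : _ = 0) ?add0r; last first.
    rewrite -[RHS](us0 M y); apply: eq_us1 => A R.
    pose Phi z := chi (size z) (size A) *: Psi (mono (q (z ++ A) :: R)).
    rewrite -(@ds_th_sym _ v Phi).
    - by apply: eq_lsum => u; rewrite /Phi size_map.
    - apply: (mlinear_size (fun n => chi n (size A))).
      exact: (q_prefix_mlinear A (HR R)).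
    - apply: (gsym_size (fun n => chi n (size A))).
      exact: (gsym_suffix A (q_gsym (HR R))).
  case: (y) => [|t r]; last by rewrite (gam_ds v (HR (t :: r))) scaler0.
  by rewrite [ds _ _ _]lsum0 scaler0.
rewrite add0r sp_mono; last first.
  split=> a x1 x2 x3 w Hx; first exact: (HM v [:: w] _ _ _ _ Hx).
  by have := HM (v ++ [:: w]) [::] _ _ _ _ Hx; rewrite -!catA.
rewrite -usZ -[RHS](us_nilr y (fun L => Psi (G (v ++ [:: mono L])))).
pose f L A B := chi (size v).+1 (size A) *:
  Psi (mono (q (map th v ++ th (mono L) :: A) :: B)).
transitivity (us y (fun L R => - us R (f L)) -
  us y (fun L R => if R is [::] then 0 else Psi (mono (gam (v ++ [:: mono L]) :: R)))).
  rewrite -usN -usD; apply: eq_us1 => L R.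
  have -> : v ++ [:: mono L; mono R] = (v ++ [:: mono L]) ++ [:: mono R] by rewrite -catA.
  rewrite F_mono // wdeg_cat wdeg_cons wdeg_nil hdeg_mono size_cat addn1 map_cat.
  rewrite (eq_us1 R (Psi := f L)); last by move=> A B; rewrite /f -catA.
  by signs.
(* L and A are regrouped into the part u of y consumed by q; [us_extract_th] then sums over the
   choices of L in u. *)
rewrite usN -us_coassoc.
have -> : us y (fun u B => us u (fun L A => f L A B)) =
    - us y (fun u B => Psi (mono (gam (v ++ [:: mono u]) :: B))).
  rewrite -usN; apply: eq_us1 => u B; rewrite (gam_mono v u (HR B)) -dvZ.
  pose Phi w := chi (size v).+1 (size w).-1 *: Psi (mono (q (map th v ++ w) :: B)).
  rewrite -[RHS](_ : us u (fun L A => Phi (th (mono L) :: A)) = _); last first.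
    rewrite us_extract_th.
    - by congr (- _); apply: eq_dv => w _ Hw; rewrite /Phi Hw.
    - apply: (mlinear_size (fun n => chi (size v).+1 n.-1)).
      exact: (q_suffix_mlinear (map th v) (HR B)).
    - apply: (gsym_size (fun n => chi (size v).+1 n.-1)).
      exact: (gsym_prefix (map th v) (q_gsym (HR B))).
  by apply: eq_us1 => L A; rewrite /f /Phi /=.
rewrite opprK -usN -usD; apply: eq_us1 => L [|t R]; last by rewrite subrr.
by rewrite subr0.
Qed.

(** The [phi] terms cancel as for a coderivation of [Sbar]: the new letter q(th v, A) lies in one of
    the two parts. The prefix [gam v] would cancel likewise, but [scons] drops it in front of an
    empty part; the two unmatched terms form the right side. *)
Lemma F_sp (M : lmodType K) (Psi : helt W -> helt W -> M) v x : bilin Psi ->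
  sp spl (F (v ++ [:: x])) Psi + eps (wdeg v) *: sp spl x (fun a b =>
    Psi (F (v ++ [:: a])) b +
    eps ((wdeg v + 1) * hdeg a) *: Psi a (F (v ++ [:: b]))) =
  eps (wdeg v * hdeg x) *: Psi x (G v) - Psi (G v) x.
Proof.
move=> B; have [BL BR] := B.
have HL w : hlinear (fun t => Psi t w) by move=> a x1 x2 x3 Hx; apply: BL.
have HR w : hlinear (Psi w) by move=> a x1 x2 x3 Hx; apply: BR.
pose Psi2 a b := Psi (F (v ++ [:: a])) b +
    eps ((wdeg v + 1) * hdeg a) *: Psi a (F (v ++ [:: b])).
have B2 : bilin Psi2.
  split=> a x1 x2 x3 w Hx; rewrite /Psi2.
    rewrite (HL w _ _ _ _ (F_hlin v [::] Hx)) (HL _ _ _ _ _ Hx).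
    have [-> -> _] := Hx; rewrite !scalerDr !scalerA [a * _]mulrC; zmodule.
  rewrite (HR _ _ _ _ _ Hx) (HR _ _ _ _ _ (F_hlin v [::] Hx)).
  by rewrite !scalerDr !scalerA [a * _]mulrC; zmodule.
have HS : hlinear (fun t => sp spl t Psi) by exact: letter_split_hlinear.
move: x; apply: (@helt_mono_ext _ _ _
  (fun x => sp spl (F (v ++ [:: x])) Psi + eps (wdeg v) *: sp spl x Psi2)
  (fun x => eps (wdeg v * hdeg x) *: Psi x (G v) - Psi (G v) x)).
- apply: hlinearD; last by apply: hlinearZ; apply: letter_split_hlinear.
  by move=> a x1 x2 x3 Hx; apply: HS; apply: F_hlin.
- move=> a x1 x2 x3 Hx; rewrite (HR _ _ _ _ _ Hx) (HL _ _ _ _ _ Hx).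
  have [-> -> _] := Hx; rewrite scalerDr scalerBr opprD !scalerA [a * _]mulrC.
  zmodule.
move=> y; rewrite sp_mono // (F_mono v y HS).
set ze := map th v; set ga := gam v.
have ES z y' : sp spl (mono (z :: y')) Psi =
    us y' (fun L R => eps (hdeg z + wdeg L) *: Psi (mono (z :: L)) (mono R)) +
    us y' (fun L R => eps (hdeg z * wdeg L + wdeg L) *: Psi (mono L) (mono (z :: R))).
  rewrite sp_mono // us_cons; congr (_ + _); apply: eq_us1 => L R; rewrite ?wdeg_cons //.
  by rewrite scalerA -epsD.
have -> : match y with [::] => 0 | _ :: _ => sp spl (mono (ga :: y)) Psi end =
    sp spl (mono (ga :: y)) Psi.
  case: (y) => [|t r] //; rewrite ES !us_nil (hlinear0 (HR _) (mono_nil g)).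
  by rewrite (hlinear0 (HL _) (mono_nil g)) !scaler0 addr0.
pose c (A : vword) := chi (size v) (size A).
(* P1 and P2 split a term of F(v y), with the letter q on the left or on the right; P3 and P4 split
   y first and apply F to its left or right part. G3 and G4 are the corresponding terms with the
   prefix ga. *)
pose P1 := us y (fun A t => us t (fun L R => eps (wdeg v + wdeg A - 1 + wdeg L) *:
  (c A *: Psi (mono (q (ze ++ A) :: L)) (mono R)))).
pose P2 := us y (fun A t => us t (fun L R =>
  eps ((wdeg v + wdeg A - 1) * wdeg L + wdeg L) *:
  (c A *: Psi (mono L) (mono (q (ze ++ A) :: R))))).
pose P3 := us y (fun L R => us L (fun A B => eps (wdeg L + wdeg v) *:
  (c A *: Psi (mono (q (ze ++ A) :: B)) (mono R)))).
pose P4 := us y (fun L R => us R (fun A B => eps (wdeg L + (wdeg v + 1) * (wdeg L + 1) + wdeg v) *: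
  (c A *: Psi (mono L) (mono (q (ze ++ A) :: B))))).
pose G3 := us y (fun L R => eps (wdeg L + wdeg v) *:
  (if L is [::] then 0 else Psi (mono (ga :: L)) (mono R))).
pose G4 := us y (fun L R => eps (wdeg L + (wdeg v + 1) * (wdeg L + 1) + wdeg v) *:
  (if R is [::] then 0 else Psi (mono L) (mono (ga :: R)))).
have -> : us y (fun A R => chi (size v) (size A) *: sp spl (mono (q (ze ++ A) :: R)) Psi) =
    P1 + P2.
  rewrite -usD; apply: eq_us1 => A t.
  rewrite ES scalerDr -!usZ -[hdeg (q _)]/(wdeg (ze ++ A) - 1) wdeg_cat wdeg_th.
  by congr (_ + _); apply: eq_us1 => L R; rewrite !scalerA [c A * _]mulrC.
have -> : us y (fun L R => eps (wdeg L) *: Psi2 (mono L) (mono R)) = P3 + P4 + (G3 + G4).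
  rewrite -!usD; apply: eq_us1 => L R; rewrite /Psi2.
  rewrite (F_mono v L (HL (mono R))) (F_mono v R (HR (mono L))) hdeg_mono.
  rewrite !usZ; signs.
have P13 : P1 + P3 = 0.
  rewrite /P1 -us_coassoc -usD -[RHS](us0 M y); apply: eq_us1 => u R.
  rewrite -usD -[RHS](us0 M u); apply: eq_us => A C <- _.
  by move: (c A *: _) => T; signs.
have P24 : P2 + P4 = 0.
  rewrite /P2 -us_coassoc.
  rewrite (eq_us1 y (Psi := fun u R => us u (fun L A => eps (wdeg L * wdeg A) *:
    (eps ((wdeg v + wdeg A - 1) * wdeg L + wdeg L) *:
    (c A *: Psi (mono L) (mono (q (ze ++ A) :: R))))))); last first.
    by move=> u R; rewrite us_comm.
  rewrite us_coassoc -usD -[RHS](us0 M y); apply: eq_us1 => L t.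
  rewrite -usD -[RHS](us0 M t); apply: eq_us1 => A R.
  by move: (c A *: _) => T; signs.
rewrite ES -/ga gam_deg.
set G1 := us y _; set G2 := us y _.
(* G3 has no term with L empty, so that term of G1 survives; similarly for R empty in G2 below. *)
have G13 : G1 + G3 = eps (wdeg v + 1) *: Psi (mono [:: ga]) (mono y).
  rewrite -[RHS](us_nill y (fun R => eps (wdeg v + 1) *: Psi (mono [:: ga]) (mono R))).
  rewrite -usD; apply: eq_us1 => -[|t L] R; rewrite ?wdeg_nil ?scaler0; signs.
have G24 : G2 + G4 = eps (wdeg v * wdeg y) *: Psi (mono y) (mono [:: ga]).
  rewrite -[RHS](us_nilr y (fun L => eps (wdeg v * wdeg L) *: Psi (mono L) (mono [:: ga]))).
  rewrite -usD; apply: eq_us1 => L [|t R]; rewrite ?scaler0; signs.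
rewrite -scalerDr.
transitivity (eps (wdeg v) *: (P1 + P3 + (P2 + P4) + (G1 + G3 + (G2 + G4)))).
  by congr (_ *: _); zmodule.
rewrite P13 P24 G13 G24 !add0r hdeg_mono -/(G v); signs.
Qed.

End BlockMap.

(** * Identification of the induced coderivations *)

Section MonoWords.
Variables (K : fieldType) (g : gmod K).
Local Notation V := (gshift g).
Local Notation W := (LLletter g).
Local Notation vword := (seq (helt V)).
Local Notation wword := (seq (helt W)).
Local Notation mono := (@mono K g).

Lemma LLmonoE (cs : seq (seq (helt g))) :
  LLmono cs = [seq mono (map (happ (susp g)) c) | c <- cs].
Proof. by []. Qed.

Lemma helt_mono_sum (M : lmodType K) (x : helt W) : exists s : seq (K * vword),
  forall Psi : helt W -> M, hlinear Psi -> Psi x = lsum s (fun y => Psi (mono y)).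
Proof.
have [s Hs Ex] := gpres_split (heltP x : gproj (Sbar V) (hdeg x - 1) (hval x) = hval x).
exists s => Psi H; apply: (hlinear_lsum_val (h := mono) H _ Ex).
by move=> c /Hs Ec; rewrite -[LHS]/(wdeg c.2 + 1) Ec subrK.
Qed.

(** A letter is an arbitrary homogeneous element of W; multilinearity replaces the letters by
    monomials one after another, from the left. *)
Lemma tbar_mono_ind (Q : LLbar g -> Prop) : Q 0 ->
  (forall a x y, Q x -> Q y -> Q (a *: x + y)) ->
  (forall ys : seq vword, Q (hval (tword (map mono ys)))) -> forall x, Q x.
Proof.
move=> Q0 QL Qm.
have Qs (T : eqType) (s : seq (K * T)) (f : T -> LLbar g) :
    (forall t, Q (f t)) -> Q (lsum s f).
  move=> Hf; elim: s => [|c s IH]; first by rewrite lsum_nil.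
  by rewrite lsum_cons; apply: QL.
have Qw (w : wword) (ys : seq vword) : Q (hval (tword (map mono ys ++ w))).
  elim: w ys => [|x w IH] ys; first by rewrite cats0.
  have [s Hs] := helt_mono_sum (LLbar g) x.
  rewrite (Hs (fun t => hval (tword (map mono ys ++ t :: w)))); last first.
    exact: (@tword_mlinear _ _ (map mono ys) w).
  apply: Qs => y; have := IH (ys ++ [:: y]).
  by rewrite map_cat -catA.
elim/tword_ind => [//|a w t IH]; apply: QL IH; exact: (Qw w [::]).
Qed.

(** The function f stands for any additive statistic; it is taken to be the length for [weight] and
    the length plus one for [word_bound]. *)
Lemma unsh_mono (ys : seq vword) c : c \in unsh (map mono ys) ->
  exists ys1 ys2, [/\ c.2.1 = map mono ys1, c.2.2 = map mono ys2 &
    forall f : vword -> nat, (sumn (map f ys1) + sumn (map f ys2) = sumn (map f ys))%N].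
Proof.
elim: ys c => [|y ys IH] c /=; first by rewrite inE => /eqP ->; exists [::], [::].
rewrite mem_cat => /orP[] /mapP[e /IH[ys1 [ys2 [E1 E2 Ef]]] ->] /=.
  by exists (y :: ys1), ys2; rewrite E1 E2; split=> // f; rewrite /= -addnA Ef.
by exists ys1, (y :: ys2); rewrite E1 E2; split=> // f; rewrite /= addnCA Ef.
Qed.

End MonoWords.

Lemma lin1F_neq (K : fieldType) (V : gmod K) (w : seq (helt V)) :
  size w != 1 -> lin1F w = 0.
Proof. by case: w => [|x [|y w]]. Qed.

Section LLCoder.
Variables (K : fieldType) (g : gmod K) (l : seq g -> g).
Hypothesis charK : [pchar K] =i pred0.
Hypothesis Hl : is_shLie l.
Variable d : ghom 1 g g.
Hypothesis d2 : forall x, d (d x) = 0.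
Hypothesis dl : is_derivation l d.
Local Notation V := (gshift g).
Local Notation W := (LLletter g).
Local Notation vword := (seq (helt V)).
Local Notation wword := (seq (helt W)).
Local Notation mono := (@mono K g).
Local Notation q := (q Hl).
Local Notation dV := (dV d).
Local Notation th := (th d).

Section OneCoefficient.
Variable chi : nat -> nat -> K.
Hypothesis chi0 : forall i, chi i 0 = 0.
Local Notation F := (F Hl d chi0).

Definition LLcoder : ghom (- 1) (LLbar g) (LLbar g) :=
  zmap (F_deg Hl d chi0) (F_hlin Hl d chi0).

Lemma LLcoderE w : LLcoder (hval (tword w)) = Ds F w (fun u => hval (tword u)).
Proof. exact: zmapE. Qed.

Lemma LLcoder_coder : is_coderT LLcoder.
Proof.
split; first exact: zmap_deltaZ.
apply: (@zmap_deltaC _ _ _ (@deltaW_deg K g) (@deltaW_anti K g) _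
  (F_deg Hl d chi0) (F_hlin Hl d chi0) _ (G_deg Hl d chi)
  (G_hlin Hl d chi) (G_nil Hl d chi)).
  move=> M Psi v x; exact: F_ds.
move=> M Psi v x; exact: F_sp.
Qed.

Lemma tproj_LLcoder v x : tproj W (LLcoder (hval (tword (v ++ [:: x])))) =
  hval (F (v ++ [:: x])).
Proof.
rewrite LLcoderE; apply: etrans (lsum_lin (tproj W) _ _) _.
rewrite -/(Ds F _ _) Ds_rcons DsE big1 ?add0r => [|j _]; last first.
  rewrite -[RHS](us0 _ (take j v)); apply: eq_us1 => u u'.
  rewrite tword_liftE lin1F_neq ?scaler0 // !size_cat /= addn1 addnS.
  by case: (_ + _)%N.
rewrite -[RHS](us_nill v (fun u' => hval (F (u' ++ [:: x])))).
apply: eq_us1 => u u'; rewrite tword_liftE.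
by case: u => [|t [|t' u]]; rewrite /= ?scaler0 // wdeg_nil eps0 scale1r.
Qed.

(** Only words of length one survive: in the first sum of [F_mono] these have R empty, and the term
    prefixed by [gam] is longer. The correction is therefore invisible in the operations to be
    induced. *)
Lemma sproj_LLcoder v y :
  sproj V (tproj W (LLcoder (hval (tword (v ++ [:: mono y]))))) =
  (eps (wdeg v) * chi (size v) (size y)) *: hval (q (map th v ++ y)).
Proof.
rewrite tproj_LLcoder (F_mono Hl d chi0 (Psi := fun t => sproj V (hval t)));
  last by move=> a t u w [_ _ ->]; rewrite linearP.
rewrite -[X in _ + X](_ : 0 = _); last first.
  by case: y => [|t y] //; rewrite -[hval _]/(hval (sword _)) sword_liftE.
rewrite addr0 -scalerA; congr (_ *: _).
rewrite -[RHS](us_nilr y (fun A => chi (size v) (size A) *: hval (q (map th v ++ A)))).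
apply: eq_us1 => A R; rewrite -[hval (mono _)]/(hval (sword _)) sword_liftE.
by case: R => [|t R]; rewrite ?scaler0.
Qed.

Lemma LLcoder_nil : LLcoder (hval (tword [::])) = 0.
Proof. by rewrite LLcoderE Ds_nil. Qed.

End OneCoefficient.

(** In the induction of [derived_exp] a new differentiated letter raises both m and i. *)
Lemma derived_sign_rec m i :
  odd (((2 * m.+1 + i.+1 - 1) * i.+1)./2)%N =
  odd (((2 * m + i - 1) * i)./2)%N (+) ~~ odd m.
Proof.
have -> : ((2 * m.+1 + i.+1 - 1) * i.+1 =
    (2 * m + i - 1) * i + (2 * i + m + 1).*2)%N.
  (* The case i = 0 is separate because 2 * m + i - 1 is truncated when m is 0 as well. *)
  case: i => [|i]; first by rewrite muln0 -muln2; lia.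
  have -> : (2 * m.+1 + i.+2 - 1 = 2 * m + i + 3)%N by lia.
  have -> : (2 * m + i.+1 - 1 = 2 * m + i)%N by lia.
  by rewrite -!muln2 -addn1; lia.
rewrite halfD odd_double andbF add0n doubleK !oddD.
by case: (odd i); case: (odd m); case: (odd _).
Qed.

Lemma sum_nseq n (c : int) : \sum_(p <- nseq n c) p = c * n%:Z.
Proof.
elim: n => [|n IH]; first by rewrite big_nil mulr0.
by rewrite big_cons IH intS mulrDr mulr1.
Qed.

Lemma tens_exp0 n ds : tens_exp (nseq n 0) ds = 0.
Proof.
by elim: n ds => [|n IH] [|x ds] //=; rewrite IH sum_nseq mul0r mulr0 addr0.
Qed.

(* Compares the sign in derived_map with that of q (theta^i (x) s^-1), where
   theta = - s d s^-1 s^-1. *)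
Lemma derived_exp (ds es : seq int) (z : int) m : m = (size ds + size es)%N ->
  oddz ((((2 * m + size ds - 1) * size ds)./2)%N%:Z +
    (shift_exp (rcons [seq x + 1 + 1 | x <- ds] z) +
     shift_exp [seq x + 1 | x <- ds ++ es] +
     tens_exp (nseq (size ds) 1 ++ nseq (size es) 0) (ds ++ es))) =
  oddz (\sum_(x <- [seq x + 1 + 1 | x <- ds]) x +
    shift_exp ([seq x + 1 + 1 | x <- ds] ++ [seq x + 1 | x <- es]) + (size ds)%:Z).
Proof.
move=> ->{m}; elim: ds => [|x ds IH].
  rewrite muln0 /= big_nil add0r addr0 /shift_exp /= tens_exp0.
  by rewrite big_nil mulr0 !add0r addr0.
have S : oddz ((((2 * (size ds + size es).+1 + (size ds).+1 - 1) * (size ds).+1)./2)%N%:Z) =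
    oddz ((((2 * (size ds + size es) + size ds - 1) * size ds)./2)%N%:Z) (+)
    ~~ oddz ((size ds)%:Z + (size es)%:Z).
  by rewrite -PoszD; exact: derived_sign_rec.
rewrite [size (x :: ds)]/= addSn oddzD {}S; move: IH.
rewrite [map _ (x :: ds)]/= rcons_cons [(x :: ds) ++ es]/= [map _ (x :: (ds ++ es))]/=.
rewrite [(_ :: map _ ds) ++ _]/= big_cons !shift_exp_cons.
rewrite [nseq (size ds).+1 1]/= [(1 :: _) ++ _]/= [tens_exp (1 :: _) _]/=.
rewrite big_cat /= !sum_nseq mul0r addr0 mul1r.
rewrite !size_cat !size_rcons !size_map !size_cat ?PoszD ?intS ?oddzE.
by odd_cases.
Qed.

(** The condition i < m secures [chi_delta0]: for m <= i the truncated difference m - i would be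
    0. *)
Definition chi_delta (m i i' k : nat) : K := [&& i' == i, k == (m - i)%N & (i < m)%N]%:R.

Lemma chi_delta0 m i i' : chi_delta m i i' 0 = 0.
Proof.
rewrite /chi_delta [0%N == _]eq_sym subn_eq0 ltnNge.
by case: (m <= i)%N; rewrite !andbF.
Qed.

Lemma l0 p r : l (p ++ 0 :: r) = 0.
Proof.
apply: eq_double; have := shLie_multilinear Hl p r 1 0 0.
by rewrite !scale1r addr0.
Qed.

(** The signs come from the minus in theta, one for each differentiated letter; they are the summand
    [size ds] in [derived_exp]. *)
Lemma l_opp p xs r :
  l (p ++ map (fun x => - d x) xs ++ r) = (-1) ^+ size xs *: l (p ++ map d xs ++ r).
Proof.
elim: xs p => [|x xs IH] p /=; first by rewrite scale1r.
have := shLie_multilinear Hl p (map (fun x => - d x) xs ++ r) (-1) (d x) 0.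
rewrite addr0 scaleN1r l0 addr0 => ->.
have := IH (p ++ [:: d x]); rewrite -!catA /= => ->.
by rewrite exprS -scalerA.
Qed.

Lemma map_hval_sus (c : seq (helt g)) :
  map (@hval K V) (map (happ (susp g)) c) = map (@hval K g) c.
Proof. by rewrite -map_comp; apply: eq_map. Qed.

Lemma map_hdeg_sus (c : seq (helt g)) :
  map (@hdeg K V) (map (happ (susp g)) c) = [seq x + 1 | x <- map (@hdeg K g) c].
Proof. by rewrite -!map_comp; apply: eq_map. Qed.

Lemma size1_flatten (T : Type) (cs : seq (seq T)) :
  all (fun c => size c == 1) cs -> cs = [seq [:: x] | x <- flatten cs].
Proof. by elim: cs => [|[|x [|y c]] cs IH] //= /IH {1}->. Qed.

(** The arity condition has two sources: [chi_delta] fixes the number of letters and the length of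
    the last one, and [th] kills every word in which an earlier letter does not have length one. *)
Lemma LLcoder_derived m i : (i < m)%N ->
  derived_coder l d m i (LLcoder (chi_delta0 m i)).
Proof.
move=> im; split; first exact: LLcoder_coder.
move=> cs; case/lastP: cs => [|cs c].
  by rewrite LLcoder_nil /LLproj !raddf0; case: i {im}.
rewrite map_rcons eqseq_rcons.
transitivity (sproj V (tproj W (LLcoder (chi_delta0 m i) (hval (tword
  (map mono (map (map (happ (susp g))) cs) ++ [:: mono (map (happ (susp g)) c)]))))));
  first by rewrite LLmonoE map_rcons -cats1 -[in RHS]map_comp.
set v := map mono _; set y := map _ c.
have Sv : size v = size cs by rewrite !size_map.
have Sy : size y = size c by rewrite size_map.
rewrite sproj_LLcoder Sv Sy /chi_delta im andbT.
case Ec: (size c == m - i)%N; last by rewrite !andbF mulr0 scale0r.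
rewrite !andbT; case Ei: (size cs == i); last first.
  rewrite mulr0 scale0r; case: eqP => // E.
  by move: Ei; rewrite -(size_map size) E size_nseq eqxx.
rewrite mulr1; case E1: (all (fun c => size c == 1) cs); last first.
  have -> : (map size cs == nseq i 1) = false.
    apply/negbTE/negP => /eqP E; move/negbT: E1; rewrite -(all_map size (fun n => n == 1)).
    by rewrite E all_nseq orbT.
  move/negbT/allPn: E1 => [c0 Hin Hc0].
  have [cs1 [cs2 Ecs]] : exists cs1 cs2, cs = cs1 ++ c0 :: cs2.
    by case/splitPr: Hin => cs1 cs2; exists cs1, cs2.
  rewrite /v Ecs !map_cat !map_cons -catA.
  rewrite [hval _](mlinear0 _ _ (qval_mlinear Hl)) ?scaler0 //.
  by apply: th_mono0; rewrite size_map.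
have Ecs := size1_flatten E1; set xs := flatten cs in Ecs.
have Sx : size xs = i by rewrite -(eqP Ei) [in RHS]Ecs size_map.
have -> : map size cs == nseq i 1.
  rewrite [in X in X == _]Ecs -map_comp -Sx.
  by apply/eqP; elim: (xs) => //= x s ->.
have Efl : flatten (rcons cs c) = xs ++ c by rewrite flatten_rcons.
set ds := map (@hdeg K g) xs; set es := map (@hdeg K g) c.
have Sd : size ds = i by rewrite size_map.
have Se : size es = (m - i)%N by rewrite size_map (eqP Ec).
have Sm : m = (size ds + size es)%N by rewrite Sd Se subnKC // ltnW.
have Ev : map (@hdeg K W) v = [seq x + 1 + 1 | x <- ds].
  rewrite /v Ecs -!map_comp; apply: eq_map => x /=.
  by rewrite hdeg_mono wdeg_cons wdeg_nil addr0.
have EZ : map (@hdeg K V) (map th v ++ y) = [seq x + 1 + 1 | x <- ds] ++ [seq x + 1 | x <- es].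
  rewrite map_cat map_hdeg_sus -Ev -!map_comp; congr (_ ++ _).
  by apply: eq_map => x; apply: th_deg.
have EH : map (@hval K V) (map th v ++ y) =
    map (fun x => - d x) (map (@hval K g) xs) ++ map (@hval K g) c.
  rewrite map_cat map_hval_sus /v Ecs -!map_comp; congr (_ ++ _).
  by apply: eq_map => x /=; rewrite th_mono1.
have -> : hval (q (map th v ++ y)) =
    eps (shift_exp (map (@hdeg K V) (map th v ++ y))) *:
    (l (map (@hval K V) (map th v ++ y)) : V).
  rewrite -[LHS]/(qval l _) /qval; case E: (_ ++ _) => [|t r] //.
  have : size (map th v ++ y) = 0%N by rewrite E.
  by rewrite size_cat Sy (eqP Ec) => /eqP; rewrite addn_eq0 subn_eq0 leqNgt im andbF.
rewrite EZ EH (l_opp [::]) /= size_map Sx /derived_map Efl.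
rewrite LLmonoE map_rcons map_rcons.
have -> : [seq mono (map (happ (susp g)) c) | c <- cs] = v by rewrite /v -map_comp.
rewrite Ev.
rewrite map_hdeg_sus map_cat -/ds -/es.
have Er z : tens_exp (nseq i.+1 (-1)) (rcons [seq x + 1 + 1 | x <- ds] z) =
    shift_exp (rcons [seq x + 1 + 1 | x <- ds] z).
  by rewrite /shift_exp size_rcons size_map Sd.
have Es : tens_exp (nseq m (-1)) [seq x + 1 | x <- ds ++ es] =
    shift_exp [seq x + 1 | x <- ds ++ es].
  by rewrite /shift_exp size_map size_cat -Sm.
rewrite Er Es /derived_sign.
have Ed n : (-1) ^+ n = eps n%:Z :> K by rewrite eps_oddz /oddz absz_nat signr_odd.
rewrite !Ed -epsD wdegE Ev map_cat take_size_cat ?size_map ?drop_size_cat ?size_map //.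
rewrite [LHS]scalerA -epsD [LHS]scalerA -epsD.
congr (_ *: _); apply: eps_par; have := derived_exp (ds := ds) (es := es)
  (hdeg (mono (map (happ (susp g)) c))) Sm.
by rewrite Sd Se => ->.
Qed.

End LLCoder.

(** * Expansion in the coefficients and the locally finite sum *)

Section CoefficientExpansion.
Variables (K : fieldType) (M : lmodType K).

(* A is linear in chi and only involves the chi i k with i + k < n. *)
Definition coef_form n (A : forall chi : nat -> nat -> K, (forall i, chi i 0 = 0) -> M)
    : Prop :=
  forall chi (H : forall i, chi i 0 = 0), A chi H =
    \sum_(1 <= m < n) \sum_(0 <= i < m) chi i (m - i)%N *:
      A (chi_delta K m i) (chi_delta0 K m i).

(** For k > 0 the only indicator table that is nonzero at (i, k) is the one for m = i + k and the
    same i; for k = 0 all tables vanish there. *)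
Lemma coef_form_base n i k (t : M) : (i + k < n)%N ->
  coef_form n (fun chi _ => chi i k *: t).
Proof.
move=> lt_n chi H.
have E m j : (chi j (m - j)%N) *: (chi_delta K m j i k *: t) =
    if (m == i + k)%N && ((j == i) && (k != 0)%N) then chi i k *: t else 0.
  rewrite /chi_delta; case: (eqVneq i j) => [<-|ne]; last first.
    by rewrite andbF scale0r scaler0.
  case: (eqVneq k 0%N) => [->|k0] /=.
    rewrite andbF eq_sym subn_eq0 [(i < m)%N]ltnNge andbN scale0r scaler0 //.
  rewrite andbT; have -> : (k == (m - i)%N) && (i < m)%N = (m == i + k)%N.
    by apply/andP/eqP => [[/eqP -> /ltnW lim]|->]; [rewrite subnKC|rewrite addKn; split=> //; lia].
  by case: eqP => [->|]; rewrite ?addKn ?scale1r // scale0r scaler0.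
transitivity (\sum_(1 <= m < n) \sum_(0 <= j < m)
    if (m == i + k)%N && ((j == i) && (k != 0)%N) then chi i k *: t else 0); last first.
  by apply: eq_bigr => m _; apply: eq_bigr => j _; rewrite E.
case: (eqVneq k 0%N) => [->|k0].
  by rewrite H scale0r big1 // => m _; rewrite big1 // => j _; rewrite !andbF.
rewrite (big_cat_nat _ (n := (i + k).+1)) //= [X in _ = _ + X]big1_seq ?addr0; last first.
  move=> m; rewrite mem_index_iota => /andP[_ /andP[lt_m _]].
  by rewrite big1 // => j _; rewrite gtn_eqF.
rewrite big_nat_recr /=; last by lia.
rewrite big1_seq ?add0r; last first.
  move=> m; rewrite mem_index_iota => /andP[_ /andP[_ lt_m]].
  by rewrite big1 // => j _; rewrite ltn_eqF.
under eq_bigr do rewrite eqxx andbT /=.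
by rewrite -big_mkcond big_nat1_eq /= -[X in (X < _)%N]addn0 ltn_add2l lt0n k0.
Qed.

Lemma coef_form0 n : coef_form n (fun _ _ => 0).
Proof.
by move=> chi H; rewrite big1 // => m _; rewrite big1 // => i _; rewrite scaler0.
Qed.

Lemma eq_coef_form n A B : (forall chi H, A chi H = B chi H) ->
  coef_form n B -> coef_form n A.
Proof.
move=> E HB chi H; rewrite E HB; apply: eq_bigr => m _; apply: eq_bigr => i _.
by rewrite E.
Qed.

Lemma coef_formD n A B : coef_form n A -> coef_form n B ->
  coef_form n (fun chi H => A chi H + B chi H).
Proof.
move=> HA HB chi H; rewrite HA HB -big_split; apply: eq_bigr => m _ /=.
by rewrite -big_split; apply: eq_bigr => i _; rewrite scalerDr.
Qed.

Lemma coef_formZ n e A : coef_form n A -> coef_form n (fun chi H => e *: A chi H).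
Proof.
move=> HA chi H; rewrite HA scaler_sumr; apply: eq_bigr => m _.
by rewrite scaler_sumr; apply: eq_bigr => i _; rewrite !scalerA mulrC.
Qed.

Lemma coef_form_lsum n (T : eqType) (s : seq (K * T)) A :
  (forall c, c \in s -> coef_form n (A c.2)) ->
  coef_form n (fun chi H => lsum s (fun t => A t chi H)).
Proof.
elim: s => [|c s IH] HA.
  by apply: eq_coef_form (coef_form0 n) => chi H; rewrite lsum_nil.
apply: (eq_coef_form (B := fun chi H => c.1 *: A c.2 chi H +
  lsum s (fun t => A t chi H))) => [chi H|]; first by rewrite lsum_cons.
apply: coef_formD; first by apply: coef_formZ; apply: HA; rewrite mem_head.
by apply: IH => e es; apply: HA; rewrite inE es orbT.
Qed.

End CoefficientExpansion.

Section LocalSum.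
Variables (K : fieldType) (g : gmod K) (l : seq g -> g).
Hypothesis Hl : is_shLie l.
Variable d : ghom 1 g g.
Local Notation V := (gshift g).
Local Notation W := (LLletter g).
Local Notation vword := (seq (helt V)).
Local Notation mono := (@mono K g).
Local Notation F := (F Hl d).

(** Every coefficient chi i k met on the word has i + k below this number: i is controlled by the
    number of letters and k by the length of one letter. *)
Definition word_bound (ys : seq vword) : nat := sumn (map (fun y => (size y).+1) ys).

Lemma size_word_bound ys : (size ys <= word_bound ys)%N.
Proof. by rewrite /word_bound; elim: ys => //= y ys; lia. Qed.

Lemma F_coef_form (M : lmodType K) (Psi : helt W -> M) n ys y : hlinear Psi ->
  (word_bound ys + (size y).+1 <= n)%N ->
  coef_form n (fun chi H => Psi (F H (map mono ys ++ [:: mono y]))).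
Proof.
move=> HP Hn.
apply: (eq_coef_form (B := fun chi H => eps (wdeg (map mono ys)) *:
    (us y (fun A R => chi (size ys) (size A) *:
       Psi (mono (q Hl (map (th d) (map mono ys) ++ A) :: R))) +
     (if y is [::] then 0 else Psi (mono (gam Hl d chi (map mono ys) :: y)))))).
  by move=> chi H; rewrite F_mono // size_map.
have Sy := size_word_bound ys.
apply: coef_formZ; apply: coef_formD.
  apply: coef_form_lsum => c /unsh_size Hc; apply: coef_form_base.
  by move: Hn Sy Hc; clear; move: (size c.2.1) => a; lia.
case: y Hn => [|t y] Hn; first exact: coef_form0.
have HR := mono_cons_hlinear (t :: y) HP.
case/lastP: ys Sy Hn => [|ys y'] _ Hn.
  apply: eq_coef_form (coef_form0 M n) => chi H.
  exact: (hlinear0 HR).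
apply: (eq_coef_form (B := fun chi H => chi (size ys).+1 (size y').-1 *:
    dv (dV d) y' (fun u => Psi (mono (q Hl (map (th d) (map mono ys) ++ u) :: t :: y))))).
  by move=> chi H; rewrite map_rcons -cats1 (gam_mono _ _ _ _ _ HR) size_map.
apply: coef_form_base; have := size_word_bound ys.
by move: Hn; rewrite /word_bound map_rcons sumn_rcons /=; lia.
Qed.

Lemma Ds_coef_form (M : lmodType K) (Phi : seq (helt W) -> M) n ys : mlinear Phi ->
  (word_bound ys <= n)%N ->
  coef_form n (fun chi H => Ds (F H) (map mono ys) Phi).
Proof.
elim/last_ind: ys Phi => [|ys y IH] Phi HP.
  by move=> _; apply: eq_coef_form (coef_form0 M n) => chi H; rewrite Ds_nil.
rewrite /word_bound map_rcons sumn_rcons -/(word_bound ys) => Hn.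
apply: (eq_coef_form (B := fun chi H => Ds (F H) (map mono ys) (fun u => Phi (u ++ [:: mono y])) +
  us (map mono ys) (fun u v => eps (wdeg u) *: Phi (u ++ [:: F H (v ++ [:: mono y])])))).
  by move=> chi H; rewrite map_rcons -cats1 Ds_rcons.
apply: coef_formD; first by apply: IH; [exact: mlinear_suffix|lia].
apply: (@coef_form_lsum _ _ _ _ _ (fun p chi H => eps (wdeg p.1) *:
  Phi (p.1 ++ [:: F H (p.2 ++ [:: mono y])]))) => c /unsh_mono[ys1 [ys2 [_ E2 Hf]]].
apply: coef_formZ; rewrite E2; apply: (F_coef_form (Psi := fun t => Phi (c.2.1 ++ [:: t]))).
  exact: (HP c.2.1 [::]).
by have := Hf (fun y => (size y).+1); rewrite -!/(word_bound _); lia.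
Qed.

(** Since [th] and q carry all signs, the derived homotopies are summed with coefficients one. *)
Definition chi_one (i k : nat) : K := (k != 0)%N%:R.

Lemma chi_one0 i : chi_one i 0 = 0.
Proof. by []. Qed.

Lemma LLcoder_locsum :
  is_locsum (fun m x => \sum_(0 <= i < m) LLcoder Hl d (chi_delta0 K m i) x)
    (LLcoder Hl d chi_one0).
Proof.
apply: tbar_mono_ind => [|a x y [N1 H1] [N2 H2]|ys].
- exists 0%N => M _; rewrite raddf0 big1 // => m _; rewrite big1 // => i _.
  exact: raddf0.
- exists (maxn N1 N2) => M; rewrite geq_max => /andP[/H1 E1 /H2 E2].
  rewrite linearP E1 E2 scaler_sumr -big_split; apply: eq_bigr => m _.
  rewrite scaler_sumr -big_split; apply: eq_bigr => i _.
  by symmetry; exact: (linearP (LLcoder Hl d (chi_delta0 K m i))).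

exists (word_bound ys) => M HM; rewrite LLcoderE.
(* On this word [chi_one] acts as a finite sum of the tables [chi_delta], with coefficient one
   because m - i is positive. *)
rewrite (Ds_coef_form (@tword_mlinear _ _) HM); apply: eq_big_nat => m _.
apply: eq_big_nat => i /andP[_ im]; rewrite LLcoderE /chi_one.
by rewrite subn_eq0 leqNgt im scale1r.
Qed.

End LocalSum.

(** * Uniqueness of coderivations *)

Section Kernel.
Variables (K : fieldType) (W : gmod K).
Local Notation word := (seq (helt W)).

Lemma tproj_deg k (c : Tbar W) :
  gproj (Tbar W) k c = c -> gproj W k (tproj W c) = tproj W c.
Proof.
move=> Hc; have := @ghom_gen _ _ _ _ (@tword_relH K W) 0 W (tproj W).
move=> /(_ _ k c Hc); rewrite addr0; apply => w.
rewrite addr0 -[pgen _ w]/(hval (tword w)) tword_liftE.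
case: w => [|x [|y w]] /=; rewrite ?raddf0 //.
by rewrite wdeg_cons wdeg_nil addr0 heltP.
Qed.

Definition first_letter (t : helt (Tbar W)) : helt W := Helt (tproj_deg (heltP t)).

Lemma first_letter_hlin a x y z : hlin a x y z ->
  hlin a (first_letter x) (first_letter y) (first_letter z).
Proof.
case=> Ex Ey Ez; split=> //.
by rewrite -![hval (first_letter _)]/(tproj W (hval _)) Ez linearP.
Qed.

Lemma helt_tword_ext (M : lmodType K) (Psi Psi' : helt (Tbar W) -> M) :
  hlinear Psi -> hlinear Psi' -> (forall w, Psi (tword w) = Psi' (tword w)) ->
  Psi =1 Psi'.
Proof.
move=> H H' E x; have [s Hs Ex] := gpres_split (heltP x).
have D : {in s, forall c, hdeg (tword c.2) = hdeg x} by move=> c /Hs.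
rewrite (hlinear_lsum_val H D Ex) (hlinear_lsum_val H' D Ex).
by apply: eq_lsum => w; apply: E.
Qed.

Definition snoc_fun (c : helt W) (u : word) : Tbar W :=
  if u is [::] then 0 else hval (tword (u ++ [:: c])).

Lemma snoc_mlin c : mlin (snoc_fun c).
Proof.
apply: mlinear_mlin => // p q a x y z H.
have E t : snoc_fun c (p ++ t :: q) = hval (tword (p ++ t :: (q ++ [:: c]))).
  by rewrite -cat_cons catA; case: p.
by rewrite !E; apply: tword_mlinear H.
Qed.

Definition snoc c : {linear Tbar W -> Tbar W} := tword_lift (snoc_mlin c).

Lemma snoc_hlinear u : hlinear (fun c => snoc c u).
Proof.
move=> a x y z H; move: u; apply: tbar_ext => [||w].
- exact: (linearP (snoc z)).
- by apply: linear_addp; [apply: linear_scalep|]; exact: (linearP (snoc _)).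
rewrite !tword_liftE /snoc_fun; case: w => [|t w]; first by rewrite scaler0 addr0.
exact: (@tword_mlinear _ _ (t :: w) [::] _ _ _ _ H).
Qed.

Definition join_fun (x y : helt (Tbar W)) : Tbar W := snoc (first_letter y) (hval x).

Lemma join_bilin : bilin join_fun.
Proof.
split=> a x y z w H; first by have [_ _ E] := H; rewrite /join_fun E linearP.
exact: (snoc_hlinear _ (first_letter_hlin H)).
Qed.

Lemma hval_first_letter w : hval (first_letter (tword w)) = lin1F w.
Proof. by rewrite -[LHS]/(tproj W (hval (tword w))) tword_liftE. Qed.

Lemma first_letter1 x : first_letter (tword [:: x]) = x.
Proof.
apply: helt_eq; last exact: hval_first_letter.
by rewrite -[LHS]/(wdeg [:: x]) wdeg_cons wdeg_nil addr0.
Qed.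

(* The component of deltaZ in Tbar (x) W is w x |-> w (x) x. *)
Lemma join_deltaZ t : tens_lift join_bilin (deltaZ W (hval t)) =
  hval t - hval (tword [:: first_letter t]).
Proof.
move: t; apply: helt_tword_ext => [a x y z [_ _ ->]|a x y z H|w].
- have L := linear_compp (linearP (tens_lift join_bilin)) (linearP (deltaZ W)).
  by rewrite L.
- rewrite (@tword_mlinear _ W [::] [::] _ _ _ _ (first_letter_hlin H)).
  by have [_ _ ->] := H; rewrite scalerBr opprD; zmodule.
have E1 := hval_first_letter w.
elim/last_ind: w E1 => [|w x _] E1.
  rewrite deltaZ_nil raddf0 tword_nil.
  by rewrite (hlinear0 (@tword_mlinear _ W [::] [::])) ?subr0 // E1.
rewrite -cats1 in E1 *; rewrite deltaZ_rcons.
have -> : tens_lift join_bilin (us w (fun L R => wpair L (R ++ [:: x]))) =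
    us w (fun L R => if R is [::] then snoc_fun x L else 0).
  apply: etrans (us_lin _ _ _) _; apply: eq_us1 => L R.
  apply: etrans (tens_liftE join_bilin _ _) _; rewrite /join_fun.
  have EF := hval_first_letter (R ++ [:: x]).
  case: R EF => [|y R] EF; last first.
    rewrite (hlinear0 (snoc_hlinear _)) // EF lin1F_neq // size_cat addn1.
    by [].
  rewrite first_letter1.
  exact: tword_liftE.
rewrite us_nilr /snoc_fun; case: w E1 => [|y w] E1.
  rewrite first_letter1.
  by rewrite subrr.
rewrite (hlinear0 (@tword_mlinear _ W [::] [::])) ?subr0 // E1 lin1F_neq //.
by rewrite size_cat addn1.
Qed.

End Kernel.

Section UsFirst.
Variables (K : fieldType) (V : gmod K) (M : lmodType K).

(** Each letter is pulled to the front once, and by symmetry it returns to its place with the same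
    sign. *)
Lemma us_first w (Phi : seq (helt V) -> M) : gsym Phi ->
  us w (fun L R => if L is [:: x] then Phi (x :: R) else 0) = (size w)%:R *: Phi w.
Proof.
elim: w Phi => [|x w IH] Phi H; first by rewrite us_nil scale0r.
rewrite us_cons /= mulrS scalerDl scale1r -(us_nill w (fun R => Phi (x :: R))).
congr (_ + _); rewrite us_nill -(IH _ (gsym_prefix [:: x] H)).
apply: eq_us1 => -[|z [|z' L]] R; rewrite ?scaler0 //.
have /= -> := H [::] z x R; rewrite wdeg_cons wdeg_nil addr0 scalerA -epsD.
by rewrite [hdeg z * _]mulrC eps2 scale1r.
Qed.

End UsFirst.

Section LLUniqueness.
Variables (K : fieldType) (g : gmod K).
Hypothesis charK : [pchar K] =i pred0.
Local Notation V := (gshift g).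
Local Notation W := (LLletter g).
Local Notation vword := (seq (helt V)).
Local Notation mono := (@mono K g).

Lemma natr_neq0 n : (n.+1)%:R != 0 :> K.
Proof. by move/pcharf0P: charK => ->. Qed.

Definition first_vletter (c : helt W) : helt V :=
  Helt (sproj_deg (heltP c : gproj (Sbar V) (hdeg c - 1) (hval c) = hval c)).

Lemma first_vletter_hlin a x y z : hlin a x y z ->
  hlin a (first_vletter x) (first_vletter y) (first_vletter z).
Proof.
case=> Ex Ey Ez; split.
- by rewrite -[LHS]/(hdeg x - 1) Ex.
- by rewrite -[LHS]/(hdeg y - 1) Ey.
have E c : hval (first_vletter c) = sproj V (hval c) by [].
by rewrite !E Ez; exact: (linearP (sproj V)).
Qed.

Lemma scons0 (t : helt V) c : hval t = 0 -> scons t c = 0.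
Proof.
by apply: (hlinear0 (Psi := fun t => scons t c)) => a x y z; apply: scons_paramP.
Qed.

Definition avg_fun (y : vword) : Sbar V := (size y)%:R^-1 *: hval (sword y).

Lemma avg_mlin : mlin avg_fun.
Proof.
apply: mlinear_mlin; first by rewrite /avg_fun sword_nil scaler0.
exact: (mlinear_size (fun n => n%:R^-1) (@sword_mlinear _ V)).
Qed.

Lemma avg_gsym : gsym avg_fun.
Proof. exact: (gsym_size (fun n => n%:R^-1) (@sword_gsym _ V)). Qed.

Definition avg : {linear Sbar V -> Sbar V} := sword_lift avg_mlin avg_gsym.

(** Multiplying a one-letter left part with the right part and dividing by the length inverts the
    coproduct of [Sbar] on words of length at least two. The sign undoes that of s (x) s. *)
Definition glue_fun (x y : helt (LLbar g)) : Sbar V :=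
  eps (hdeg x + 1) *: avg (scons (first_vletter (first_letter x)) (tproj W (hval y))).

Lemma glue_bilin : bilin glue_fun.
Proof.
split=> a x y z w H; rewrite /glue_fun.
  have [-> -> _] := H; apply: scale_lin.
  by rewrite (scons_paramP _ (first_vletter_hlin (first_letter_hlin H))) linearP.
by have [_ _ ->] := H; apply: scale_lin; rewrite !linearP.
Qed.

Lemma wpair1_bilin : bilin (fun a b : helt W => wpair [:: a] [:: b]).
Proof.
by split=> a x1 x2 x3 w Hx; [exact: (mlinear_tpairL _ [::] [::])|exact: (mlinear_tpairR _ [::] [::])].
Qed.

Lemma deltaC_letter (x : helt W) : deltaC (deltaW g) (hval (tword [:: x])) =
  sp (letter_split (@deltaW_deg K g)) x (fun a b => wpair [:: a] [:: b]).
Proof.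
rewrite tword_liftE /deltaC_fun (partB_rcons (@deltaW_deg K g) [::] x).
rewrite /partA_fun big_geq // raddf0 subr0 add0r wdeg_nil eps0 scale1r us_nil.
by apply: eq_lsum => t; rewrite wdeg_nil mul0r eps0 scale1r.
Qed.

Lemma hval_first_vletter y : hval (first_vletter (mono y)) = lin1F y.
Proof. by rewrite -[LHS]/(sproj V (hval (sword y))) sword_liftE. Qed.

Lemma glue_deltaC (c : helt W) :
  tens_lift glue_bilin (deltaC (deltaW g) (hval (tword [:: c]))) =
  hval c - hval (sword [:: first_vletter c]).
Proof.
move: c; apply: (@helt_mono_ext _ _ _ (fun c =>
   tens_lift glue_bilin (deltaC (deltaW g) (hval (tword [:: c]))))
  (fun c => (hval c : Sbar V) - hval (sword [:: first_vletter c]))).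
- move=> a x y z H.
  rewrite (@tword_mlinear _ W [::] [::] _ _ _ _ H).
  exact: (linear_compp (linearP (tens_lift glue_bilin)) (linearP (deltaC (deltaW g)))).
- move=> a x y z H.
  rewrite (@sword_mlinear _ V [::] [::] _ _ _ _ (first_vletter_hlin H)).
  by have [_ _ ->] := H; rewrite scalerBr opprD; zmodule.
move=> y; rewrite deltaC_letter (sp_mono _ wpair1_bilin).
(* For n = 1 the right part is empty and the product vanishes; for n > 1 the inverse cancels the
   factor of [us_first]. *)
pose f n : K := if (1 < n)%N then n%:R^-1 else 0.
pose Phi (u : vword) := f (size u) *: (hval (sword u) : Sbar V).
have S1 : hlinear (fun t : helt V => hval (sword [:: t])) := @sword_mlinear _ V [::] [::].
transitivity (us y (fun L R => if L is [:: z] then Phi (z :: R) else 0)).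
  apply: etrans (us_lin _ _ _) _; apply: eq_us1 => L R.
  transitivity (eps (wdeg L) *: glue_fun (tword [:: mono L]) (tword [:: mono R])).
    by rewrite -(tens_liftE glue_bilin); exact: linearZ.
  rewrite /glue_fun scalerA -epsD first_letter1 -[hdeg (tword _)]/(wdeg [:: mono L]).
  rewrite wdeg_cons wdeg_nil hdeg_mono.
  rewrite [X in eps X](_ : _ = (wdeg L + 1) + (wdeg L + 1)); last by ring.
  rewrite eps2 scale1r tword_liftE.
  case: L => [|z [|z' L]].
  - by rewrite (scons0 _ (hval_first_vletter [::])) raddf0.
  - have -> : first_vletter (mono [:: z]) = z.
      apply: helt_eq; last exact: hval_first_vletter.
      by rewrite -[LHS]/(wdeg [:: z] + 1 - 1) wdeg_cons wdeg_nil addr0 addrK.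
    rewrite -[lin1F _]/(hval (sword R)) sconsE; case: R => [|t R].
      by rewrite raddf0 /Phi scale0r.
    exact: sword_liftE.
  by rewrite (scons0 _ (hval_first_vletter [:: z, z' & L])) raddf0.
rewrite us_first; last exact: (gsym_size f (@sword_gsym _ V)).
rewrite /Phi scalerA /f; case: y => [|z [|z' y]].
- rewrite mul0r scale0r -[hval (mono [::])]/(hval (sword [::])) sword_nil.
  by rewrite (hlinear0 S1 (hval_first_vletter [::])) subrr.
- have -> : first_vletter (mono [:: z]) = z.
    apply: helt_eq; last exact: hval_first_vletter.
    by rewrite -[LHS]/(wdeg [:: z] + 1 - 1) wdeg_cons wdeg_nil addr0 addrK.
  by rewrite mulr0 scale0r subrr.
by rewrite (hlinear0 S1 (hval_first_vletter [:: z, z' & y])) subr0 mulfV ?natr_neq0 // scale1r.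
Qed.

(** The kernel of deltaZ consists of single letters of W, and on these deltaC is the coproduct of
    the letter, whose kernel is V. *)
Lemma deltaZC_ker (t : helt (LLbar g)) :
  deltaZ W (hval t) = 0 -> deltaC (deltaW g) (hval t) = 0 ->
  sproj V (tproj W (hval t)) = 0 -> hval t = 0.
Proof.
move=> HZ HC Hp.
have /eqP := join_deltaZ t; rewrite HZ raddf0 eq_sym subr_eq0 => /eqP Et.
have := glue_deltaC (first_letter t).
rewrite -Et HC raddf0 (hlinear0 (@sword_mlinear _ V [::] [::] : hlinear _)) //.
rewrite subr0 => H0; rewrite Et.
by apply: (hlinear0 (@tword_mlinear _ W [::] [::])).
Qed.

End LLUniqueness.

Section CoderivationUniqueness.
Variables (K : fieldType) (g : gmod K).
Hypothesis charK : [pchar K] =i pred0.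
Local Notation V := (gshift g).
Local Notation W := (LLletter g).
Local Notation vword := (seq (helt V)).
Local Notation wword := (seq (helt W)).
Local Notation mono := (@mono K g).
Local Notation spl := (letter_split (@deltaW_deg K g)).

(** The letters of V are counted, not those of W: cobar lengthens a word of W but preserves this
    number. *)
Definition weight (ys : seq vword) : nat := sumn (map size ys).

Lemma tword_weight0 ys : weight ys = 0%N -> hval (tword (map mono ys)) = 0.
Proof.
case: ys => [|[|y0 y] ys] // _; first exact: tword_nil.
exact: (mlinear0 [::] _ (@tword_mlinear _ _) (mono_nil g)).
Qed.

Lemma ds_weight (M : lmodType K) (Phi : wword -> M) ys : mlinear Phi ->
  (forall zs, weight zs = weight ys -> Phi (map mono zs) = 0) ->
  ds spl (map mono ys) Phi = 0.
Proof.
elim: ys Phi => [|y ys IH] Phi HP H0; first exact: ds_nil.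
rewrite ds_cons (IH (fun u => Phi (mono y :: u))); last 2 first.
- exact: (mlinear_prefix [:: mono y] HP).
- by move=> zs Hz; apply: (H0 (y :: zs)); rewrite /weight /= -!/(weight _) Hz.
rewrite scaler0 addr0 sp_mono; last exact: (mlinear_bilin [::] _ HP).
rewrite -[RHS](us0 M y); apply: eq_us => L R _ Hs.
by rewrite (H0 (L :: R :: ys)) ?scaler0 // /weight /= addnA Hs.
Qed.

Variables (p : int) (X : ghom p (LLbar g) (LLbar g)).
Hypothesis XZ : forall x, tderiv X (deltaZ W x) = deltaZ W (X x).
Hypothesis XC : forall x,
  tderiv X (deltaC (deltaW g) x) = deltaC (deltaW g) (X x).
Hypothesis Xproj : forall ys, sproj V (tproj W (X (hval (tword (map mono ys))))) = 0.

Lemma tderiv_wpair_weight n (ys zs : seq vword) :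
  (forall us, (weight us < n)%N -> X (hval (tword (map mono us))) = 0) ->
  (weight ys + weight zs <= n)%N ->
  tderiv X (wpair (map mono ys) (map mono zs)) = 0.
Proof.
move=> IH Hn.
have Z0 : tderiv X 0 = 0 by rewrite /tderiv !raddf0 addr0.
case: (posnP (weight ys)) => [Hy|Hy].
  by rewrite /wpair tpair0l ?Z0 //; apply: tword_weight0.
case: (posnP (weight zs)) => [Hz|Hz].
  by rewrite /wpair tpair0r ?Z0 //; apply: tword_weight0.
rewrite tderiv_tpair tpair0l ?tpair0r ?scaler0 ?addr0 //; apply: IH; lia.
Qed.

(** A tensor factor of weight 0 vanishes, so in every nonzero term of a coproduct both factors have
    smaller weight and X kills them. For deltaC this applies through [deltaC_cobar] and
    [ds_weight]. *)
Lemma coder_weight n ys : (weight ys < n)%N -> X (hval (tword (map mono ys))) = 0.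
Proof.
elim: n ys => [//|n IH] ys; rewrite ltnS => Hn.
have ZZ zs : (weight zs <= n)%N -> tderiv X (deltaZ W (hval (tword (map mono zs)))) = 0.
  move=> {}Hn; case/lastP: zs Hn => [|zs z] Hn.
    by rewrite deltaZ_nil /tderiv !raddf0 addr0.
  rewrite map_rcons -cats1 deltaZ_rcons; apply: etrans (us_lin (tderiv X) _ _) _.
  rewrite /us -[RHS](lsum0 _ (unsh (map mono zs))).
  apply: eq_lsum_in => c /unsh_mono[ys1 [ys2 [-> -> Hf]]].
  have := tderiv_wpair_weight (n := n) (ys := ys1) (zs := ys2 ++ [:: z]) IH.
  rewrite map_cat => H; apply: H.
  have := Hf size; move: Hn; rewrite /weight map_rcons map_cat sumn_rcons sumn_cat /=; lia.
have LZ : linear (fun x => tderiv X (deltaZ W x)).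
  exact: (linear_compp (tderiv_linear X) (linearP (deltaZ W))).
have MZ : mlinear (fun u => tderiv X (deltaZ W (hval (tword u)))).
  by move=> p' q' a x y z H; rewrite (@tword_mlinear _ _ _ _ _ _ _ _ H) LZ.
apply: (deltaZC_ker charK (t := happ X (tword (map mono ys)))).
- by rewrite -[hval (happ _ _)]/(X (hval (tword (map mono ys)))) -XZ ZZ.
- rewrite -[hval (happ _ _)]/(X (hval (tword (map mono ys)))) -XC.
  rewrite (deltaC_cobar (@deltaW_deg K g)); last exact: deltaW_anti.
  have -> (t1 t2 : tens (LLbar g) (LLbar g)) : tderiv X (t1 - t2) = tderiv X t1 - tderiv X t2.
    exact: linearB.
  rewrite cobar_mapE deltaU_tword.
  have -> : tderiv X (deltaZ W (ds spl (map mono ys) (fun u => hval (tword u)))) = 0.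
    transitivity (ds spl (map mono ys) (fun u => tderiv X (deltaZ W (hval (tword u))))).
      apply: etrans (_ : tderiv X (ds spl (map mono ys)
        (fun u => deltaZ W (hval (tword u)))) = _).
        by congr (tderiv X _); exact: (lsum_lin (deltaZ W)).
      exact: (lsum_lin (tderiv X)).
    by apply: ds_weight => // zs Hz; apply: ZZ; rewrite Hz.
  rewrite sub0r; apply/eqP; rewrite oppr_eq0; apply/eqP.
  transitivity (us (map mono ys) (fun L R => eps (wdeg L) *:
    ds spl R (fun R' => tderiv X (wpair L R')))).
    transitivity (tderiv X (us (map mono ys) (fun L R => eps (wdeg L) *:
      ds spl R (fun R' => wpair L R')))).
      congr (tderiv X _); apply: etrans (us_lin _ _ _) _; apply: eq_us1 => L R.
      rewrite tmap_wpair mul1r happ_gid.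
      by rewrite (happ_cobar_map _ R (tpair_hlinearR (tword L))).
    apply: etrans (us_lin (tderiv X) _ _) _; apply: eq_us1 => L R.
    apply: etrans (linearZ _ _) _; congr (_ *: _); exact: (lsum_lin (tderiv X)).
  rewrite /us -[RHS](lsum0 _ (unsh (map mono ys))).
  apply: eq_lsum_in => c /unsh_mono[ys1 [ys2 [-> -> Hf]]].
  rewrite ds_weight ?scaler0 // => [|zs Hz].
    move=> p' q' a x y z H; rewrite /wpair (mlinear_tpairR _ _ _ H).
    exact: tderiv_linear.
  apply: (tderiv_wpair_weight IH); rewrite Hz.
  by have := Hf size; rewrite -!/(weight _) => ->.
- exact: Xproj.
Qed.

Lemma coder_eq0 x : X x = 0.
Proof.
move: x; apply: tbar_mono_ind => [|a x y Hx Hy|ys]; first exact: raddf0.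
  by rewrite linearP Hx Hy scaler0 addr0.
exact: (coder_weight (ltnSn (weight ys))).
Qed.

End CoderivationUniqueness.

(** * The square of an odd coderivation *)

Section SquareCoderivation.
Variables (K : fieldType) (g : gmod K) (E : ghom (- 1) (LLbar g) (LLbar g)).
Local Notation W := (LLletter g).
Hypothesis EC : is_coderT E.

Lemma square_deg k (x : LLbar g) : gproj (LLbar g) k x = x ->
  gproj (LLbar g) (k + (- 1 - 1)) ((E \o E) x) = (E \o E) x.
Proof. by move=> /(ghomP E)/(ghomP E); rewrite addrA. Qed.

Definition square : ghom (- 1 - 1) (LLbar g) (LLbar g) :=
  @Ghom K _ _ _ (E \o E) square_deg.

(** E is odd, so the two cross terms E (x) E cancel. *)
Lemma tderiv_square t : tderiv square t = tderiv E (tderiv E t).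
Proof.
move: t; apply: tens_ext => [||x y]; first exact: tderiv_linear.
  exact: (linear_compp (tderiv_linear E) (tderiv_linear E)).
rewrite !tderiv_tpair.
have -> (t1 t2 : tens (LLbar g) (LLbar g)) : tderiv E (t1 + t2) = tderiv E t1 + tderiv E t2.
  exact: linearD.
rewrite tderivZ !tderiv_tpair -[hdeg (happ E x)]/(hdeg x - 1).
have -> : happ square x = happ E (happ E x) by apply: helt_eq => //; apply: addrA.
have -> : happ square y = happ E (happ E y) by apply: helt_eq => //; apply: addrA.
signs.
Qed.

Lemma square_deltaZ x : tderiv square (deltaZ W x) = deltaZ W (square x).
Proof. by have [EZ _] := EC; rewrite tderiv_square !EZ. Qed.

Lemma square_deltaC x :
  tderiv square (deltaC (deltaW g) x) = deltaC (deltaW g) (square x).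
Proof.
have [_ EE] := EC; rewrite tderiv_square.
rewrite -[square x]/(E (E x)) -EE -EE tderivZ scalerA -epsD.
by rewrite -[LHS]scale1r; congr (_ *: _); rewrite eps_oddz.
Qed.

End SquareCoderivation.

(** * The sh Lie relation *)

Section ShLieIdentity.
Variables (K : fieldType) (g : gmod K) (l : seq g -> g).
Hypothesis charK : [pchar K] =i pred0.
Hypothesis Hl : is_shLie l.
Local Notation V := (gshift g).
Local Notation W := (LLletter g).
Local Notation vword := (seq (helt V)).
Local Notation q := (q Hl).

(** Suspending t to a letter of W makes this an instance of [glue_deltaC]. *)
Lemma deltaS_ker (t : helt (Sbar V)) :
  deltaS V (hval t) = 0 -> sproj V (hval t) = 0 -> hval t = 0.
Proof.
move=> HD Hp; pose c : helt W := happ (susp _) t.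
have Hc : deltaC (deltaW g) (hval (tword [:: c])) = 0.
  rewrite deltaC_letter (sp_tens_lift _ _ (@wpair1_bilin _ g)).
  have -> : deltaW g (hval c) = 0.
    rewrite -[LHS]/(tmap (susp _) (susp _) (deltaS V (hval t))) HD.
    exact: raddf0.
  exact: raddf0.
have := glue_deltaC charK c; rewrite Hc raddf0.
by rewrite (hlinear0 (@sword_mlinear _ V [::] [::] : hlinear _)) // subr0.
Qed.

Variable n : nat.

(** This is an explicit model of the coderivation induced by the operation of arity n; the sh Lie
    structure only supplies it abstractly. *)
Definition arity_fun (z : vword) : Sbar V :=
  us z (fun L R => if size L == n then hval (sword (q L :: R)) else 0).

Lemma arity_mlinear (M : lmodType K) (Psi : helt V -> M) : hlinear Psi ->
  mlinear (fun L => if size L == n then Psi (q L) else 0).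
Proof.
move=> H p r a x y z Hx; rewrite !size_cat /=; case: ifP => _.
  exact/H/q_hlin.
by rewrite scaler0 addr0.
Qed.

Lemma arity_gsym_letter (M : lmodType K) (Psi : helt V -> M) : hlinear Psi ->
  gsym (fun L => if size L == n then Psi (q L) else 0).
Proof.
move=> H p x y r; have -> : size (p ++ y :: x :: r) = size (p ++ x :: y :: r).
  by rewrite !size_cat.
by case: ifP => _; rewrite ?scaler0 // (q_gsym Hl H).
Qed.

Lemma sword_cons_hlinear R : hlinear (fun t : helt V => hval (sword (t :: R))).
Proof. exact: (@sword_mlinear _ V [::] R). Qed.

Lemma arity_mlin : mlin arity_fun.
Proof.
apply: mlinear_mlin.
  rewrite /arity_fun us_nil; case: ifP => // _.
  by apply: (hlinear0 (sword_cons_hlinear [::])).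
apply: us_mlinear; split=> [R|L]; first exact: arity_mlinear (sword_cons_hlinear R).
case: (size L == n); first exact: (mlinear_prefix [:: q L] (@sword_mlinear _ V)).
by move=> p r a x y z _; rewrite scaler0 addr0.
Qed.

Lemma arity_gsym : gsym arity_fun.
Proof.
apply: us_gsym; split=> [R|L]; first exact: arity_gsym_letter (sword_cons_hlinear R).
case: (size L == n); first exact: (gsym_prefix [:: q L] (@sword_gsym _ V)).
by move=> p x y r; rewrite scaler0.
Qed.

Definition arity_lin : {linear Sbar V -> Sbar V} := sword_lift arity_mlin arity_gsym.

Lemma arityE z : arity_lin (hval (sword z)) = arity_fun z.
Proof. exact: sword_liftE. Qed.

Lemma arity_deg k (x : Sbar V) : gproj (Sbar V) k x = x ->
  gproj (Sbar V) (k - 1) (arity_lin x) = arity_lin x.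
Proof.
move: k x; apply: ghom_gen => z; rewrite -[pgen _ _]/(hval (sword z)) arityE.
rewrite us_lin; apply: eq_us => L R Ez _; case: ifP => _; last exact: raddf0.
rewrite -[RHS]heltP -[hdeg (sword _)]/(wdeg (q L :: R)) wdeg_cons.
by rewrite -[hdeg (q L)]/(wdeg L - 1) -Ez; congr (gproj _ _ _); ring.
Qed.

Definition arity_map : ghom (- 1) (Sbar V) (Sbar V) := Ghom arity_deg.

Lemma arity_mapE z : arity_map (hval (sword z)) = arity_fun z.
Proof. exact: arityE. Qed.

Lemma happ_arity_map (M : lmodType K) (Psi : helt (Sbar V) -> M) z :
  hlinear Psi -> Psi (happ arity_map (sword z)) =
  us z (fun L R => if size L == n then Psi (sword (q L :: R)) else 0).
Proof.
move=> H; pose s := [seq c <- unsh z | size c.2.1 == n].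
have Es (N : lmodType K) (f : vword -> vword -> N) : lsum s (fun p => f p.1 p.2) =
    us z (fun L R => if size L == n then f L R else 0).
  rewrite /lsum big_filter big_mkcond; apply: eq_bigr => c _.
  by case: ifP; rewrite ?scaler0.
rewrite -(Es _ (fun L R => Psi (sword (q L :: R)))).
apply: (hlinear_lsum_val (h := fun p => sword (q p.1 :: p.2)) H).
  move=> c; rewrite mem_filter => /andP[_ /unsh_deg Hc].
  rewrite -[LHS]/(wdeg (q c.2.1 :: c.2.2)) wdeg_cons -[hdeg (q _)]/(wdeg _ - 1).
  by rewrite -[RHS]/(wdeg z - 1) -Hc addrAC.
by rewrite (Es _ (fun L R => hval (sword (q L :: R)))); exact: arity_mapE.
Qed.

Lemma arity_coder : is_coderS arity_map.
Proof.
move=> x; move: x; apply: sbar_ext => [||z].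
- exact: (linear_compp (tderiv_linear arity_map) (linearP (deltaS V))).
- exact: (linear_compp (linearP (deltaS V)) (linearP arity_map)).
pose T A B : tens (Sbar V) (Sbar V) := tpair (sword A) (sword B).
have -> : deltaS V (arity_map (hval (sword z))) =
    us z (fun L t => us t (fun A B => if size L == n then T (q L :: A) B else 0)) +
    us z (fun L t => us t (fun A B =>
      if size L == n then eps ((wdeg L - 1) * wdeg A) *: T A (q L :: B) else 0)).
  rewrite arity_mapE; apply: etrans (us_lin _ _ _) _; rewrite -usD.
  apply: eq_us1 => L t; case: ifP => _; last by rewrite raddf0 !us0 addr0.
  by rewrite deltaS_sword us_cons.
rewrite deltaS_sword; apply: etrans (us_lin (tderiv arity_map) _ _) _.
rewrite -us_coassoc.
have -> : us z (fun L t => us t (fun A B =>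
      if size L == n then eps ((wdeg L - 1) * wdeg A) *: T A (q L :: B) else 0)) =
    us z (fun A t => us t (fun L B =>
      if size L == n then eps (wdeg A) *: T A (q L :: B) else 0)).
  rewrite -us_coassoc -[RHS]us_coassoc; apply: eq_us1 => u B.
  rewrite us_comm; apply: eq_us1 => A L; case: ifP => _; rewrite ?scaler0 //.
  by rewrite scalerA -epsD; congr (_ *: _); apply: eps_par; par.
rewrite -usD; apply: eq_us1 => A B.
apply: etrans (tderiv_tpair _ _ _) _; congr (_ + _).
  exact: (happ_arity_map A (tpair_hlinearL (sword B))).
rewrite (happ_arity_map B (tpair_hlinearR (sword A))) -usZ.
apply: eq_us1 => L R; case: ifP => _; rewrite ?scaler0 //.
by congr (_ *: _); apply: eps_par; rewrite oddzE.
Qed.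

(** Both are coderivations with the same projection to V. By induction on the length their
    difference lies in the kernel of the coproduct, where [deltaS_ker] applies. *)
Lemma shLie_coder_arity (D : ghom (- 1) (Sbar V) (Sbar V)) z : (0 < n)%N ->
  shLie_coder l n D -> D (hval (sword z)) = arity_fun z.
Proof.
move=> n0 [DC Dp]; have [k] := ubnP (size z); elim: k z => [//|k IH] z.
rewrite ltnS => Hz; apply/eqP; rewrite -subr_eq0 -arity_mapE; apply/eqP.
pose X : {linear Sbar V -> Sbar V} := D \- arity_map.
have Xdeg : gproj (Sbar V) (wdeg z - 1) (X (hval (sword z))) = X (hval (sword z)).
  rewrite -[X _]/(D (hval (sword z)) - arity_map (hval (sword z))).
  have H : gproj (Sbar V) (wdeg z) (hval (sword z)) = hval (sword z) := heltP (sword z).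
  rewrite -[X in _ = X - _](ghomP D H) -[X in _ = _ - X](ghomP arity_map H).
  exact: linearB.
apply: (deltaS_ker (t := Helt Xdeg)).
  rewrite -[hval _]/(D (hval (sword z)) - arity_map (hval (sword z))) raddfB.
  rewrite -[X in X - _]DC -[X in _ - X]arity_coder deltaS_sword.
  apply/eqP; rewrite subr_eq0; apply/eqP.
  apply: etrans (us_lin (tderiv D) _ _) _.
  apply: etrans (esym (us_lin (tderiv arity_map) _ _)).
  apply: eq_us => L R _ Hs.
  apply: etrans (tderiv_tpair D _ _) (etrans _ (esym (tderiv_tpair arity_map _ _))).
  case: L Hs => [|x L] Hs.
    by rewrite !(tpair0l _ (sword_nil V)) !tpair0l ?scaler0 // -[hval _]/(gfun _ _) sword_nil raddf0.
  case: R Hs => [|y R] Hs.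
    by rewrite !(tpair0r _ (sword_nil V)) !tpair0r ?scaler0 // -[hval _]/(gfun _ _) sword_nil raddf0.
  have E w : (size w < k)%N -> happ D (sword w) = happ arity_map (sword w).
    move=> Hw; apply: helt_eq => //.
    by rewrite -[LHS]/(D (hval (sword w))) -[RHS]/(arity_map (hval (sword w))) IH // arity_mapE.
  by rewrite !E //; move: Hs Hz => /=; lia.
transitivity (sproj V (D (hval (sword z))) - sproj V (arity_map (hval (sword z)))).
  exact: linearB.
have := Dp (map (@desus K g) z); rewrite map_sus_desus size_map => ->.
apply/eqP; rewrite subr_eq0 arity_mapE; apply/eqP.
have -> : sproj V (arity_fun z) = if size z == n then hval (q z) else 0.
  rewrite /arity_fun -[RHS](us_nilr z (fun L => if size L == n then hval (q L) else 0)).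
  rewrite us_lin; apply: eq_us1 => L R; case: ifP => _.
    by rewrite sword_liftE; case: R.
  by rewrite raddf0; case: R.
case: ifP => // /eqP Ez; rewrite /shLie_map map_sus_desus map_hval_desus -Ez.
case: (z) Ez => [|t r] Ez; first by rewrite -Ez in n0.
rewrite -[RHS]/(eps (shift_exp (map (@hdeg K V) (t :: r))) *:
  (l (map (@hval K V) (t :: r)) : V)).
by rewrite /shift_exp size_map.
Qed.

End ShLieIdentity.

Section ShLieRelation.
Variables (K : fieldType) (g : gmod K) (l : seq g -> g).
Hypothesis charK : [pchar K] =i pred0.
Hypothesis Hl : is_shLie l.
Local Notation V := (gshift g).
Local Notation vword := (seq (helt V)).
Local Notation q := (q Hl).

Lemma shLie_relation (z : vword) : us z (fun L R => hval (q (q L :: R))) = 0.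
Proof.
have [D [E [HD HE EE]]] := shLie_square Hl.
pose Q z := us z (fun L R => hval (sword (q L :: R))).
have EQ y : E (hval (sword y)) = Q y.
  have [N HN] := HE (hval (sword y)).
  rewrite (HN (maxn N (size y).+1)) ?leq_maxl //.
  transitivity (\sum_(1 <= m < maxn N (size y).+1) arity_fun Hl m y).
    apply: eq_big_nat => m /andP[m0 _].
    exact: (shLie_coder_arity charK Hl y m0 (HD m m0)).
  rewrite /arity_fun /us /lsum exchange_big; apply: eq_big_seq => c /unsh_size Hc /=.
  rewrite -scaler_sumr; congr (_ *: _).
  (* Summing over the arities selects m equal to the length of the left part. The sum starts at 1,
     which omits only the empty left part, where q is 0. *)
  rewrite -big_mkcond (eq_bigl (fun m => m == size c.2.1)) => [|m]; last exact: eq_sym.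
  rewrite big_nat1_eq; case: ifP => // /negbT; rewrite negb_and -ltnNge ltnS leqn0 -leqNgt.
  case/orP => [/eqP/size0nil E0|Hs].
    rewrite E0; symmetry; apply: (hlinear0 (sword_cons_hlinear (g := g) c.2.2)).
    by [].
  move: Hs; rewrite geq_max => /andP[_]; rewrite -Hc -addnS => Hs; exfalso.
  by move: Hs; rewrite leqNgt addnS ltnS leq_addr.
have := EE (hval (sword z)); rewrite EQ => H0.
have <- : sproj V (E (Q z)) = us z (fun L R => hval (q (q L :: R))).
  rewrite /Q us_lin us_lin; apply: eq_us1 => L R; rewrite EQ /Q us_lin.
  rewrite -[RHS](us_nilr (q L :: R) (fun y => hval (q y))); apply: eq_us1 => A B.
  by rewrite sword_liftE; case: B.
by rewrite H0 raddf0.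
Qed.

End ShLieRelation.

(** * The square of the codifferential *)

Section SymmetricEvaluation.
Variables (K : fieldType) (V : gmod K) (M : lmodType K).
Local Notation word := (seq (helt V)).

Lemma gsym_move (Phi : word -> M) p t u r : gsym Phi ->
  Phi (p ++ t :: u ++ r) = eps (hdeg t * wdeg u) *: Phi (p ++ u ++ t :: r).
Proof.
move=> H; elim: u p => [|x u IH] p; first by rewrite wdeg_nil mulr0 eps0 scale1r.
rewrite cat_cons H; have := IH (p ++ [:: x]); rewrite -!catA /= => ->.
by rewrite wdeg_cons mulrDr scalerA epsD.
Qed.

(** For symmetric Phi the block may be moved to the end. The blocks for all places of the last
    letter then run through the unshuffles (u, v) with v nonempty, and F [::] = 0 adds the missing
    one. *)
Lemma Ds_gsym (F : word -> helt V) (Phi : word -> M) w :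
  (forall u, hdeg (F u) = wdeg u - 1) -> hval (F [::]) = 0 ->
  mlinear Phi -> gsym Phi ->
  Ds F w Phi = us w (fun u v => eps (wdeg u) *: Phi (u ++ [:: F v])).
Proof.
move=> Fdeg F0; elim/last_ind: w Phi => [|w x IH] Phi HL HS.
  by rewrite Ds_nil us_nil (mlinear0 [::] [::] HL) ?scaler0.
rewrite -cats1 Ds_rcons us_rcons; congr (_ + _).
rewrite IH; [|exact: mlinear_suffix|exact: gsym_suffix].
apply: eq_us1 => u v; rewrite -!catA /= HS Fdeg !scalerA -!epsD.
by rewrite wdeg_cat wdeg_cons wdeg_nil; congr (_ *: _); apply: eps_par; par.
Qed.

End SymmetricEvaluation.

Section SquareZero.
Variables (K : fieldType) (g : gmod K) (l : seq g -> g).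
Hypothesis charK : [pchar K] =i pred0.
Hypothesis Hl : is_shLie l.
Variable d : ghom 1 g g.
Hypothesis d2 : forall x, d (d x) = 0.
Hypothesis dl : is_derivation l d.
Local Notation V := (gshift g).
Local Notation W := (LLletter g).
Local Notation vword := (seq (helt V)).
Local Notation wword := (seq (helt W)).
Local Notation mono := (@mono K g).
Local Notation q := (q Hl).
Local Notation th := (th d).
Local Notation chi0 := (@chi_one0 K).
Local Notation F := (F Hl d chi0).
Local Notation gam := (gam Hl d (@chi_one K)).
Local Notation E := (LLcoder Hl d chi0).

Definition qv (z : vword) : V := hval (q z).

Lemma qv_mlinear : mlinear qv.
Proof. exact: (qval_mlinear Hl). Qed.

Lemma qv_gsym : gsym qv.
Proof. exact: (qval_gsym Hl). Qed.

Lemma us_map_th (M : lmodType K) (w : wword) (Phi : vword -> vword -> M) :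
  us w (fun L R => Phi (map th L) (map th R)) = us (map th w) Phi.
Proof.
elim: w Phi => [|x w IH] Phi; first by rewrite !us_nil.
rewrite /= !us_cons th_deg -(IH (fun L R => Phi (th x :: L) R)); congr (_ + _).
by rewrite -IH; apply: eq_us1 => L R; rewrite wdeg_th.
Qed.

Definition f_val (w : wword) : V := sproj V (tproj W (E (hval (tword w)))).

Lemma f_val_mono u y : y != [::] ->
  f_val (u ++ [:: mono y]) = eps (wdeg u) *: qv (map th u ++ y).
Proof.
case: y => // t y _; rewrite /f_val sproj_LLcoder /chi_one.
by rewrite mulr1.
Qed.

Lemma f_val_hlinear u : hlinear (fun x => f_val (u ++ [:: x])).
Proof.
move=> a x y z H; rewrite /f_val (@tword_mlinear _ W u [::] _ _ _ _ H).
exact: (linear_compp (linearP (sproj V)) (linear_compp (linearP (tproj W)) (linearP E))).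
Qed.

Lemma dv_th_qv v y :
  dv (dV d) (map th v ++ y) qv =
  eps (wdeg v) *: dv (dV d) y (fun u => qv (map th v ++ u)).
Proof.
rewrite dv_cat wdeg_th [X in X + _](_ : _ = 0) ?add0r //.
elim: v (qv) qv_mlinear => [|x v IH] Phi HP; first exact: dv_nil.
rewrite /= dv_cons (mlinear0 [::] _ HP) ?add0r; last exact: dV_th.
by rewrite (IH (fun u => Phi (th x :: u)) (mlinear_prefix [:: th x] HP)) scaler0.
Qed.

(* Since d is a derivation, everything cancels except when the last letter has
   arity one: there chi_one puts no term into gam. *)
Lemma gam_th_F ys :
  hval (gam (map mono ys)) - hval (th (F (map mono ys))) = qv (map th (map mono ys)).
Proof.
case/lastP: ys => [|ys y].
  by rewrite -[hval (th _)]/(- dV d (sproj V 0)) !raddf0 addr0.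
rewrite map_rcons -cats1; set v := map mono ys.
have -> : hval (gam (v ++ [:: mono y])) = chi_one K (size v).+1 (size y).-1 *:
    dv (dV d) y (fun u => qv (map th v ++ u)).
  by apply: (gam_mono Hl d (@chi_one K) (Psi := fun t => hval t : V)) => a x z t [_ _ ->].
have -> : hval (th (F (v ++ [:: mono y]))) = - (eps (wdeg v) *: (chi_one K (size v) (size y) *:
    dV d (qv (map th v ++ y)))).
  have -> : hval (th (F (v ++ [:: mono y]))) = - dV d (f_val (v ++ [:: mono y])).
    by rewrite /f_val tproj_LLcoder.
  rewrite /f_val sproj_LLcoder -scalerA; congr (- _).
  have Z (a : K) (x : V) : dV d (a *: x) = a *: dV d x by exact: linearZ.
  by rewrite !Z.
have -> : dV d (qv (map th v ++ y)) = - dv (dV d) (map th v ++ y) qv.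
  exact: qval_deriv.
rewrite dv_th_qv map_cat; set D := dv _ _ _.
have -> : - (eps (wdeg v) *: (chi_one K (size v) (size y) *: (- (eps (wdeg v) *: D)))) =
    chi_one K (size v) (size y) *: D.
  by rewrite !scalerN opprK 2!scalerA mulrAC eps_sqr mul1r.
rewrite /chi_one /D; case: y {D} => [|y0 [|y1 y]].
- rewrite dv_nil !scaler0 subrr; symmetry.
  by apply: (mlinear0 _ [::] qv_mlinear); apply: th_mono0.
- rewrite scale0r scale1r sub0r dv_cons dv_nil scaler0 addr0 -scaleN1r; symmetry.
  apply: hlinear_scale (qv_mlinear (map th v) [::]) _ _.
    by rewrite th_deg hdeg_mono wdeg_cons wdeg_nil addr0.
  by rewrite th_mono1 scaleN1r.
rewrite subrr; symmetry.
by apply: (mlinear0 _ [::] qv_mlinear); apply: th_mono0.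
Qed.

(** Either the block of the first application ends before x, which stays the last letter, or it
    contains x. *)
Lemma f_val_E w x : sproj V (tproj W (E (E (hval (tword (w ++ [:: x])))))) =
  Ds F w (fun u => f_val (u ++ [:: x])) +
  us w (fun u v => eps (wdeg u) *: f_val (u ++ [:: F (v ++ [:: x])])).
Proof.
rewrite [in X in tproj W (E X)]LLcoderE -Ds_rcons.
have L : linear (fun t => sproj V (tproj W (E t))).
  exact: (linear_compp (linearP (sproj V)) (linear_compp (linearP (tproj W)) (linearP E))).
pose f : {linear LLbar g -> V} := HB.pack (fun t => sproj V (tproj W (E t)))
  (GRing.isLinear.Build K (LLbar g) V _ _ L).
exact: (lsum_lin f).
Qed.

Lemma gsym_qv_th y : gsym (fun u => qv (map th u ++ y)).
Proof.
by move=> p a b r; rewrite !map_cat /= -!catA /= qv_gsym !th_deg.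
Qed.

Lemma Ds_f_val w y : y != [::] ->
  Ds F w (fun u => f_val (u ++ [:: mono y])) =
  - us w (fun u v => eps (wdeg v) *: qv (map th u ++ th (F v) :: y)).
Proof.
move=> Hy; have -> : Ds F w (fun u => f_val (u ++ [:: mono y])) =
    eps (wdeg w + 1) *: Ds F w (fun u => qv (map th u ++ y)).
  rewrite -DsZ; apply: eq_Ds => [//|u Hu]; rewrite f_val_mono // Hu.
  by congr (_ *: _); apply: eps_par; par.
rewrite (Ds_gsym w (@F_deg _ _ _ Hl d _ chi0) _ _ (gsym_qv_th y)); last 2 first.
- by [].
- exact: (mlinear_th d (mlinear_suffix y qv_mlinear)).
rewrite -usZ -usN; apply: eq_us => u v Hw _.
rewrite map_cat -catA /= -Hw; signs.
Qed.

Lemma f_val_F u v y : y != [::] ->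
  eps (wdeg u) *: f_val (u ++ [:: F (v ++ [:: mono y])]) =
  eps (wdeg v) *: (us y (fun A R => chi_one K (size v) (size A) *:
      qv (map th u ++ q (map th v ++ A) :: R)) + qv (map th u ++ gam v :: y)).
Proof.
move=> Hy; rewrite (F_mono Hl d chi0 (Psi := fun x => f_val (u ++ [:: x])) v y (f_val_hlinear u)).
rewrite scalerA mulrC -scalerA; congr (_ *: _).
case: y Hy => // t y _; rewrite scalerDr f_val_mono // scalerA eps_sqr scale1r.
congr (_ + _); rewrite -usZ; apply: eq_us1 => A R.
by rewrite f_val_mono // !scalerA mulrCA eps_sqr mulr1.
Qed.

(** The relation on z y, with the inner operation moved back past the remaining letters of z and the
    two parts of z exchanged, has the shape of the terms in [f_val_F]. *)
Lemma shLie_relation_cat z y :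
  us z (fun L R => eps (wdeg R) *: us y (fun A B => qv (L ++ q (R ++ A) :: B))) = 0.
Proof.
have := shLie_relation charK Hl (z ++ y); rewrite us_cat => H0.
rewrite us_comm -[RHS](scaler0 _ (eps (wdeg z))) -[in RHS]H0 -usZ.
apply: eq_us => L R HLR _; rewrite scalerA -!usZ; apply: eq_us1 => A B.
rewrite -/(qv _).
have := gsym_move [::] (q (L ++ A)) R B qv_gsym; rewrite /= => ->.
rewrite -[hdeg (q _)]/(wdeg _ - 1) wdeg_cat -HLR; signs.
Qed.

(* The collected terms form the sh Lie relation on the word theta(w) y. *)
Lemma f_val_square ys y :
  sproj V (tproj W (E (E (hval (tword (map mono ys ++ [:: mono y])))))) = 0.
Proof.
have [->|Hy] := eqVneq y [::].
  rewrite (mlinear0 (map mono ys) [::] (@tword_mlinear _ W) (mono_nil g)).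
  by rewrite !raddf0.
rewrite f_val_E Ds_f_val //; set w := map mono ys.
rewrite -usN -usD -[RHS](shLie_relation_cat (map th w) y) -us_map_th.
apply: eq_lsum_in => c /unsh_mono[ys1 [ys2 [-> -> _]]].
set u := map mono ys1; set v := map mono ys2.
rewrite f_val_F // -scalerN -scalerDr wdeg_th; congr (_ *: _).
have Hq : hlin (- 1) (th (F v)) (gam v) (q (map th v)).
  have Eq : hdeg (q (map th v)) = wdeg v - 1 by rewrite -(wdeg_th d v).
  split; rewrite ?Eq ?th_deg //.
  by rewrite scaleN1r addrC gam_th_F.
have := qv_mlinear (map th u) y Hq; rewrite scaleN1r => E1.
(* By [chi_one] the sum over (A, R) lacks the terms with A empty; the difference of [gam v] and
   [th (F v)], which is q(th v), supplies them. *)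
rewrite addrA addrAC -{}E1 -(us_nill y (fun R => qv (map th u ++ q (map th v) :: R))) -usD.
apply: eq_us1 => A R; rewrite /chi_one; case: A => [|t A] /=.
  by rewrite scale0r addr0 cats0.
by rewrite scale1r add0r.
Qed.

Lemma LLcoder_square x : E (E x) = 0.
Proof.
have EC := LLcoder_coder charK Hl d2 chi0.
apply: (coder_eq0 charK (X := square E)).
- exact: square_deltaZ.
- exact: square_deltaC.
elim/last_ind => [|ys y _].
  by rewrite -[square E _]/(E (E _)) LLcoder_nil !raddf0.
by rewrite map_rcons -cats1; apply: f_val_square.
Qed.

End SquareZero.

Theorem theorem6p8 (K : fieldType) (charK : [pchar K] =i pred0) (g : gmod K)
    (l : seq g -> g) (Hl : is_shLie l)
    (d : ghom 1 g g) (d2 : forall x, d (d x) = 0) (dl : is_derivation l d) :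
  exists (D : nat -> nat -> ghom (- 1) (LLbar g) (LLbar g))
         (E : ghom (- 1) (LLbar g) (LLbar g)),
    [/\ forall m i, (i < m)%N -> derived_coder l d m i (D m i),
        is_locsum (fun m x => \sum_(0 <= i < m) D m i x) E
      & is_LLinf E].
Proof.
exists (fun m i => LLcoder Hl d (chi_delta0 K m i)), (LLcoder Hl d (@chi_one0 K)).
split; last split.
- exact: (LLcoder_derived charK Hl d2).
- exact: LLcoder_locsum.
- exact: LLcoder_coder.
exact: LLcoder_square.
Qed.
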